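(* Let $N\in\mathbb{N}$, $N\ge1$, and let $f\in L^2(\mathbb{R})$ be of the form $f(x)=\frac1{2\pi}\int_{\mathbb{R}}e^{-ixy}\hat f(y)\,dy$, $x\in\mathbb{R}$, with $\hat f\in L^2(\mathbb{R})$ compactly supported, extended to an entire function on $\mathbb{C}$ by the same formula. For any $M\in\mathbb{N}$, $M\ge1$, let $\beta=(-1)^{MN+1}(2MN)!$. Then the solution of the initial value problem $$\partial_t u(t,x)=-B^Nu(t,x),\qquad u(t_0,x)=f(x),\qquad t\ge t_0,\ x\in\mathbb{R},$$ is given by $$u(t,x)=\lim_{m\to\infty}\lim_{n\to\infty}\mathbb{E}\Big[f\Big(x+W_n^{2MN,\beta}\big(S_m^{\frac1{2M}}(t-t_0)\big)\Big)\Big].$$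
   Context: Fourier transform convention: $\hat f(y)=\int_{\mathbb{R}}e^{ixy}f(x)\,dx$ for $f\in L^1(\mathbb{R})$. $B^N$ is the operator on $L^2(\mathbb{R})$ with $\widehat{B^Nf}(y)=|y|^N\hat f(y)$ and domain $\{f\in L^2(\mathbb{R}):\int y^{2N}|\hat f(y)|^2dy<\infty\}$. The solution of the initial value problem is the one given by the associated strongly continuous contraction semigroup $e^{-(t-t_0)B^N}$ on $L^2(\mathbb{R})$ applied to $f$. Random walks: for an integer $K\ge2$ and $\beta\in\mathbb{C}$, let $\xi_{K,\beta}$ be uniformly distributed on the $K$-th roots of $\beta$, i.e. $\mathbb{E}[g(\xi_{K,\beta})]=\frac1K\sum_{k=0}^{K-1}g(\beta^{1/K}e^{2\pi i k/K})$ for every $g:\mathbb{C}\to\mathbb{C}$ (with $\beta^{1/K}$ a fixed $K$-th root). Let $(\xi_j)_{j\ge1}$ be i.i.d. copies and $W_n^{K,\beta}(t)=n^{-1/K}\sum_{j=1}^{\lfloor nt\rfloor}\xi_j$, $t\ge0$. Approximate subordinators: for $\alpha\in(0,1)$, $t\ge 0$ and integer $m\ge2$, $S_m^\alpha(t)=\frac1m\sum_{j=0}^{X}Y_j$, where $X$ is Poisson with parameter $\lambda t m^{2\alpha}$, $\lambda=1/\Gamma(1-\alpha)$, and $Y_0,Y_1,\dots$ are i.i.d., independent of $X$, with density $c_m y^{-\alpha-1}\mathbf 1_{(1/m,m^2)}(y)$, $c_m=\frac{\alpha}{m^\alpha(1-m^{-3\alpha})}$. The walk and $S_m^\alpha(t)$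 are independent. *)

(* Defs.v *)
From HB Require Import structures.
From mathcomp Require Export all_boot all_order all_algebra.
From mathcomp Require Export complex.
From mathcomp Require Export finmap.
From mathcomp Require Export all_classical all_reals all_analysis.

Set Implicit Arguments.
Unset Strict Implicit.
Unset Printing Implicit Defensive.

Import Order.TTheory GRing.Theory Num.Theory.
Import numFieldNormedType.Exports.
Import ComplexField.

Local Open Scope classical_set_scope.
Local Open Scope complex_scope.
Local Open Scope ring_scope.

(* The library puts a topology on R[i] through its regular-module alias
   R[i]^o; this is convergence of complex sequences for the modulus. *)
Definition ccvg {R : realType} (u : nat -> R[i]) (l : R[i]) : Prop :=
  (u : nat -> R[i]^o) @ \oo --> (l : R[i]^o).

Definition iterated_lim {R : realType} (a : nat -> nat -> R[i]) (l : R[i])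
    : Prop :=
  exists v : nat -> R[i],
    (forall m, (2 <= m)%N -> ccvg (a m) (v m)) /\ ccvg v l.

Definition cexp {R : realType} (z : R[i]) : R[i] :=
  (expR (complex.Re z) * cos (complex.Im z)) +i*
  (expR (complex.Re z) * sin (complex.Im z)).

Definition cintegral {d} {T : measurableType d} {R : realType}
    (mu : {measure set T -> \bar R}) (f : T -> R[i]) : R[i] :=
  (\int[mu]_x complex.Re (f x)) +i* (\int[mu]_x complex.Im (f x)).

Definition cexpectation {d} {T : measurableType d} {R : realType}
    (P : probability T R) (X : T -> R[i]) : R[i] :=
  fine 'E_P[fun w => complex.Re (X w)] +i* fine 'E_P[fun w => complex.Im (X w)].

(* R[i] carries no measurable structure in the library: its Borel
   sigma-algebra is that of R * R under this identification. *)
Definition cpair {R : realType} (z : R[i]) : R * R :=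
  (complex.Re z, complex.Im z).

(* Elements of L^2(R; C) are handled through representatives; the norm is
   +oo%E outside L^2. *)
Definition L2norm {R : realType} (f : R -> R[i]) : \bar R :=
  Lnorm (@lebesgue_measure R) 2%:E (fun x => (Normc.normc (f x))%:E).

Definition L2 {R : realType} (f : R -> R[i]) : Prop :=
  measurable_fun setT (cpair \o f) /\ (L2norm f < +oo)%E.

Definition aeeq {R : realType} (f g : R -> R[i]) : Prop :=
  {ae @lebesgue_measure R, forall x, f x = g x}.

Definition fourier {R : realType} (f : R -> R[i]) (y : R) : R[i] :=
  cintegral (@lebesgue_measure R) (fun x => cexp ('i%C * (x * y)%:C) * f x).

Definition inverse_fourier {R : realType} (F : R -> R[i]) (z : R[i]) : R[i] :=
  ((2 * pi)^-1)%:C *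
  cintegral (@lebesgue_measure R) (fun y => cexp (- ('i%C * z * y%:C)) * F y).

Definition truncate {R : realType} (r : R) (f : R -> R[i]) (x : R) : R[i] :=
  if `|x| <= r then f x else 0.

(* F is the Fourier-Plancherel transform of f in L^2: the L^2-limit of the
   L^1 transforms of the truncations of f. *)
Definition is_fourier {R : realType} (f F : R -> R[i]) : Prop :=
  [/\ L2 f, L2 F &
      L2norm (fun y => fourier (truncate r f) y - F y) @[r --> +oo] --> 0%E].

(* "f is in the domain of B^N and B^N f = h" *)
Definition BN_graph {R : realType} (N : nat) (f h : R -> R[i]) : Prop :=
  exists F : R -> R[i],
    [/\ is_fourier f F,
        (\int[@lebesgue_measure R]_y
            (y ^+ (2 * N) * Normc.normc (F y) ^+ 2)%:E < +oo)%E &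
        is_fourier h (fun y => (`|y| ^+ N)%:C * F y)].

(* Operators act on representatives; linearity and contractivity force them to
   respect almost everywhere equality. *)
Record contraction_semigroup {R : realType}
    (T : R -> (R -> R[i]) -> (R -> R[i])) : Prop := ContractionSemigroup {
  csg_L2 : forall t f, 0 <= t -> L2 f -> L2 (T t f);
  csg_linear : forall t (a : R[i]) f g, 0 <= t -> L2 f -> L2 g ->
    aeeq (T t (fun x => a * f x + g x)) (fun x => a * T t f x + T t g x);
  csg_contraction : forall t f, 0 <= t -> L2 f ->
    (L2norm (T t f) <= L2norm f)%E;
  csg_0 : forall f, L2 f -> aeeq (T 0 f) f;
  csg_add : forall s t f, 0 <= s -> 0 <= t -> L2 f ->
    aeeq (T (s + t) f) (T s (T t f));
  csg_continuous : forall f, L2 f ->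
    L2norm (fun x => T h f x - f x) @[h --> 0^'+] --> 0%E
}.

(* "f is in the domain of the generator of T, which maps f to g" *)
Definition generator_graph {R : realType}
    (T : R -> (R -> R[i]) -> (R -> R[i])) (f g : R -> R[i]) : Prop :=
  [/\ L2 f, L2 g &
      L2norm (fun x => (h^-1)%:C * (T h f x - f x) - g x)
        @[h --> 0^'+] --> 0%E].

(* T is the semigroup exp(- t B^N): equality, domains included, of its
   generator with - B^N. *)
Definition generated_by_opp_BN {R : realType} (N : nat)
    (T : R -> (R -> R[i]) -> (R -> R[i])) : Prop :=
  contraction_semigroup T /\
  forall f g, generator_graph T f g <-> BN_graph N f (fun x => - g x).

Definition mutually_independent {d} {T : measurableType d} {R : realType}
    (P : probability T R) (I : choiceType) (G : I -> set (set T)) : Prop :=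
  forall (J : {fset I}) (A : I -> set T),
    (forall i, i \in J -> G i (A i)) ->
    P (\bigcap_(i in [set` J]) A i) = (\prod_(i <- J) P (A i))%E.

Definition sigma_of {d d'} {T : measurableType d} {T' : measurableType d'}
    (X : T -> T') : set (set T) :=
  [set X @^-1` A | A in measurable].

(* i.i.d. variables, uniform on the K-th roots b * exp(2 i pi k / K) of b^K;
   xi j stands for the step of index j + 1. *)
Record root_steps {d} {T : measurableType d} {R : realType}
    (P : probability T R) (K : nat) (b : R[i]) (xi : nat -> T -> R[i]) : Prop :=
  RootSteps {
  rs_measurable : forall j, measurable_fun setT (cpair \o xi j);
  rs_uniform : forall j (g : R[i] -> R[i]),
    cexpectation P (g \o xi j) =
    K%:R^-1 *
    \sum_(k < K) g (b * cexp ('i%C * (2 * pi * k%:R / K%:R)%:C));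
  rs_independent :
    mutually_independent P (fun j => sigma_of (cpair \o xi j))
}.

(* Num.truncn is the floor of n * s, as a natural number. *)
Definition walk {T : Type} {R : realType} (K : nat) (xi : nat -> T -> R[i])
    (n : nat) (s : R) (w : T) : R[i] :=
  (n%:R `^ (- K%:R^-1))%:C * \sum_(j < Num.truncn (n%:R * s)) xi j w.

(* The sigma-algebra of the whole process s |-> walk K xi n s. *)
Definition sigma_walk {d} {T : measurableType d} {R : realType} (K : nat)
    (xi : nat -> T -> R[i]) (n : nat) : set (set T) :=
  <<s \bigcup_(s in [set s : R | 0 <= s]) sigma_of (cpair \o walk K xi n s) >>.

Definition Gamma {R : realType} (a : R) : R :=
  \int[@lebesgue_measure R]_(x in `]0, +oo[) (x `^ (a - 1) * expR (- x)).

Definition jump_density {R : realType} (alpha : R) (m : nat) (y : R) : R :=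
  alpha / (m%:R `^ alpha * (1 - m%:R `^ (- (3 * alpha)))) *
  y `^ (- alpha - 1) * \1_(`]m%:R^-1, m%:R ^+ 2[%classic) y.

(* The Poisson law is written out because the library's poisson_pmf is
   constantly 1 at rate 0, which occurs at t = 0. *)
Record subordinator_data {d} {T : measurableType d} {R : realType}
    (P : probability T R) (alpha t : R) (m : nat)
    (X : {RV P >-> nat}) (Y : nat -> {RV P >-> R}) : Prop :=
  SubordinatorData {
  sd_poisson : forall k,
    P (X @^-1` [set k]) =
    (let rate := (Gamma (1 - alpha))^-1 * t * m%:R `^ (2 * alpha) in
     rate ^+ k / (k`!)%:R * expR (- rate))%:E;
  sd_density : forall j (A : set R), measurable A ->
    P (Y j @^-1` A) =
    (\int[@lebesgue_measure R]_(y in A) (jump_density alpha m y)%:E)%E;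
  sd_independent :
    mutually_independent P
      (fun o : option nat =>
         if o is Some j then sigma_of (Y j) else sigma_of X)
}.

(* The sum has X + 1 terms, from Y_0 to Y_X. *)
Definition subordinator {T : Type} {R : realType} (m : nat) (X : T -> nat)
    (Y : nat -> T -> R) (w : T) : R :=
  m%:R^-1 * \sum_(0 <= j < (X w).+1) Y j w.

Definition walk_indep_subordinator {d} {T : measurableType d} {R : realType}
    (P : probability T R) (K : nat) (xi : nat -> T -> R[i]) (n : nat)
    (S : T -> R) : Prop :=
  mutually_independent P
    (fun c : bool => if c then sigma_walk K xi n else sigma_of S).

(* Main.v *)
(** The idea.  Fix s = t - t0, K = 2MN, theta = y^K, and cut the spectral datum
    off outside a compact set carrying it.

    Roots of unity annihilate every power not divisible by K, so the mean of
    e^(z xi) over the K-th roots xi of beta is 1 + z^K beta / K! + O(z^(2K)).  For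
    z = - i y n^(-1/K) the choice of beta turns this into 1 - theta/n + O(n^-2), and
    conditioning on the independent time S_m shows that the characteristic function
    of the stopped walk tends to E e^(- theta S_m), uniformly for bounded y; Fubini
    gives the inner limit.  Since S_m is a compound Poisson variable,
    E e^(- theta S_m) = L e^(rate (L - 1)) with L the Laplace transform of a jump,
    and an integration by parts gives m^(2 alpha) (1 - L) -> Gamma(1 - alpha)
    theta^alpha.  Hence the outer limit is the inverse transform v(s) of
    e^(- s |y|^N) fhat.

    By Plancherel v(r) lies in the domain of B^N and v' = - B^N v in L^2, so
    r |-> T(s - r) v(r) has zero derivative.  A real induction on r replaces the
    calculus of L^2-valued functions and yields T(s) v(0) = v(s).  Plancherel's
    identity comes from Abel means: damping the transform by e^(- eps |y|) turns
    its square norm into a quadratic form of the Poisson kernel. *)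

Require Import Defs.
From mathcomp Require Import measurable_realfun.
From mathcomp Require Import ring lra.

Import Order.TTheory GRing.Theory Num.Theory.
Import numFieldNormedType.Exports.

Set Implicit Arguments.
Unset Strict Implicit.
Unset Printing Implicit Defensive.

Local Open Scope classical_set_scope.
Local Open Scope complex_scope.
Local Open Scope ring_scope.

Local Notation Re := complex.Re.
Local Notation Im := complex.Im.
Local Notation nc := Normc.normc.
Local Notation cmeas f := (measurable_fun setT (cpair \o f)).

(** * Complex-valued functions *)

(** Two obstacles shape the proof. The properties of the random variables hold almost surely, while
    Fubini's theorem and the product formulas are used with bounds valid everywhere. So replacements
    come first: finite combinations of indicators for the exponentials of the steps, the positive
    part for the subordinator, and a restriction to an event for the stopped walk. Moreover f may
    grow exponentially off the real axis, so every expectation needs e^(c S_m) to be integrable for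
    all real c. This holds because the jumps are bounded by m^2, but the moments depend on m: the
    inner error is a constant tied to m divided by n, so n tends to infinity first.

    On the analytic side [is_fourier] speaks of truncations of f, so placing v(r) in the domain of
    B^N requires inversion in L^2 and not only an isometry. Plancherel's inequality is obtained for
    every integrable function, by a Schur test on the Poisson form. Equality is proved only for
    bounded functions supported in an interval and continuous inside it; inversion for these extends
    by density, since truncated inversion is a contraction. *)

Lemma cReD (R : realType) (z w : R[i]) : Re (z + w) = Re z + Re w.
Proof. by case: z w => [a b] [c e]. Qed.

Lemma cImD (R : realType) (z w : R[i]) : Im (z + w) = Im z + Im w.
Proof. by case: z w => [a b] [c e]. Qed.

Lemma cReN (R : realType) (z : R[i]) : Re (- z) = - Re z.
Proof. by case: z. Qed.

Lemma cImN (R : realType) (z : R[i]) : Im (- z) = - Im z.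
Proof. by case: z. Qed.

Lemma cReM (R : realType) (z w : R[i]) : Re (z * w) = Re z * Re w - Im z * Im w.
Proof. by case: z w => [a b] [c e]. Qed.

Lemma cImM (R : realType) (z w : R[i]) : Im (z * w) = Re z * Im w + Im z * Re w.
Proof. by case: z w => [a b] [c e]. Qed.

Lemma ReIm_eq (R : realType) (z w : R[i]) : Re z = Re w -> Im z = Im w -> z = w.
Proof. by case: z w => [a b] [c e] /= -> ->. Qed.

Lemma normc_ge0 (R : realType) (z : R[i]) : 0 <= nc z.
Proof. by case: z => a b /=; exact: sqrtr_ge0. Qed.

Lemma sqr_normcE (R : realType) (z : R[i]) : nc z ^+ 2 = Re z ^+ 2 + Im z ^+ 2.
Proof. by case: z => a b /=; rewrite sqr_sqrtr// addr_ge0 ?sqr_ge0. Qed.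

Lemma normcD_le (R : realType) (z w : R[i]) : nc (z + w) <= nc z + nc w.
Proof. exact: le_normcD. Qed.

Lemma normcN_eq (R : realType) (z : R[i]) : nc (- z) = nc z.
Proof. exact: normcN. Qed.

Lemma normcB_le (R : realType) (z w : R[i]) : nc (z - w) <= nc z + nc w.
Proof. by rewrite -(normcN_eq w) normcD_le. Qed.

Lemma distcC (R : realType) (z w : R[i]) : nc (z - w) = nc (w - z).
Proof. by rewrite -normcN_eq opprB. Qed.

Lemma normc_real (R : realType) (x : R) : nc x%:C = `|x|.
Proof. by rewrite /= expr0n/= addr0 sqrtr_sqr. Qed.

Lemma normcX (R : realType) (z : R[i]) n : nc (z ^+ n) = nc z ^+ n.
Proof.
elim: n => [|n IH]; first by rewrite !expr0 Normc.normc1.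
by rewrite !exprS Normc.normcM IH.
Qed.

Lemma Re_le_normc (R : realType) (z : R[i]) : `|Re z| <= nc z.
Proof.
rewrite -(@ler_pXn2r _ 2) ?nnegrE ?normc_ge0// sqr_normcE -normrX ger0_norm ?sqr_ge0//.
by rewrite lerDl sqr_ge0.
Qed.

Lemma Im_le_normc (R : realType) (z : R[i]) : `|Im z| <= nc z.
Proof.
rewrite -(@ler_pXn2r _ 2) ?nnegrE ?normc_ge0// sqr_normcE -normrX ger0_norm ?sqr_ge0//.
by rewrite lerDr sqr_ge0.
Qed.

Lemma normc_le_ReIm (R : realType) (z : R[i]) : nc z <= `|Re z| + `|Im z|.
Proof.
rewrite -(@ler_pXn2r _ 2) ?nnegrE ?normc_ge0 ?addr_ge0// sqr_normcE.
rewrite sqrrD !real_normK ?num_real// -addrA lerD2l lerDr.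
by rewrite mulrn_wge0// mulr_ge0.
Qed.

Lemma normcJ_eq (R : realType) (z : R[i]) : nc (z^*)%C = nc z.
Proof. by case: z => a b /=; rewrite sqrrN. Qed.

Lemma mul_conjc (R : realType) (z : R[i]) : z * (z^*)%C = (nc z ^+ 2)%:C.
Proof. by rewrite sqr_normcE; apply: ReIm_eq; rewrite ?cReM ?cImM; case: z => a b /=; ring. Qed.

Lemma normc_real_mul (R : realType) (a : R) (z : R[i]) : nc (a%:C * z) = `|a| * nc z.
Proof. by rewrite Normc.normcM normc_real. Qed.

Lemma real_mulE (R : realType) (a : R) (z : R[i]) : a%:C * z = (a * Re z) +i* (a * Im z).
Proof. by case: z => x y; apply: ReIm_eq; rewrite ?cReM ?cImM /=; ring. Qed.

Lemma cexpD (R : realType) (z w : R[i]) : cexp (z + w) = cexp z * cexp w.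
Proof.
by apply: ReIm_eq; rewrite /cexp ?cReM ?cImM /= ?cReD ?cImD expRD ?cosD ?sinD; ring.
Qed.

Lemma cexp0 (R : realType) : cexp (0 : R[i]) = 1.
Proof. by rewrite /cexp/= expR0 cos0 sin0 mulr1 mulr0. Qed.

Lemma normc_cexp (R : realType) (z : R[i]) : nc (cexp z) = expR (Re z).
Proof.
rewrite /cexp/= !exprMn -mulrDr cos2Dsin2 mulr1 sqrtr_sqr ger0_norm//.
Qed.

Lemma cexp_sum (R : realType) I (s : seq I) (F : I -> R[i]) :
  cexp (\sum_(i <- s) F i) = \prod_(i <- s) cexp (F i).
Proof.
elim: s => [|i s IH]; first by rewrite !big_nil cexp0.
by rewrite !big_cons cexpD IH.
Qed.

Lemma normc_sum (R : realType) I (s : seq I) (F : I -> R[i]) :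
  nc (\sum_(i <- s) F i) <= \sum_(i <- s) nc (F i).
Proof.
elim: s => [|i s IH]; first by rewrite !big_nil Normc.normc0.
by rewrite !big_cons (le_trans (normcD_le _ _))// lerD2l.
Qed.

Lemma cRe_sum (R : realType) I (s : seq I) (F : I -> R[i]) :
  Re (\sum_(i <- s) F i) = \sum_(i <- s) Re (F i).
Proof. by elim: s => [|i s IH]; rewrite ?big_nil// !big_cons cReD IH. Qed.

Lemma iM_real (R : realType) (x : R) : 'i%C * x%:C = 0 +i* x.
Proof. by apply: ReIm_eq; rewrite ?cReM ?cImM /=; ring. Qed.

(* The unit vector realising the modulus is the conjugate of z. *)
Lemma normc_le_test (R : realType) (z : R[i]) (B : R) :
  0 <= B -> (forall w, `|Re (w * z)| <= nc w * B) -> nc z <= B.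
Proof.
move=> B0 /(_ (z^*)%C); rewrite mulrC mul_conjc normcJ_eq /= ger0_norm ?sqr_ge0//.
rewrite expr2; have := normc_ge0 z; rewrite le_eqVlt => /predU1P[<-//|z0].
by rewrite ler_pM2l.
Qed.

Section complex_measurability.
Context d (T : measurableType d) (R : realType).
Implicit Types f g : T -> R[i].

Lemma cmeasP f : cmeas f <->
  measurable_fun setT (fun x => Re (f x)) /\ measurable_fun setT (fun x => Im (f x)).
Proof.
split=> [mf|[mr mi]]; last exact: measurable_fun_pair.
split.
- exact: (measurableT_comp (@measurable_fst _ _ R R) mf).
- exact: (measurableT_comp (@measurable_snd _ _ R R) mf).
Qed.

Lemma cmeasM f g : cmeas f ->
  cmeas g ->
  cmeas (fun x => f x * g x).
Proof.
move=> /cmeasP[f1 f2] /cmeasP[g1 g2]; apply/cmeasP; split.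
- under eq_fun do rewrite cReM; apply: measurable_funB; exact: measurable_funM.
- under eq_fun do rewrite cImM; apply: measurable_funD; exact: measurable_funM.
Qed.

Lemma cmeasD f g : cmeas f ->
  cmeas g ->
  cmeas (fun x => f x + g x).
Proof.
move=> /cmeasP[f1 f2] /cmeasP[g1 g2]; apply/cmeasP; split.
- by under eq_fun do rewrite cReD; apply: measurable_funD.
- by under eq_fun do rewrite cImD; apply: measurable_funD.
Qed.

Lemma cmeas_cst (z : R[i]) : cmeas (fun _ : T => z).
Proof. by apply/cmeasP; split; exact: measurable_cst. Qed.

Lemma cmeasN f : cmeas f ->
  cmeas (fun x => - f x).
Proof.
move=> mf; under eq_fun do rewrite -mulN1r.
by apply: cmeasM => //; exact: cmeas_cst.
Qed.

Lemma cmeasB f g : cmeas f ->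
  cmeas g ->
  cmeas (fun x => f x - g x).
Proof. by move=> mf mg; apply: cmeasD => //; exact: cmeasN. Qed.

Lemma cmeas_real (h : T -> R) : measurable_fun setT h ->
  cmeas (fun x => (h x)%:C).
Proof. by move=> mh; apply/cmeasP; split => //=; exact: measurable_cst. Qed.

Lemma cmeas_cexp f : cmeas f ->
  cmeas (fun x => cexp (f x)).
Proof.
move=> /cmeasP[f1 f2].
have mc : measurable_fun setT (@cos R).
  by apply: continuous_measurable_fun; exact: continuous_cos.
have ms : measurable_fun setT (@sin R).
  by apply: continuous_measurable_fun; exact: continuous_sin.
by apply/cmeasP; split; rewrite /cexp/=; apply: measurable_funM;
  [exact: (measurableT_comp (@measurable_expR R))|exact: (measurableT_comp mc)
  |exact: (measurableT_comp (@measurable_expR R))|exact: (measurableT_comp ms)].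
Qed.

Lemma cmeas_normc f : cmeas f ->
  measurable_fun setT (fun x => nc (f x)).
Proof.
move=> /cmeasP[f1 f2].
have ms : measurable_fun setT (@Num.sqrt R).
  by apply: continuous_measurable_fun; exact: sqrt_continuous.
rewrite (_ : (fun x => _) = Num.sqrt \o (fun x => Re (f x) ^+ 2 + Im (f x) ^+ 2)).
  apply: (measurableT_comp ms); apply: measurable_funD;
  by apply: measurable_funX.
by apply/funext => x /=; case: (f x).
Qed.

Lemma cmeas_conj f : cmeas f ->
  cmeas (fun x => (f x)^*%C).
Proof.
move=> /cmeasP[f1 f2]; apply/cmeasP; split.
- by rewrite (_ : (fun x => _) = fun x => Re (f x))//; apply/funext => x; case: (f x).
- rewrite (_ : (fun x => _) = fun x => - Im (f x)); first exact: measurableT_comp.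
  by apply/funext => x; case: (f x).
Qed.

End complex_measurability.

Definition cintegrable d (T : measurableType d) (R : realType)
    (mu : {measure set T -> \bar R}) (f : T -> R[i]) :=
  mu.-integrable setT (fun x => (Re (f x))%:E) /\
  mu.-integrable setT (fun x => (Im (f x))%:E).

Section complex_integral.
Context d (T : measurableType d) (R : realType) (mu : {measure set T -> \bar R}).
Implicit Types f g : T -> R[i].

Lemma cintegrable_meas f : cintegrable mu f -> cmeas f.
Proof.
move=> [/measurable_int f1 /measurable_int f2]; apply/cmeasP.
by split; exact/measurable_EFinP.
Qed.

Lemma le_cintegrable f (h : T -> R) : cmeas f ->
  mu.-integrable setT (EFin \o h) -> (forall x, nc (f x) <= h x) ->
  cintegrable mu f.
Proof.
move=> /cmeasP[f1 f2] ih fh; split.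
- apply: (le_integrable measurableT _ _ ih); first exact/measurable_EFinP.
  move=> x _ /=; rewrite lee_fin (le_trans (Re_le_normc _))//.
  by rewrite (le_trans (fh x))// ler_norm.
- apply: (le_integrable measurableT _ _ ih); first exact/measurable_EFinP.
  move=> x _ /=; rewrite lee_fin (le_trans (Im_le_normc _))//.
  by rewrite (le_trans (fh x))// ler_norm.
Qed.

Lemma cintegrable_normc f : cintegrable mu f ->
  mu.-integrable setT (fun x => (nc (f x))%:E).
Proof.
move=> fi; have mf := cintegrable_meas fi; case: fi => f1 f2.
apply: (le_integrable measurableT _ _
  (integrableD measurableT (integrable_norm f1) (integrable_norm f2))).
  by apply/measurable_EFinP; exact: cmeas_normc.
move=> x _ /=; rewrite lee_fin ger0_norm ?normc_ge0//.
by rewrite ger0_norm ?addr_ge0// normc_le_ReIm.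
Qed.

Lemma cintegrableP f : cmeas f ->
  mu.-integrable setT (fun x => (nc (f x))%:E) -> cintegrable mu f.
Proof. by move=> mf fi; exact: (le_cintegrable mf fi). Qed.

Lemma cintegrableD f g : cintegrable mu f -> cintegrable mu g ->
  cintegrable mu (fun x => f x + g x).
Proof.
move=> [f1 f2] [g1 g2]; split.
- by under eq_fun do rewrite cReD EFinD; exact: integrableD.
- by under eq_fun do rewrite cImD EFinD; exact: integrableD.
Qed.

Lemma cintegrableZ (a : R[i]) f : cintegrable mu f ->
  cintegrable mu (fun x => a * f x).
Proof.
move=> fi; apply: cintegrableP.
  by apply: cmeasM; [exact: cmeas_cst|exact: cintegrable_meas].
under eq_fun do rewrite Normc.normcM EFinM.
by apply: integrableZl => //; exact: cintegrable_normc.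
Qed.

Lemma cintegralD f g : cintegrable mu f -> cintegrable mu g ->
  cintegral mu (fun x => f x + g x) = cintegral mu f + cintegral mu g.
Proof.
move=> [f1 f2] [g1 g2]; rewrite /cintegral; apply: ReIm_eq => /=.
- under eq_Rintegral do rewrite cReD.
  by rewrite RintegralD.
- under eq_Rintegral do rewrite cImD.
  by rewrite RintegralD.
Qed.

Lemma cintegralZ (a : R[i]) f : cintegrable mu f ->
  cintegral mu (fun x => a * f x) = a * cintegral mu f.
Proof.
move=> [f1 f2]; rewrite /cintegral; apply: ReIm_eq; rewrite ?cReM ?cImM /=.
- under eq_Rintegral do rewrite cReM.
  rewrite RintegralB ?RintegralZl//.
    by have := integrableZl measurableT (Re a) f1; apply: eq_integrable => // x _.
  by have := integrableZl measurableT (Im a) f2; apply: eq_integrable => // x _.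
- under eq_Rintegral do rewrite cImM.
  rewrite RintegralD ?RintegralZl//.
    by have := integrableZl measurableT (Re a) f2; apply: eq_integrable => // x _.
  by have := integrableZl measurableT (Im a) f1; apply: eq_integrable => // x _.
Qed.

Lemma cintegrableB f g : cintegrable mu f -> cintegrable mu g ->
  cintegrable mu (fun x => f x - g x).
Proof.
move=> fi gi; under eq_fun do rewrite -(mulN1r (g _)).
by apply: cintegrableD => //; exact: cintegrableZ.
Qed.

Lemma cintegralB f g : cintegrable mu f -> cintegrable mu g ->
  cintegral mu (fun x => f x - g x) = cintegral mu f - cintegral mu g.
Proof.
move=> fi gi; under [in LHS]eq_fun do rewrite -(mulN1r (g _)).
by rewrite cintegralD ?cintegralZ ?mulN1r//; exact: cintegrableZ.
Qed.

Lemma cintegral_real (h : T -> R) : cintegral mu (fun x => (h x)%:C) = (\int[mu]_x h x)%:C.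
Proof. by apply: ReIm_eq => //=; rewrite /Rintegral integral0. Qed.

(** Estimating real and imaginary parts separately would lose a factor. Testing against every w,
    which moves inside the integral, reduces the claim to the real triangle inequality with the
    sharp constant. *)
Lemma normc_cintegral f : cintegrable mu f ->
  nc (cintegral mu f) <= \int[mu]_x nc (f x).
Proof.
move=> fi; apply: normc_le_test.
  by apply: Rintegral_ge0 => x _; exact: normc_ge0.
move=> w; rewrite -cintegralZ//= (le_trans (le_normr_Rintegral _ _))//.
  by case: (cintegrableZ w fi).
rewrite -RintegralZl//; last exact: cintegrable_normc.
apply: le_Rintegral => //.
- by apply: (integrable_norm (f := fun x => Re (w * f x))); case: (cintegrableZ w fi).
- by have := integrableZl measurableT (nc w) (cintegrable_normc fi);
    apply: eq_integrable => // x _.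
- by move=> x _; rewrite -Normc.normcM Re_le_normc.
Qed.

Lemma normc_cintegral_le f (h : T -> R) : cintegrable mu f ->
  mu.-integrable setT (EFin \o h) -> (forall x, nc (f x) <= h x) ->
  nc (cintegral mu f) <= \int[mu]_x h x.
Proof.
move=> fi hi fh; rewrite (le_trans (normc_cintegral fi))//.
by apply: le_Rintegral => //; exact: cintegrable_normc.
Qed.

Lemma eq_cintegral f g : f =1 g -> cintegral mu f = cintegral mu g.
Proof. by move=> /funext ->. Qed.

Lemma ae_eq_cintegral f g : cmeas f ->
  cmeas g -> {ae mu, forall x, f x = g x} ->
  cintegral mu f = cintegral mu g.
Proof.
move=> /cmeasP[f1 f2] /cmeasP[g1 g2] fg; rewrite /cintegral /Rintegral.
congr (fine _ +i* fine _); apply: ae_eq_integral => //; try exact/measurable_EFinP.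
- by apply: (filterS _ fg) => x fgx _; rewrite fgx.
- by apply: (filterS _ fg) => x fgx _; rewrite fgx.
Qed.

End complex_integral.

(** * Fubini's theorem for complex integrands *)

Section product.
Context d1 d2 (T1 : measurableType d1) (T2 : measurableType d2) (R : realType).
Variables (m1 : {sigma_finite_measure set T1 -> \bar R})
  (m2 : {sigma_finite_measure set T2 -> \bar R}).

(** A bound that splits into a product makes the iterated integral of the bound factor, so joint
    integrability follows from that of g and h. The later exchanges of complex integrals all supply
    a bound of this shape. *)
Lemma integrable_prod_le (f : T1 * T2 -> R) (g : T1 -> R) (h : T2 -> R) :
  measurable_fun setT f ->
  m1.-integrable setT (EFin \o g) -> m2.-integrable setT (EFin \o h) ->
  (forall x y, `|f (x, y)| <= g x * h y) ->
  (m1 \x m2)%E.-integrable setT (EFin \o f).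
Proof.
move=> mf ig ih fgh; apply/integrable12ltyP; first exact/measurable_EFinP.
have mg : measurable_fun setT g by exact/measurable_EFinP/(measurable_int m1).
have mh : measurable_fun setT h by exact/measurable_EFinP/(measurable_int m2).
apply: (@le_lt_trans _ _ (\int[m1]_x (`|g x|%:E * \int[m2]_y `|h y|%:E)%E)%E).
  apply: ge0_le_integral => //.
  - by move=> x _; exact: integral_ge0.
  - apply: (@measurable_fun_fubini_tonelli_F _ _ _ _ _ m2 (fun z => `|(f z)%:E|%E)) => //.
    by apply: measurableT_comp => //; exact/measurable_EFinP.
  - apply: emeasurable_funM; last exact: measurable_cst.
    by apply/measurable_EFinP; apply: measurableT_comp.
  - move=> x _; rewrite -ge0_integralZl//; last first.
      by apply/measurable_EFinP; apply: measurableT_comp.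
    apply: ge0_le_integral => //.
    + apply: measurableT_comp => //; apply/measurable_EFinP.
      exact: (measurableT_comp mf).
    + by apply: measurable_funeM; apply/measurable_EFinP; apply: measurableT_comp.
    + move=> y _; rewrite -EFinM lee_fin (le_trans (fgh x y))//.
      by rewrite -normrM ler_norm.
have hfin : (\int[m2]_y `|h y|%:E < +oo)%E by case/integrableP : ih.
have gfin : (\int[m1]_y `|g y|%:E < +oo)%E by case/integrableP : ig.
rewrite ge0_integralZr//; last 2 first.
- by apply/measurable_EFinP; apply: measurableT_comp.
- by apply: integral_ge0.
by rewrite lte_mul_pinfty// ?integral_ge0// ge0_fin_numE// integral_ge0.
Qed.

Lemma Rfubini (f : T1 * T2 -> R) (g : T1 -> R) (h : T2 -> R) :
  measurable_fun setT f ->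
  m1.-integrable setT (EFin \o g) -> m2.-integrable setT (EFin \o h) ->
  (forall x y, `|f (x, y)| <= g x * h y) ->
  \int[m1]_x \int[m2]_y f (x, y) = \int[m2]_y \int[m1]_x f (x, y).
Proof.
move=> mf ig ih fgh.
have fi := integrable_prod_le mf ig ih fgh.
(* The bound holds at every point, so every section is integrable and not only almost every one;
   hence [fine] loses nothing in the inner integrals. *)
have f1 x : m2.-integrable setT (fun y => (f (x, y))%:E).
  have := integrableZl measurableT (g x) ih.
  apply: le_integrable => //.
    by apply/measurable_EFinP; exact: (measurableT_comp mf).
  by move=> y _ /=; rewrite lee_fin (le_trans (fgh x y))// ler_norm.
have f2 y : m1.-integrable setT (fun x => (f (x, y))%:E).
  have := integrableZr measurableT (h y) ig.
  apply: le_integrable => //.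
    by apply/measurable_EFinP; exact: (measurableT_comp mf).
  by move=> x _ /=; rewrite lee_fin (le_trans (fgh x y))// ler_norm.
rewrite /Rintegral; congr fine.
have -> : (\int[m1]_x (fine (\int[m2]_y (f (x, y))%:E))%:E =
    \int[m1]_x (\int[m2]_y (f (x, y))%:E))%E.
  by apply: eq_integral => x _; rewrite fineK// integrable_fin_num.
have -> : (\int[m2]_y (fine (\int[m1]_x (f (x, y))%:E))%:E =
    \int[m2]_y (\int[m1]_x (f (x, y))%:E))%E.
  by apply: eq_integral => x _; rewrite fineK// integrable_fin_num.
exact: (Fubini fi).
Qed.

Lemma cfubini (f : T1 * T2 -> R[i]) (g : T1 -> R) (h : T2 -> R) :
  cmeas f ->
  m1.-integrable setT (EFin \o g) -> m2.-integrable setT (EFin \o h) ->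
  (forall x y, nc (f (x, y)) <= g x * h y) ->
  cintegral m1 (fun x => cintegral m2 (fun y => f (x, y))) =
  cintegral m2 (fun y => cintegral m1 (fun x => f (x, y))).
Proof.
move=> /cmeasP[f1 f2] ig ih fgh; rewrite /cintegral/=; congr (_ +i* _).
- apply: (@Rfubini (fun z => Re (f z)) _ _ f1 ig ih) => x y.
  exact: le_trans (Re_le_normc _) (fgh x y).
- apply: (@Rfubini (fun z => Im (f z)) _ _ f2 ig ih) => x y.
  exact: le_trans (Im_le_normc _) (fgh x y).
Qed.

(** Integrability is not assumed: positive and negative parts fall under Tonelli's theorem, and
    [fine] is measurable, its default values at infinity included. *)
Lemma measurable_Rintegral_snd (f : T1 * T2 -> R) : measurable_fun setT f ->
  measurable_fun setT (fun x => \int[m2]_y f (x, y)).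
Proof.
move=> mf; rewrite /Rintegral; apply: measurableT_comp => //.
have mf' : measurable_fun setT (EFin \o f) by exact/measurable_EFinP.
rewrite (_ : (fun x => _) = (fun x => (\int[m2]_y ((EFin \o f)^\+ (x, y)))
   - (\int[m2]_y ((EFin \o f)^\- (x, y))))%E); last first.
  by apply/funext => x; rewrite integralE; congr (_ - _)%E; apply: eq_integral => y _;
    rewrite ?funeposE ?funenegE.
apply: emeasurable_funB; apply: measurable_fun_fubini_tonelli_F => //.
- exact: measurable_funepos.
- exact: measurable_funeneg.
Qed.

Lemma cmeas_cintegral_snd (f : T1 * T2 -> R[i]) : cmeas f ->
  cmeas (fun x => cintegral m2 (fun y => f (x, y))).
Proof.
move=> /cmeasP[f1 f2]; apply/cmeasP; split => /=.
- exact: (measurable_Rintegral_snd f1).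
- exact: (measurable_Rintegral_snd f2).
Qed.

End product.

(** * Derivatives of real functions *)

Lemma is_derive1M (R : realType) (f g : R -> R) (x a b : R) :
  is_derive x 1 f a -> is_derive x 1 g b ->
  is_derive x 1 (fun t => f t * g t) (a * g x + f x * b).
Proof.
move=> fa gb; have := is_deriveM fa gb; rewrite (_ : f * g = fun t => f t * g t)//.
by move/is_derive_eq; apply; rewrite /GRing.scale/= addrC; congr (_ + _); rewrite mulrC.
Qed.

Lemma is_derive1D (R : realType) (f g : R -> R) (x a b : R) :
  is_derive x 1 f a -> is_derive x 1 g b ->
  is_derive x 1 (fun t => f t + g t) (a + b).
Proof. exact: is_deriveD. Qed.

Lemma is_derive1N (R : realType) (f : R -> R) (x a : R) :
  is_derive x 1 f a -> is_derive x 1 (fun t => - f t) (- a).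
Proof. exact: is_deriveN. Qed.

Lemma is_derive1Z (R : realType) (f : R -> R) (c x a : R) :
  is_derive x 1 f a -> is_derive x 1 (fun t => c * f t) (c * a).
Proof. exact: is_deriveZ. Qed.

Lemma is_derive1_lin (R : realType) (c x : R) : is_derive x 1 (fun t => t * c) c.
Proof.
have := is_derive1M (is_derive_id x 1) (is_derive_cst c x 1).
by move/is_derive_eq; apply; rewrite mul1r mulr0 addr0.
Qed.

Lemma is_derive1_comp_lin (R : realType) (f : R -> R) (c x a : R) :
  is_derive (x * c) 1 f a -> is_derive x 1 (fun t => f (t * c)) (a * c).
Proof.
move=> fa; rewrite (_ : (fun t => f (t * c)) = f \o (fun t => t * c))//.
by apply: is_derive1_comp; exact: is_derive1_lin.
Qed.

Lemma is_derive1_Xn (R : realType) (n : nat) (x : R) :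
  is_derive x 1 (fun t => t ^+ n) (n%:R * x ^+ n.-1).
Proof.
have := is_deriveX n (is_derive_id x (1 : R)).
rewrite (_ : id ^+ n = fun t : R => t ^+ n); last first.
  by apply/funext => t; rewrite fctE.
by move/is_derive_eq; apply; rewrite /GRing.scale/= mulr1.
Qed.

Lemma is_derive1_sum (R : realType) n (f : 'I_n -> R -> R) (x : R) (a : 'I_n -> R) :
  (forall i, is_derive x 1 (f i) (a i)) ->
  is_derive x 1 (fun t => \sum_(i < n) f i t) (\sum_(i < n) a i).
Proof. by move=> /is_derive_sum; rewrite fct_sumE. Qed.

Lemma is_derive_continuous (R : realType) (f : R -> R) (x a : R) :
  is_derive x 1 f a -> {for x, continuous f}.
Proof.
by move=> fa; apply: differentiable_continuous; apply/derivable1_diffP; case: fa.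
Qed.

(** * Taylor's formula for the exponential and averages over roots of unity *)

Section cexp_taylor.
Variable R : realType.
Implicit Types (z w : R[i]) (t : R).

Let taylor z w p t : R :=
  Re (w * cexp (t%:C * z)) - \sum_(j < p) Re (w * z ^+ j) / (j`!)%:R * t ^+ j.

Lemma is_derive_Re_cexp z w t :
  is_derive t 1 (fun s : R => Re (w * cexp (s%:C * z))) (Re (w * z * cexp (t%:C * z))).
Proof.
case: z => x y; case: w => a b.
rewrite (_ : (fun s : R => _) = fun s : R =>
    expR (s * x) * (a * cos (s * y) + (- b) * sin (s * y))); last first.
  by apply/funext => s; rewrite cReM /cexp real_mulE /=; ring.
have e1 := is_derive1_comp_lin (is_derive_expR (t * x)).
have c1 := is_derive1Z a (is_derive1_comp_lin (is_derive_cos (t * y))).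
have s1 := is_derive1Z (- b) (is_derive1_comp_lin (is_derive_sin (t * y))).
have := is_derive1M e1 (is_derive1D c1 s1).
move/is_derive_eq; apply; rewrite cReM cImM /cexp real_mulE cReM /=; ring.
Qed.

Lemma is_derive_taylor z w p t :
  is_derive t 1 (taylor z w p.+1) (taylor z (w * z) p t).
Proof.
have := is_derive1D (is_derive_Re_cexp z w t) (is_derive1N (is_derive1_sum
  (fun j : 'I_p.+1 => is_derive1Z (Re (w * z ^+ j) / (j`!)%:R) (is_derive1_Xn j t)))).
move/is_derive_eq; apply; rewrite /taylor; congr (_ - _).
rewrite big_ord_recl/= mul0r mulr0 add0r; apply: eq_bigr => j _.
rewrite /bump/= add1n factS natrM invfM exprS !mulrA.
have J0 : (j.+1)%:R != 0 :> R by rewrite pnatr_eq0.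
by rewrite add0n [X in X * t ^+ _]mulrAC divfK.
Qed.

(** The remainder along the segment from 0 to z is tested against w to become a real function of t.
    Differentiating it multiplies w by z and lowers the order by one, so the mean value theorem
    gives the bound by induction on p, for all w at once. *)
Lemma taylor_le z w p t : 0 <= t -> t <= 1 ->
  `|taylor z w p t| <= nc w * nc z ^+ p * expR (nc z).
Proof.
elim: p w t => [|p IH] w t t0 t1.
  rewrite /taylor big_ord0 subr0 expr0 mulr1 (le_trans (Re_le_normc _))//.
  rewrite Normc.normcM ler_wpM2l ?normc_ge0// normc_cexp ler_expR real_mulE/=.
  rewrite (le_trans (ler_norm _))// normrM ger0_norm//.
  by rewrite (le_trans _ (Re_le_normc z))// ler_piMl.
have [||c cin Hc] := @MVT_segment R (taylor z w p.+1) (taylor z (w * z) p) 0 t t0.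
- by move=> s _; exact: is_derive_taylor.
- apply: continuous_subspaceT => s.
  exact: is_derive_continuous (is_derive_taylor z w p s).
- have T0 : taylor z w p.+1 0 = 0.
    rewrite /taylor big_ord_recl big1 => [|j _]; last by rewrite /= /bump/= add1n [0 ^+ _]exprS mul0r mulr0.
    rewrite (_ : 0%:C = 0)// mul0r cexp0 /= !expr0 fact0 divr1 !mulr1 addr0.
    by rewrite subrr.
  have := Hc; rewrite T0 !subr0 => ->.
  rewrite normrM (ger0_norm t0) (@le_trans _ _ (`|taylor z (w * z) p c|))//.
    by rewrite ler_piMr.
  move: cin; rewrite in_itv/= => /andP[c0 ct].
  rewrite (le_trans (IH _ _ c0 (le_trans ct t1)))// Normc.normcM exprS.
  by rewrite !mulrA.
Qed.

Lemma cexp_taylor z p :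
  nc (cexp z - \sum_(j < p) ((j`!)%:R^-1)%:C * z ^+ j) <= nc z ^+ p * expR (nc z).
Proof.
apply: normc_le_test => [|w].
  by rewrite mulr_ge0 ?expR_ge0// exprn_ge0// normc_ge0.
have := @taylor_le z w p 1 ler01 (lexx _); rewrite mulrA; congr (_ <= _).
rewrite /taylor mulrBr cReD cReN (_ : 1%:C = 1)// mul1r; congr (`|_ - _|).
rewrite mulr_sumr cRe_sum; apply: eq_bigr => j _.
rewrite expr1n mulr1 mulrCA real_mulE/= mulrC; ring.
Qed.

End cexp_taylor.

Section root_average.
Variables (R : realType) (K : nat).
Hypothesis K0 : (0 < K)%N.

Let zeta (k : nat) : R[i] := cexp ('i%C * (2 * pi * k%:R / K%:R)%:C).

Lemma zetaX k j : zeta k ^+ j = zeta 1 ^+ j ^+ k.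
Proof.
have zk i : zeta i = zeta 1 ^+ i.
  elim: i => [|i IH]; first by rewrite /zeta mulr0 mul0r mulr0 cexp0.
  rewrite exprS -IH /zeta -cexpD -mulrDr; congr (cexp ('i * _)).
  rewrite -[RHS]rmorphD/=; congr _%:C; rewrite -natr1; field.
  by rewrite pnatr_eq0 -lt0n.
by rewrite (zk k) -!exprM mulnC.
Qed.

Lemma normc_zeta k : nc (zeta k) = 1.
Proof. by rewrite normc_cexp iM_real/= expR0. Qed.

Lemma zeta1_order : zeta 1 ^+ K = 1.
Proof.
rewrite -[K in LHS]mul1n exprM -[zeta 1 ^+ 1]expr1 -exprM mul1n.
rewrite -(zetaX K 1) expr1 /zeta -mulrA divff ?pnatr_eq0 -?lt0n// mulr1 iM_real.
by rewrite /cexp/= expR0 !mul1r mulr_natl cos2pi sin2pi.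
Qed.

(** With x = pi r / K in the open interval from 0 to pi, cos (2 x) = 1 - 2 sin^2 x is less than
    1. *)
Lemma zeta1_neq1 r : (0 < r < K)%N -> zeta 1 ^+ r != 1.
Proof.
move=> /andP[r0 rK]; rewrite -[zeta 1]expr1 -[X in (X ^+ r)]expr1 -(zetaX r 1) expr1.
rewrite /zeta iM_real /cexp/= expR0 !mul1r; apply/eqP => -[c1 _].
have K0R : (0 : R) < K%:R by rewrite ltr0n.
have : 0 < sin (pi * r%:R / K%:R :> R).
  apply: sin_gt0_pi; rewrite -mulrA !mulr_gt0 ?pi_gt0 ?invr_gt0 ?ltr0n//=.
  by rewrite gtr_pMr ?pi_gt0// ltr_pdivrMr// mul1r ltr_nat.
move=> s0; have := cosD (pi * r%:R / K%:R) (pi * r%:R / K%:R :> R).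
have -> : pi * r%:R / K%:R + pi * r%:R / K%:R = 2 * pi * r%:R / K%:R :> R.
  by field; rewrite gt_eqF.
rewrite c1; have := cos2Dsin2 (pi * r%:R / K%:R :> R); nra.
Qed.

Lemma sum_zetaX j : \sum_(k < K) zeta k ^+ j = if (K %| j)%N then K%:R else 0.
Proof.
under eq_bigr do rewrite zetaX.
case: ifPn => Kj.
  rewrite (eq_bigr (fun=> 1)) ?sumr_const ?card_ord// => k _.
  by rewrite -(divnK Kj) mulnC exprM zeta1_order !expr1n.
have q1 : zeta 1 ^+ j != 1.
  rewrite (divn_eq j K) exprD mulnC exprM zeta1_order expr1n mul1r.
  by rewrite zeta1_neq1// lt0n -/(dvdn K j) Kj ltn_mod.
have := subrX1 (zeta 1 ^+ j) K; rewrite -exprM mulnC exprM zeta1_order expr1n subrr.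
by move/esym/eqP; rewrite mulf_eq0 subr_eq0 (negbTE q1)/= => /eqP.
Qed.

Lemma root_average_cexp (u : R[i]) :
  nc (K%:R^-1 * \sum_(k < K) cexp (u * zeta k) - (1 + ((K`!)%:R^-1)%:C * u ^+ K))
    <= nc u ^+ (2 * K) * expR (nc u).
Proof.
have KC : (K%:R : R[i]) != 0 by rewrite pnatr_eq0 -lt0n.
(* Among the exponents below 2K only 0 and K are multiples of K, so these two terms are all that the
   averaged Taylor polynomial retains. *)
have main : 1 + ((K`!)%:R^-1)%:C * u ^+ K = K%:R^-1 * \sum_(k < K)
    \sum_(j < 2 * K) ((j`!)%:R^-1)%:C * (u * zeta k) ^+ j.
  rewrite exchange_big/= (eq_bigr (fun j : 'I__ => ((j`!)%:R^-1)%:C * u ^+ j *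
      (if (K %| j)%N then K%:R else 0))); last first.
    move=> j _; rewrite -sum_zetaX mulr_sumr; apply: eq_bigr => k _.
    by rewrite exprMn mulrA.
  rewrite mul2n -addnn big_split_ord/= mulrDr; congr (_ + _).
    rewrite (bigD1 (Ordinal K0))//= dvdn0 fact0 invr1 expr0 mul1r big1.
      by rewrite addr0 mul1r mulVf.
    move=> i i0; case: ifP; last by rewrite mulr0.
    rewrite gtnNdvd//= lt0n; apply: contra i0 => /eqP i0.
    by apply/eqP/val_inj.
  rewrite (bigD1 (Ordinal K0))//= addn0 dvdnn big1.
    by rewrite addr0 [RHS]mulrC mulfK.
  move=> i i0; case: ifP; last by rewrite mulr0.
  rewrite dvdn_addr ?dvdnn// gtnNdvd//= lt0n; apply: contra i0 => /eqP i0.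
  by apply/eqP/val_inj.
rewrite main -mulrBr -sumrB Normc.normcM Normc.normcV.
have -> : nc (K%:R : R[i]) = K%:R.
  by rewrite -(rmorph_nat (real_complex R)) normc_real ger0_norm.
rewrite ler_pdivrMl ?ltr0n// (le_trans (normc_sum _ _))//.
rewrite (@le_trans _ _ (\sum_(k < K) (nc u ^+ (2 * K) * expR (nc u))))//.
  apply: ler_sum => k _; have := cexp_taylor (u * zeta k) (2 * K).
  by rewrite Normc.normcM normc_zeta mulr1.
by rewrite sumr_const card_ord mulr_natl.
Qed.

End root_average.

(** * The Laplace transform of the jumps *)

Section ftc_on_segment.
Variable R : realType.
Implicit Types (f F : R -> R) (a b : R).
Local Notation leb := (@lebesgue_measure R).

Lemma integral_ftc f F a b : a <= b ->
  (forall x, a <= x <= b -> is_derive x 1 F (f x)) ->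
  (forall x, a <= x <= b -> {for x, continuous f}) ->
  (\int[leb]_(x in `[a, b]) (f x)%:E)%E = (F b - F a)%:E.
Proof.
rewrite le_eqVlt => /predU1P[<- _ _|ab dF cf].
  by rewrite set_itv1 integral_set1 subrr.
have cF x : a <= x <= b -> {for x, continuous F}.
  by move=> /dF; exact: is_derive_continuous.
rewrite (@continuous_FTC2 _ f F)//.
- by apply: continuous_in_subspaceT => x; rewrite inE/= in_itv/= => /cf.
- split.
  + move=> x; rewrite in_itv/= => /andP[ax xb].
    by have [] := dF x; rewrite ?ltW.
  + by apply: cvg_at_right_filter; apply: cF; rewrite lexx ltW.
  + by apply: cvg_at_left_filter; apply: cF; rewrite lexx ltW.
- move=> x; rewrite in_itv/= => /andP[ax xb]; rewrite derive1E.
  by have [] := dF x; rewrite ?ltW.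
Qed.

Lemma integrable_segment f a b :
  (forall x, a <= x <= b -> {for x, continuous f}) ->
  leb.-integrable `[a, b] (EFin \o f).
Proof.
move=> cf; apply: continuous_compact_integrable; first exact: segment_compact.
by apply: continuous_in_subspaceT => x; rewrite inE/= in_itv/= => /cf.
Qed.

Lemma Rintegral_ftc f F a b : a <= b ->
  (forall x, a <= x <= b -> is_derive x 1 F (f x)) ->
  (forall x, a <= x <= b -> {for x, continuous f}) ->
  \int[leb]_(x in `[a, b]) f x = F b - F a.
Proof. by move=> ab dF cf; rewrite /Rintegral (integral_ftc ab dF cf). Qed.

End ftc_on_segment.

Section powers.
Variable R : realType.
Implicit Types (a p x c : R).
Local Notation leb := (@lebesgue_measure R).

Lemma is_derive1_powR p x : 0 < x -> is_derive x 1 (fun y => y `^ p) (p * x `^ (p - 1)).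
Proof.
move=> x0; apply: DeriveDef.
- by apply: derivable_powR; rewrite in_itv/= x0.
- by rewrite -derive1E powR_derive1// in_itv/= x0.
Qed.

Lemma is_derive1_expRN c x : is_derive x 1 (fun y => expR (- (c * y))) (- c * expR (- (c * x))).
Proof.
rewrite (_ : (fun y => _) = fun y => expR (y * (- c))); last first.
  by apply/funext => y; rewrite mulrN mulrC.
have := is_derive1_comp_lin (is_derive_expR (x * - c)).
by move/is_derive_eq; apply; rewrite mulrC mulrN (mulrC x).
Qed.

Lemma ler_powRN p x (y : R) : 0 <= p -> 0 < x -> x <= y -> y `^ (- p) <= x `^ (- p).
Proof.
move=> p0 x0 xy; have y0 := lt_le_trans x0 xy.
rewrite !powRN lef_pV2 ?posrE ?powR_gt0//.
by rewrite ge0_ler_powR ?nnegrE// ltW.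
Qed.

Lemma continuous_powR_at p x : 0 < x -> {for x, continuous (fun y => y `^ p)}.
Proof. by move=> x0; exact: is_derive_continuous (is_derive1_powR p x0). Qed.

Lemma continuous_expRN_at c x : {for x, continuous (fun y => expR (- (c * y)))}.
Proof. exact: is_derive_continuous (is_derive1_expRN c x). Qed.

(** The integrand of Gamma (1 - a), indexed by a so as to match the exponent - a - 1 of the jump
    density. *)
Definition gamma_density a x := x `^ (- a) * expR (- x).

Lemma gamma_density_ge0 a x : 0 <= gamma_density a x.
Proof. by rewrite mulr_ge0 ?powR_ge0// expR_ge0. Qed.

Lemma continuous_gamma_density a x : 0 < x -> {for x, continuous (gamma_density a)}.
Proof.
move=> x0; apply: continuousM; first exact: continuous_powR_at.
rewrite (_ : (fun y => expR (- y)) = fun y => expR (- (1 * y))).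
  exact: continuous_expRN_at.
by apply/funext => y; rewrite mul1r.
Qed.

Lemma measurable_gamma_density a : measurable_fun setT (gamma_density a).
Proof.
apply: measurable_funM; first exact: measurable_powR.
by apply: measurableT_comp; [exact: measurable_expR|exact: oppr_measurable].
Qed.

Variable a : R.
Hypothesis a01 : 0 < a < 1.

(* (1 - e^-x)^(1-a) / (1-a) is bounded and, since 1 - e^-x <= x, its derivative
   dominates the density. *)
Lemma gamma_density_segment_le u v : 0 < u -> u <= v ->
  (\int[leb]_(x in `[u, v]) (gamma_density a x)%:E <= ((1 - a)^-1)%:E)%E.
Proof.
move=> u0 uv; have [a0 a1] := andP a01.
have a1' : 0 < 1 - a by rewrite subr_gt0.
pose B (x : R) := (1 - a)^-1 * (1 - expR (- (1 * x))) `^ (1 - a).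
pose b (x : R) := (1 - expR (- (1 * x))) `^ (- a) * expR (- (1 * x)).
have e1 x : 0 < x -> 0 < 1 - expR (- (1 * x)).
  by move=> x0; rewrite subr_gt0 mul1r expR_lt1 oppr_lt0.
have dE x : is_derive x 1 (fun x => 1 - expR (- (1 * x))) (expR (- (1 * x))).
  have := is_derive1D (is_derive_cst (1 : R) x 1) (is_derive1N (is_derive1_expRN 1 x)).
  by move/is_derive_eq; apply; rewrite add0r mulN1r opprK.
have dB x : 0 < x -> is_derive x 1 B (b x).
  move=> x0; have := is_derive1Z ((1 - a)^-1)
    (@is_derive1_comp _ (fun y => y `^ (1 - a)) (fun x => 1 - expR (- (1 * x))) x _ _
      (is_derive1_powR (1 - a) (e1 x x0)) (dE x)).
  move/is_derive_eq; apply; rewrite /b !mulrA mulVf ?gt_eqF// !mul1r.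
  by rewrite (_ : 1 - a - 1 = - a)//; ring.
have cb x : 0 < x -> {for x, continuous b}.
  move=> x0; apply: continuousM; last exact: continuous_expRN_at.
  apply: (@continuous_comp _ _ _ (fun x => 1 - expR (- (1 * x))) (fun y => y `^ (- a))).
    exact: is_derive_continuous (dE x).
  by apply: continuous_powR_at; exact: e1.
have u0x x : u <= x <= v -> 0 < x by move=> /andP[ux _]; exact: lt_le_trans ux.
apply: (@le_trans _ _ (\int[leb]_(x in `[u, v]) (b x)%:E)%E).
  apply: ge0_le_integral => //.
  - by move=> x _; rewrite lee_fin gamma_density_ge0.
  - by apply/measurable_EFinP; apply: measurable_funTS; exact: measurable_gamma_density.
  - have /integrableP[] : leb.-integrable `[u, v] (EFin \o b).
      by apply: integrable_segment => x /u0x; exact: cb.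
    by [].
  - move=> x /=; rewrite in_itv/= => /u0x x0; rewrite lee_fin /b /gamma_density mul1r.
    apply: ler_wpM2r; first exact: expR_ge0.
    apply: ler_powRN; first exact: ltW.
      by have := e1 _ x0; rewrite mul1r.
    by rewrite lerBlDr -lerBlDl; exact: expR_ge1Dx.
have -> := @integral_ftc R b B u v uv (fun x xuv => dB x (u0x x xuv)) (fun x xuv => cb x (u0x x xuv)).
rewrite lee_fin /B -mulrBr ler_piMr ?invr_ge0 ?(ltW a1')//.
rewrite (@le_trans _ _ (1 `^ (1 - a)))//; last by rewrite powR1.
rewrite lerBlDr (@le_trans _ _ (1 `^ (1 - a)))//; last by rewrite lerDl powR_ge0.
by rewrite ge0_ler_powR ?nnegrE// ?ltW// ?e1 ?(lt_le_trans u0)// gtrBl ?expR_gt0.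
Qed.

(** The exhausting segments are left general because two families occur: [1/(m+1), m+1], for
    finiteness of the whole integral, and the rescaled ranges of the jumps. *)
Lemma gamma_density_exhaustion (u v : nat -> R) :
  (forall m, 0 < u m) -> (forall m, u m <= v m) ->
  nonincreasing_seq u -> nondecreasing_seq v ->
  u @ \oo --> 0 -> v @ \oo --> +oo ->
  (\int[leb]_(x in `[u m, v m]) (gamma_density a x)%:E)%E @[m --> \oo] -->
  (\int[leb]_(x in `]0%R, +oo[) (gamma_density a x)%:E)%E.
Proof.
move=> u0 uv du iv cu cv.
have -> : [set` `]0, +oo[] = \bigcup_m [set` `[u m, v m]].
  apply/seteqP; split => x /=; rewrite in_itv/=.
    rewrite andbT => x0.
    have H1 : \forall m \near \oo, u m <= x.
      by move/cvgr_le : cu; apply.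
    have H2 : \forall m \near \oo, x <= v m.
      by move/cvgryPge : cv; apply.
    near \oo => m; exists m => //=; rewrite in_itv/=; apply/andP; split; near: m.
      exact: H1.
    exact: H2.
  move=> [m _] /=; rewrite in_itv/= => /andP[umx _].
  by rewrite andbT (lt_le_trans (u0 m)).
apply: ge0_nondecreasing_set_cvg_integral => //.
- move=> m n mn; apply/subsetPset => x /=; rewrite !in_itv/= => /andP[h1 h2].
  by rewrite (le_trans (du _ _ mn) h1) (le_trans h2 (iv _ _ mn)).
- by move=> i; apply/measurable_EFinP; apply: measurable_funTS; exact: measurable_gamma_density.
- by move=> i x _; rewrite lee_fin gamma_density_ge0.
Unshelve. all: by end_near. Qed.

Lemma gamma_density_integral_le :
  (\int[leb]_(x in `]0%R, +oo[) (gamma_density a x)%:E <= ((1 - a)^-1)%:E)%E.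
Proof.
have cv := @gamma_density_exhaustion (fun m => (m.+1)%:R^-1) (fun m => (m.+1)%:R).
have h m : ((m.+1)%:R^-1 : R) <= (m.+1)%:R.
  by rewrite (@le_trans _ _ 1)// ?invf_le1// ler1n.
have {}cv : (\int[leb]_(x in `[(m.+1)%:R^-1%R, (m.+1)%:R]) (gamma_density a x)%:E)%E @[m --> \oo] -->
    (\int[leb]_(x in `]0%R, +oo[) (gamma_density a x)%:E)%E.
  apply: cv => //.
  - by move=> m n mn; rewrite lef_pV2 ?posrE// ler_nat.
  - by move=> m n mn; rewrite ler_nat.
  - exact: cvg_harmonic.
  - apply/cvgryPge => A; near=> n; rewrite (@le_trans _ _ n%:R)//; last by rewrite ler_nat.
    by near: n; exact: nbhs_infty_ger.
rewrite -(cvg_lim _ cv)//; apply: lime_le; first by apply/cvg_ex; eexists; exact: cv.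
by near=> m; apply: gamma_density_segment_le.
Unshelve. all: by end_near. Qed.

(** [Gamma] is a real number obtained through [fine], so it represents the integral only once that
    integral is known to be finite. *)
Lemma GammaE : ((Gamma (1 - a))%:E = \int[leb]_(x in `]0%R, +oo[) (gamma_density a x)%:E)%E.
Proof.
rewrite /Gamma /Rintegral.
have -> : (\int[leb]_(x in `]0%R, +oo[) (x `^ (1 - a - 1) * expR (- x))%:E =
    \int[leb]_(x in `]0%R, +oo[) (gamma_density a x)%:E)%E.
  by apply: eq_integral => x _; rewrite /gamma_density (_ : 1 - a - 1 = - a)//; ring.
rewrite fineK// ge0_fin_numE.
  exact: le_lt_trans gamma_density_integral_le (ltry _).
by apply: integral_ge0 => x _; rewrite lee_fin gamma_density_ge0.
Qed.

Lemma Gamma_gt0 : 0 < Gamma (1 - a).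
Proof.
rewrite -lte_fin GammaE.
(* On [1, 2] the density is at least its value at 2. *)
apply: (@lt_le_trans _ _ (\int[leb]_(x in `[1%R, 2%R]) (2 `^ (- a) * expR (- 2))%:E)%E).
  rewrite integral_cst//= lebesgue_measure_itv/= lte_fin ltr1n -EFinD -EFinM lte_fin.
  by rewrite !mulr_gt0 ?powR_gt0 ?expR_gt0//; lra.
apply: (@le_trans _ _ (\int[leb]_(x in `[1%R, 2%R]) (gamma_density a x)%:E)%E).
  apply: ge0_le_integral => //.

  - by apply/measurable_EFinP; apply: measurable_funTS; exact: measurable_gamma_density.
  - move=> x /=; rewrite in_itv/= => /andP[x1 x2]; rewrite lee_fin.
    have [a0 a1] := andP a01.
    rewrite ler_pM ?powR_ge0 ?expR_ge0//; last by rewrite ler_expR lerN2.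
    by apply: ler_powRN => //; [exact: ltW|exact: lt_le_trans x1].
apply: ge0_subset_integral => //.
- by apply/measurable_EFinP; apply: measurable_funTS; exact: measurable_gamma_density.
- by move=> x _; rewrite lee_fin gamma_density_ge0.
- by move=> x /=; rewrite !in_itv/= => /andP[x1 _]; rewrite andbT; lra.
Qed.

(* Integration by parts, then the substitution x = c y. *)
Lemma jump_integral_by_parts c u v : 0 < c -> 0 < u -> u <= v ->
  \int[leb]_(y in `[u, v]) (a * (y `^ (- a - 1) * (1 - expR (- (c * y))))) =
  u `^ (- a) * (1 - expR (- (c * u))) - v `^ (- a) * (1 - expR (- (c * v))) +
  c `^ a * \int[leb]_(x in `[c * u, c * v]) gamma_density a x.
Proof.
move=> c0 u0 uv.
have u0x x : u <= x <= v -> 0 < x by move=> /andP[ux _]; exact: lt_le_trans ux.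
pose g (y : R) := c * y `^ (- a) * expR (- (c * y)).
pose h (y : R) := a * (y `^ (- a - 1) * (1 - expR (- (c * y)))).
have dE x : is_derive x 1 (fun y => 1 - expR (- (c * y))) (c * expR (- (c * x))).
  have := is_derive1D (is_derive_cst (1 : R) x 1) (is_derive1N (is_derive1_expRN c x)).
  by move/is_derive_eq; apply; rewrite add0r mulNr opprK.
have cg x : 0 < x -> {for x, continuous g}.
  move=> x0; apply: continuousM; last exact: continuous_expRN_at.
  by apply: continuousM; [exact: cvg_cst|exact: continuous_powR_at].
have ch x : 0 < x -> {for x, continuous h}.
  move=> x0; apply: continuousM; first exact: cvg_cst.
  apply: continuousM; first exact: continuous_powR_at.
  exact: is_derive_continuous (dE x).
have ig : leb.-integrable `[u, v] (EFin \o g).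
  by apply: integrable_segment => x /u0x; exact: cg.
have ih : leb.-integrable `[u, v] (EFin \o h).
  by apply: integrable_segment => x /u0x; exact: ch.
(* The difference h - g is the derivative of - y^(-a) (1 - e^(- c y)), so both boundary terms come
   from a single use of the fundamental theorem. *)
have E1 : \int[leb]_(y in `[u, v]) (h y - g y) =
    - v `^ (- a) * (1 - expR (- (c * v))) - (- u `^ (- a) * (1 - expR (- (c * u)))).
  apply: (@Rintegral_ftc _ (fun y => h y - g y) (fun y => - y `^ (- a) * (1 - expR (- (c * y)))) _ _ uv).
  - move=> x /u0x x0.
    have := is_derive1M (is_derive1N (is_derive1_powR (- a) x0)) (dE x).
    by move/is_derive_eq; apply; rewrite /h /g; ring.
  - move=> x /u0x x0; apply: continuousB; [exact: ch|exact: cg].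
have E2 : c `^ a * \int[leb]_(x in `[c * u, c * v]) gamma_density a x =
    \int[leb]_(y in `[u, v]) g y.
  have D1 (y : R) : is_derive y 1 (fun y : R => c * y) c.
    by have := is_derive1Z c (is_derive_id y (1 : R)); rewrite mulr1.
  have D2 : (fun y : R => c * y)^`()%classic = cst c.
    by apply/funext => y; rewrite derive1E; case: (D1 y).
  have cD y : {for y, continuous (fun y => c * y)}.
    exact: is_derive_continuous (D1 y).
  rewrite {1}/Rintegral (@integration_by_substitution_increasing _ (fun y => c * y))//.
  - have cgd x : 0 < x -> {for x, continuous (fun y => gamma_density a (c * y) * c)}.
      move=> x0; apply: continuousM; last exact: cvg_cst.
      apply: (@continuous_comp _ _ _ (fun y => c * y) (gamma_density a)); first exact: cD.
      by apply: continuous_gamma_density; rewrite mulr_gt0.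
    transitivity (c `^ a * \int[leb]_(y in `[u, v]) (gamma_density a (c * y) * c)).
      by rewrite /Rintegral D2.
    rewrite -RintegralZl//; last by apply: integrable_segment => x /u0x; exact: cgd.
    apply: eq_Rintegral => y; rewrite inE/= in_itv/= => /u0x y0.
    rewrite /gamma_density /g powRM ?(ltW c0) ?(ltW y0)// (powRN c).
    by field; rewrite gt_eqF// powR_gt0.
  - by move=> x y _ _ xy; rewrite ltr_pM2l.
  - by rewrite D2 => x _; exact: cst_continuous.
  - by rewrite D2; exact: is_cvg_cst.
  - by rewrite D2; exact: is_cvg_cst.
  - split.
    + by move=> x _; case: (D1 x).
    + by apply: cvg_at_right_filter; exact: cD.
    + by apply: cvg_at_left_filter; exact: cD.
  - apply: continuous_in_subspaceT => x; rewrite inE/= in_itv/= => /andP[xu _].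
    by apply: continuous_gamma_density; rewrite (lt_le_trans _ xu)// mulr_gt0.
rewrite E2; apply/eqP; rewrite -subr_eq; apply/eqP.
rewrite -/h -RintegralB// E1; ring.
Qed.

Lemma jump_density_patch m (g : R -> R) y : jump_density a m y * g y =
  ((fun y => (m%:R `^ a * (1 - m%:R `^ (- (3 * a))))^-1 * (a * (y `^ (- a - 1) * g y)))
    \_ `]m%:R^-1, m%:R ^+ 2[) y.
Proof.
rewrite /jump_density patchE indicE; case: ifP => _ /=; last by rewrite mulr0 mul0r.
by rewrite mulr1; ring.
Qed.

Lemma jump_integrable m (g : R -> R) : (2 <= m)%N ->
  (forall y, 0 < y -> {for y, continuous g}) ->
  leb.-integrable setT (EFin \o (fun y => jump_density a m y * g y)).
Proof.
move=> m2 cg; have m0 : (0 : R) < m%:R by rewrite ltr0n ltnW.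
rewrite (_ : (fun y => _) = (fun y => (m%:R `^ a * (1 - m%:R `^ (- (3 * a))))^-1 *
    (a * (y `^ (- a - 1) * g y))) \_ `]m%:R^-1, m%:R ^+ 2[); last first.
  by apply/funext => y; rewrite jump_density_patch.
set I := [set` `]m%:R^-1, m%:R ^+ 2[].
set h := fun y : R => _ * (a * _).
have H : leb.-integrable I (EFin \o h) -> leb.-integrable setT ((EFin \o h) \_ I).
  by apply: (iffLR (integrable_mkcond _ _)); exact: measurable_itv.
rewrite -restrict_EFin; apply: H.
(* The closed interval stays away from 0, so continuity on it gives integrability; the open one is a
   subset. *)
suff hi : leb.-integrable `[m%:R^-1, m%:R ^+ 2] (EFin \o h).
  by rewrite /I; apply: integrableS hi => //; exact: subset_itv_oo_cc.
apply: integrable_segment => x /andP[ux _].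
have x0 : 0 < x by apply: lt_le_trans ux; rewrite invr_gt0.
apply: continuousM; first exact: cvg_cst.
apply: continuousM; first exact: cvg_cst.
by apply: continuousM; [exact: continuous_powR_at|exact: cg].
Qed.

Lemma jump_integralE m (g : R -> R) : (2 <= m)%N ->
  (forall y, 0 < y -> {for y, continuous g}) ->
  \int[leb]_y (jump_density a m y * g y) = (m%:R `^ a * (1 - m%:R `^ (- (3 * a))))^-1 *
    \int[leb]_(y in `[m%:R^-1, m%:R ^+ 2]) (a * (y `^ (- a - 1) * g y)).
Proof.
move=> m2 cg; have m0 : (0 : R) < m%:R by rewrite ltr0n ltnW.
set C := (_ * _)^-1; set u := m%:R^-1; set v := m%:R ^+ 2.
have uv : u <= v.
  rewrite (@le_trans _ _ 1)// ?invf_le1 ?ler1n ?(ltnW m2)//.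
  by rewrite exprn_ege1// ler1n ltnW.
have u0x x : u <= x <= v -> 0 < x.
  by move=> /andP[ux _]; apply: lt_le_trans ux; rewrite invr_gt0.
have ci x : 0 < x -> {for x, continuous (fun y => a * (y `^ (- a - 1) * g y))}.
  move=> x0; apply: continuousM; first exact: cvg_cst.
  by apply: continuousM; [exact: continuous_powR_at|exact: cg].
have ii : leb.-integrable `[u, v] (EFin \o (fun y => a * (y `^ (- a - 1) * g y))).
  by apply: integrable_segment => x /u0x; exact: ci.
transitivity (\int[leb]_(y in `]u, v[) (C * (a * (y `^ (- a - 1) * g y)))).
  by rewrite [RHS]Rintegral_mkcond; apply: eq_Rintegral => y _; rewrite jump_density_patch.
rewrite -RintegralZl//; rewrite /Rintegral; congr fine.
symmetry; rewrite (@integral_itv_bndoo _ u v _ true false)//.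
have /integrableP[mi _] : leb.-integrable `[u, v]
    (EFin \o (fun y => C * (a * (y `^ (- a - 1) * g y)))).
  apply: integrable_segment => x /u0x x0.
  by apply: continuousM; [exact: cvg_cst|exact: ci].
by apply: measurable_funS mi => //; exact: subset_itv_oo_cc.
Qed.

Lemma jump_density_normalized m : (2 <= m)%N -> \int[leb]_y jump_density a m y = 1.
Proof.
move=> m2; have [a0 a1] := andP a01.
have m0 : (0 : R) < m%:R by rewrite ltr0n ltnW.
under eq_Rintegral do rewrite -(mulr1 (jump_density _ _ _)).
rewrite (jump_integralE m2)//; last by move=> y _; exact: cvg_cst.
set u := m%:R^-1; set v := m%:R ^+ 2.
have uv : u <= v.
  rewrite (@le_trans _ _ 1)// ?invf_le1 ?ler1n ?(ltnW m2)//.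
  by rewrite exprn_ege1// ler1n ltnW.
have u0x x : u <= x <= v -> 0 < x.
  by move=> /andP[ux _]; apply: lt_le_trans ux; rewrite invr_gt0.
have -> : \int[leb]_(y in `[u, v]) (a * (y `^ (- a - 1) * 1)) = - v `^ (- a) - - u `^ (- a).
  apply: (@Rintegral_ftc _ _ (fun y => - y `^ (- a)) _ _ uv) => x /u0x x0.
    have := is_derive1N (is_derive1_powR (- a) x0).
    by move/is_derive_eq; apply; rewrite mulr1 mulNr opprK.
  apply: continuousM; first exact: cvg_cst.
  by apply: continuousM; [exact: continuous_powR_at|exact: cvg_cst].
have -> : u `^ (- a) = m%:R `^ a.
  by rewrite /u -powR_inv1 ?ltW// -powRrM mulN1r opprK.
have -> : v `^ (- a) = m%:R `^ a * m%:R `^ (- (3 * a)).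
  rewrite /v -powR_mulrn ?ltW// -powRrM -powRD; last by rewrite (gt_eqF m0) implybT.
  by congr (_ `^ _); ring.
(* At m = 1 this constant vanishes; the hypothesis m >= 2 excludes that case. *)
have d0 : m%:R `^ a * (1 - m%:R `^ (- (3 * a))) != 0 :> R.
  rewrite mulf_neq0 ?gt_eqF ?powR_gt0// subr_gt0.
  rewrite powRN invf_lt1 ?powR_gt0//.
  rewrite (_ : (1 < _) = (1 `^ (3 * a) < m%:R `^ (3 * a))); last by rewrite powR1.
  by rewrite gt0_ltr_powR ?nnegrE ?ler01 ?(ltW m0) ?mulr_gt0// ltr1n.
by rewrite opprK -[X in _ * X](_ : m%:R `^ a * (1 - m%:R `^ (- (3 * a))) = _) ?mulVf//; ring.
Qed.

Lemma cvg_natr_powRN p : 0 < p -> (m%:R : R) `^ (- p) @[m --> \oo] --> 0.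
Proof.
move=> p0; rewrite -cvg_shiftS/=.
under eq_fun do rewrite powRN -powR_inv1 ?powR_ge0// -powRrM mulrC powRrM powR_inv1//.
apply: (@cvg_comp _ _ _ (fun m => (m.+1)%:R^-1) (fun x => x `^ p) _ (0^'+) _ _ (powR_cvg0 p0)).
move=> A /= [e e0 eA]; near=> m; apply: eA => /=; last by rewrite invr_gt0.
rewrite sub0r normrN ger0_norm ?invr_ge0//.
near: m; have := @cvg_harmonic R; move/cvgrPdist_lt => /(_ e e0).
by apply: filterS => m; rewrite sub0r normrN ger0_norm// invr_ge0.
Unshelve. all: by end_near. Qed.

(** The density has mass one, so 1 minus the transform is the integral of the density against 1 -
    e^(- c y) with c = theta / m. Integration by parts on [1/m, m^2] then applies, and c times the
    end points gives theta / m^2 and theta m. *)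
Lemma jump_laplaceE (theta : R) m : (2 <= m)%N -> 0 < theta ->
  1 - \int[leb]_y (jump_density a m y * expR (- (theta * y / m%:R))) =
  (m%:R `^ a * (1 - m%:R `^ (- (3 * a))))^-1 *
  (m%:R `^ a * (1 - expR (- (theta / m%:R ^+ 2)))
   - m%:R `^ (- (2 * a)) * (1 - expR (- (theta * m%:R)))
   + (theta / m%:R) `^ a *
     \int[leb]_(x in `[theta / m%:R ^+ 2, theta * m%:R]) gamma_density a x).
Proof.
move=> m2 t0; have m0 : (0 : R) < m%:R by rewrite ltr0n ltnW.
set c := theta / m%:R; have c0 : 0 < c by rewrite divr_gt0.
set u := m%:R^-1; set v := m%:R ^+ 2.
have uv : u <= v.
  rewrite (@le_trans _ _ 1)// ?invf_le1 ?ler1n ?(ltnW m2)//.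
  by rewrite exprn_ege1// ler1n ltnW.
have u0 : 0 < u by rewrite invr_gt0.
rewrite -[X in X - _](jump_density_normalized m2).
have -> : \int[leb]_y (jump_density a m y * expR (- (theta * y / m%:R))) =
    \int[leb]_y (jump_density a m y * expR (- (c * y))).
  by apply: eq_Rintegral => y _; congr (_ * expR (- _)); rewrite /c mulrAC.
have -> : \int[leb]_y jump_density a m y = \int[leb]_y (jump_density a m y * cst 1 y).
  by apply: eq_Rintegral => y _; rewrite mulr1.
rewrite -RintegralB//; last 2 first.
- by apply: jump_integrable => // y _; exact: cvg_cst.
- by apply: jump_integrable => // y _; exact: continuous_expRN_at.
under eq_Rintegral do rewrite -mulrBr.
rewrite (@jump_integralE m (fun y => 1 - expR (- (c * y))))//; last first.
  by move=> y _; apply: continuousB; [exact: cvg_cst|exact: continuous_expRN_at].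
rewrite (jump_integral_by_parts c0 u0 uv); congr (_ * _).
have -> : c * u = theta / m%:R ^+ 2 by rewrite /c /u -mulrA -invfM expr2.
have -> : c * v = theta * m%:R by rewrite /c /v expr2; field; rewrite gt_eqF.
have -> : u `^ (- a) = m%:R `^ a.
  by rewrite /u -powR_inv1 ?ltW// -powRrM mulN1r opprK.
have -> // : v `^ (- a) = m%:R `^ (- (2 * a)).
by rewrite /v -powR_mulrn ?ltW// -powRrM mulrN.
Qed.

(** After multiplication by m^(2a), and up to a factor tending to 1, the boundary terms are at most
    theta m^(2a - 2) and m^(-a). Both vanish because 0 < a < 1, and the remaining integral over
    [theta / m^2, theta m] exhausts Gamma (1 - a). *)
Lemma jump_laplace_cvg (theta : R) : 0 <= theta ->
  m%:R `^ (2 * a) * (1 - \int[leb]_y (jump_density a m y * expR (- (theta * y / m%:R))))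
    @[m --> \oo] --> Gamma (1 - a) * theta `^ a.
Proof.
have [a0 a1] := andP a01.
(* At theta = 0 the segments collapse and [jump_laplaceE] does not apply, but there the difference
   is 0 by normalization. *)
rewrite le_eqVlt => /predU1P[<-|theta0].
  rewrite powR0 ?gt_eqF// mulr0; apply: cvg_near_cst; near=> m.
  under eq_Rintegral do rewrite !mul0r oppr0 expR0 mulr1.
  rewrite jump_density_normalized ?subrr ?mulr0//.
  by near: m; exact: nbhs_infty_ge.
pose J (m : nat) := \int[leb]_(x in `[theta / m%:R ^+ 2, theta * m%:R]) gamma_density a x.
pose F (m : nat) : R := (1 - m%:R `^ (- (3 * a)))^-1 * (m%:R `^ (2 * a) * (1 - expR (- (theta / m%:R ^+ 2)))
  - m%:R `^ (- a) * (1 - expR (- (theta * m%:R))) + theta `^ a * J m).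
have cJ : J @ \oo --> Gamma (1 - a).
  have tm (m : nat) : theta / (m.+1)%:R ^+ 2 <= theta * (m.+1)%:R.
    rewrite ler_pM2l// (@le_trans _ _ 1)//; last by rewrite ler1n.
    by rewrite invf_le1 ?exprn_gt0// exprn_ege1// ler1n.
  rewrite -(cvg_shiftS J); apply: fine_cvg; rewrite GammaE.
  apply: (@gamma_density_exhaustion (fun m => theta / (m.+1)%:R ^+ 2)
    (fun m => theta * (m.+1)%:R)) => //.
  - by move=> m; rewrite divr_gt0// exprn_gt0.
  - move=> m n mn; rewrite ler_pM2l// lef_pV2 ?posrE ?exprn_gt0//.
    by rewrite lerXn2r ?nnegrE// ler_nat.
  - by move=> m n mn; rewrite ler_pM2l// ler_nat.
  - apply: (@squeeze_cvgr _ _ _ _ (cst 0) (fun m => theta * (m.+1)%:R^-1)); last 2 first.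
    + exact: cvg_cst.
    + rewrite -[X in _ --> X](mulr0 theta); apply: cvgM; first exact: cvg_cst.
      exact: cvg_harmonic.
    + near=> m; rewrite divr_ge0 ?(ltW theta0) ?exprn_ge0//= ler_pM2l//.
      by rewrite lef_pV2 ?posrE ?exprn_gt0// expr2 ler_peMr// ler1n.
  - apply/cvgryPge => A; near=> n; rewrite -ler_pdivrMl// (@le_trans _ _ n%:R)//; last by rewrite ler_nat.
    by near: n; exact: nbhs_infty_ger.
have cF : F @ \oo --> (1 - 0)^-1 * (0 - 0 + theta `^ a * Gamma (1 - a)).
  apply: cvgM.
    apply: cvgV; first by rewrite subr0 oner_eq0.
    by apply: cvgB; [exact: cvg_cst|apply: cvg_natr_powRN; rewrite mulr_gt0].
  apply: cvgD; last by apply: cvgM; [exact: cvg_cst|exact: cJ].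
  apply: cvgB.
  - apply: (@squeeze_cvgr _ _ _ _ (cst 0) (fun m => theta * m%:R `^ (- (2 - 2 * a)))); last 2 first.
    + exact: cvg_cst.
    + rewrite -[X in _ --> X](mulr0 theta); apply: cvgM; first exact: cvg_cst.
      by apply: cvg_natr_powRN; lra.
    + near=> m; have m0 : (0 : R) < m%:R by rewrite ltr0n; near: m; exact: nbhs_infty_gt.
      have e0 : 0 <= 1 - expR (- (theta / m%:R ^+ 2)).
        by rewrite subr_ge0 expR_le1 oppr_le0 divr_ge0 ?(ltW theta0) ?exprn_ge0.
      rewrite mulr_ge0 ?powR_ge0//= opprB powRD; last by rewrite (gt_eqF m0) implybT.
      rewrite [leRHS]mulrCA ler_wpM2l ?powR_ge0// powRN powR_mulrn//.
      by have := expR_ge1Dx (- (theta / m%:R ^+ 2)); lra.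
  - apply: (@squeeze_cvgr _ _ _ _ (cst 0) (fun m => m%:R `^ (- a))); last 2 first.
    + exact: cvg_cst.
    + exact: cvg_natr_powRN.
    + near=> m; have e0 : 0 <= 1 - expR (- (theta * m%:R)).
        by rewrite subr_ge0 expR_le1 oppr_le0 mulr_ge0 ?(ltW theta0).
      by rewrite mulr_ge0 ?powR_ge0//= ler_piMr ?powR_ge0// gerBl expR_ge0.
move: cF; rewrite !subr0 invr1 mul1r add0r mulrC; apply: cvg_trans.
apply: near_eq_cvg; near=> m.
have m2 : (2 <= m)%N by near: m; exact: nbhs_infty_ge.
have m0 : (0 : R) < m%:R by rewrite ltr0n ltnW.
rewrite jump_laplaceE// invfM -/(J m) /F.
rewrite powRM ?invr_ge0 ?ltW//.
have -> : m%:R^-1 `^ a = m%:R `^ (- a) :> R.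
  by rewrite -powR_inv1 ?(ltW m0)// -powRrM mulN1r.
rewrite !powRN !mulrA.
have -> : m%:R `^ (2 * a) = m%:R `^ a * m%:R `^ a :> R.
  by rewrite -powRD ?(gt_eqF m0) ?implybT//; congr (_ `^ _); ring.
have := powR_gt0 a m0; set q := m%:R `^ a; set r := (1 - _)^-1 => q0.
by field; rewrite gt_eqF.
Unshelve. all: by end_near. Qed.

End powers.

(** * The L^2 norm *)

Definition sqL2 (R : realType) (f : R -> R[i]) : \bar R :=
  (\int[@lebesgue_measure R]_x ((nc (f x)) ^+ 2)%:E)%E.

Local Instance ae_lebesgue_filter (R : realType) :
  Filter (nbhs (almost_everywhere (@lebesgue_measure R))).
Proof. exact: (ae_filter_ringOfSetsType (@lebesgue_measure R)). Qed.

Section L2_norm.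
Variable R : realType.
Implicit Types (f g h : R -> R[i]) (c e : R).
Local Notation leb := (@lebesgue_measure R).

Lemma sqL2_ge0 f : (0 <= sqL2 f)%E.
Proof. by apply: integral_ge0 => x _; rewrite lee_fin sqr_ge0. Qed.

Lemma measurable_sq_normc f : cmeas f -> measurable_fun setT (fun x => ((nc (f x)) ^+ 2)%:E).
Proof.
by move=> mf; apply/measurable_EFinP; apply: measurable_funX; exact: cmeas_normc.
Qed.

Lemma L2normE f : L2norm f = (sqL2 f `^ (2^-1))%E.
Proof.
rewrite /L2norm unlock /=; congr (_ `^ _)%E; apply: eq_integral => x _.
by rewrite /= (ger0_norm (normc_ge0 _)) powR_mulrn ?normc_ge0.
Qed.

Lemma L2norm_ge0 f : (0 <= L2norm f)%E.
Proof. by rewrite L2normE poweR_ge0. Qed.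

Lemma L2P f : L2 f <-> cmeas f /\ (sqL2 f < +oo)%E.
Proof.
rewrite /L2 L2normE; split=> -[mf h]; split => //.
- by move: h; apply: lty_poweRy; rewrite invr_eq0 pnatr_eq0.
- exact: poweR_lty.
Qed.

Lemma le_poweR_half (x y : \bar R) : (0 <= x -> x <= y -> x `^ 2^-1 <= y `^ 2^-1)%E.
Proof.
move=> x0 xy; apply: gt0_ler_poweR => //; rewrite ?invr_ge0//.
- by rewrite in_itv/= x0 leey.
- by rewrite in_itv/= (le_trans x0 xy) leey.
Qed.

Lemma L2norm_le_scale f g c : 0 <= c -> (sqL2 f <= (c ^+ 2)%:E * sqL2 g)%E ->
  (L2norm f <= c%:E * L2norm g)%E.
Proof.
move=> c0 /(le_poweR_half (sqL2_ge0 f)); rewrite -!L2normE poweRM ?sqL2_ge0 ?lee_fin ?sqr_ge0//.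
rewrite -L2normE poweR_EFin -powR_mulrn// -powRrM divff ?pnatr_eq0//.
by rewrite powRr1.
Qed.

Lemma L2norm_le_real f c : 0 <= c -> (sqL2 f <= (c ^+ 2)%:E)%E -> (L2norm f <= c%:E)%E.
Proof.
move=> c0 /(le_poweR_half (sqL2_ge0 f)); rewrite -L2normE.
by rewrite poweR_EFin -powR_mulrn// -powRrM divff ?pnatr_eq0// powRr1.
Qed.

Lemma le_sqL2 f g : cmeas f -> cmeas g ->
  (forall x, nc (f x) <= nc (g x)) -> (sqL2 f <= sqL2 g)%E.
Proof.
move=> mf mg fg; apply: ge0_le_integral => //.
- by move=> x _; rewrite lee_fin sqr_ge0.
- exact: measurable_sq_normc.
- exact: measurable_sq_normc.
- by move=> x _; rewrite lee_fin lerXn2r ?nnegrE ?normc_ge0.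
Qed.

Lemma L2norm_normc f g : (forall x, nc (f x) = nc (g x)) -> L2norm f = L2norm g.
Proof. by move=> fg; rewrite /L2norm; apply: eq_Lnorm => x; rewrite fg. Qed.

Lemma L2norm_distC f g : L2norm (fun x => f x - g x) = L2norm (fun x => g x - f x).
Proof. by apply: L2norm_normc => x; exact: distcC. Qed.

Lemma sqL2Z (a : R[i]) f : cmeas f ->
  sqL2 (fun x => a * f x) = ((nc a ^+ 2)%:E * sqL2 f)%E.
Proof.
move=> mf; rewrite /sqL2 -ge0_integralZl ?lee_fin ?sqr_ge0//.
- by apply: eq_integral => x _; rewrite Normc.normcM exprMn EFinM.
- exact: measurable_sq_normc.
- by move=> x _; rewrite lee_fin sqr_ge0.
Qed.

Lemma L2normZ_le (a : R[i]) f : cmeas f -> (L2norm (fun x => (a * f x)%R) <= (nc a)%:E * L2norm f)%E.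
Proof. by move=> mf; apply: L2norm_le_scale; rewrite ?normc_ge0// sqL2Z. Qed.

Lemma L2norm_le f g : cmeas f -> cmeas g ->
  (forall x, nc (f x) <= nc (g x)) -> (L2norm f <= L2norm g)%E.
Proof.
move=> mf mg fg; have := @L2norm_le_scale f g 1 ler01.
by rewrite expr1n !mul1e; apply; exact: le_sqL2.
Qed.

Lemma L2normD f g : cmeas f -> cmeas g ->
  (L2norm (fun x => f x + g x)%R <= L2norm f + L2norm g)%E.
Proof.
move=> mf mg; have := @minkowski_EFin _ _ _ leb (fun x => nc (f x)) (fun x => nc (g x)) 2.
move=> /(_ (cmeas_normc mf) (cmeas_normc mg)).
rewrite ler1n => /(_ isT); apply: le_trans.
have -> : L2norm (fun x => f x + g x) = L2norm (fun x => (nc (f x + g x))%:C).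
  by apply: L2norm_normc => x; rewrite normc_real ger0_norm// normc_ge0.
rewrite (_ : Lnorm _ _ _ = L2norm (fun x => (nc (f x) + nc (g x))%:C)); last first.
  by rewrite /L2norm; apply: eq_Lnorm => x; rewrite normc_real ger0_norm// addr_ge0 ?normc_ge0.
apply: L2norm_le.
- by apply: cmeas_real; apply: cmeas_normc; exact: cmeasD.
- by apply: cmeas_real; apply: measurable_funD; exact: cmeas_normc.
- by move=> x; rewrite !normc_real !ger0_norm ?addr_ge0 ?normc_ge0// normcD_le.
Qed.

Lemma L2normB_le f g h : cmeas f -> cmeas g -> cmeas h ->
  (L2norm (fun x => f x - h x)%R <= L2norm (fun x => f x - g x)%R + L2norm (fun x => g x - h x)%R)%E.
Proof.
move=> mf mg mh; apply: (le_trans _ (L2normD (cmeasB mf mg) (cmeasB mg mh))).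
by rewrite (_ : (fun x => f x - h x) = fun x => f x - g x + (g x - h x))//;
  apply/funext => x; rewrite addrA subrK.
Qed.

Lemma L2D f g : L2 f -> L2 g -> L2 (fun x => f x + g x).
Proof.
move=> [mf f2] [mg g2]; split; first exact: cmeasD.
by rewrite (le_lt_trans (L2normD mf mg))// lte_add_pinfty.
Qed.

Lemma L2Z (a : R[i]) f : L2 f -> L2 (fun x => a * f x).
Proof.
move=> [mf f2]; split; first by apply: cmeasM => //; exact: cmeas_cst.
rewrite (le_lt_trans (L2normZ_le a mf))// lte_mul_pinfty ?lee_fin ?normc_ge0//.
Qed.

Lemma L2B f g : L2 f -> L2 g -> L2 (fun x => f x - g x).
Proof.
move=> f2 g2; under eq_fun do rewrite -(mulN1r (g _)).
by apply: L2D => //; exact: L2Z.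
Qed.

Lemma L2_le f g : cmeas f -> L2 g -> (forall x, nc (f x) <= nc (g x)) -> L2 f.
Proof. by move=> mf [mg g2] fg; split => //; apply: le_lt_trans g2; exact: L2norm_le. Qed.

Lemma aeeq_L2norm f g : cmeas f -> cmeas g -> aeeq f g -> L2norm f = L2norm g.
Proof.
move=> mf mg fg; rewrite !L2normE; congr (_ `^ _)%E; apply: ge0_ae_eq_integral => //.
- exact: measurable_sq_normc.
- exact: measurable_sq_normc.
- by move=> x _; rewrite lee_fin sqr_ge0.
- by move=> x _; rewrite lee_fin sqr_ge0.
- by apply: (filterS _ fg) => x fgx _; rewrite fgx.
Qed.

Lemma aeeqB f f' g g' : aeeq f f' -> aeeq g g' ->
  aeeq (fun x => f x - g x) (fun x => f' x - g' x).
Proof. by move=> ff gg; apply: filterS2 ff gg => x -> ->. Qed.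

Lemma aeeq_trans f g h : aeeq f g -> aeeq g h -> aeeq f h.
Proof. by move=> ff gg; apply: filterS2 ff gg => x -> ->. Qed.

Lemma aeeq_sym f g : aeeq f g -> aeeq g f.
Proof. by apply: filterS => x ->. Qed.

Lemma aeeq_refl f : aeeq f f.
Proof. exact: filterE. Qed.

Lemma L2norm_eq0 f g : cmeas f -> cmeas g ->
  L2norm (fun x => f x - g x) = 0%E -> aeeq f g.
Proof.
move=> mf mg /Lnorm_eq0_eq0 h.
have : (fun x => (nc (f x - g x))%:E) = \0%E %[ae leb].
  apply: h => //; apply/measurable_EFinP; apply: cmeas_normc; exact: cmeasB.
apply: filterS => x /(_ I) /= [] /Normc.eq0_normc/eqP.
by rewrite subr_eq0 => /eqP.
Qed.

(** Convergence to 0 in the extended reals becomes a family of eventual real bounds; the bound with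
    e = 1 supplies the eventual finiteness that such convergence contains. *)
Lemma cvg_L2norm0 (T : Type) (Fi : set_system T) {FF : Filter Fi} (F : T -> \bar R) :
  (forall t, 0 <= F t)%E ->
  (forall e, 0 < e -> \forall t \near Fi, (F t <= e%:E)%E) <-> F @ Fi --> 0%E.
Proof.
move=> F0; split=> [h|/fine_cvgP[Ffin /cvgr_dist_le h] e e0].
  apply/fine_cvgP; split.
    have := h 1 ltr01; apply: filterS => t ht.
    by rewrite ge0_fin_numE// (le_lt_trans ht)// ltry.
  apply/cvgrPdist_le => e e0; have := h e e0; apply: filterS => t /=.
  rewrite sub0r normrN; have := F0 t; case: (F t) => [r| |]//=.
  by rewrite !lee_fin => r0 re; rewrite ger0_norm.
have := h e e0; apply: filterS2 Ffin => t /=.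
have := F0 t; case: (F t) => [r| |]//=.
by rewrite !lee_fin => r0 _; rewrite sub0r normrN ger0_norm.
Qed.

End L2_norm.

Section reflection.
Variable R : realType.
Local Notation leb := (@lebesgue_measure R).

Lemma integral_oppr (f : R -> \bar R) : measurable_fun setT f ->
  (\int[leb]_x f (- x)%R = \int[leb]_x f x)%E.
Proof.
have E g : measurable_fun setT g -> (forall x, 0 <= g x)%E ->
    (\int[leb]_x g (- x)%R = \int[leb]_x g x)%E.
  move=> mg g0; have := @ge0_integral_pushforward _ _ (measurableTypeR R) (measurableTypeR R) R
    -%R (@oppr_measurable R setT) leb setT g measurableT mg (fun x _ => g0 x).
  rewrite preimage_setT /= => <-.
  by apply: eq_measure_integral => A mA _; exact: lebesgue_measureN.
move=> mf; rewrite [RHS]integralE.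
rewrite -(E _ (measurable_funepos mf))// -(E _ (measurable_funeneg mf))//.
rewrite [LHS]integralE; apply: congr2.
- by apply: eq_integral => x _; rewrite !funeposE.
- by congr (- _)%E; apply: eq_integral => x _; rewrite !funenegE.
Qed.

Lemma Rintegral_oppr (f : R -> R) : measurable_fun setT f ->
  \int[leb]_x f (- x) = \int[leb]_x f x.
Proof.
move=> mf; rewrite /Rintegral -(integral_oppr (f := EFin \o f))//.
exact/measurable_EFinP.
Qed.

Lemma cmeas_oppr (f : R -> R[i]) : cmeas f ->
  cmeas (fun x => f (- x)).
Proof. by move=> mf; exact: (measurableT_comp mf (@oppr_measurable R setT)). Qed.

Lemma sqL2_oppr (f : R -> R[i]) : cmeas f ->
  sqL2 (fun x => f (- x)) = sqL2 f.
Proof. by move=> mf; exact: (integral_oppr (measurable_sq_normc mf)). Qed.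

End reflection.

(** The Fourier transform of [abel_weight e]; its total mass is 2 pi rather than 1, which is the
    constant in Plancherel's identity. *)
Definition poisson_kernel (R : realType) (e h : R) : R := 2 * e / (e ^+ 2 + h ^+ 2).

Definition abel_weight (R : realType) (e y : R) : R := expR (- (e * `|y|)).

(** * Plancherel's identity *)

Section poisson_kernel.
Variable R : realType.
Local Notation leb := (@lebesgue_measure R).

Lemma integral_cauchy : (\int[leb]_u (2 / (1 + u ^+ 2))%:E)%E = (2 * pi : R)%:E.
Proof.
have d0 (u : R) : 0 < 1 + u ^+ 2 by rewrite ltr_pwDl// sqr_ge0.
have cG (u : R) : {for u, continuous (fun u : R => 2 / (1 + u ^+ 2))}.
  apply: continuousM; first exact: cvg_cst.
  apply: continuousV; first by rewrite gt_eqF.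
  by apply: continuousD; [exact: cvg_cst|exact: exprn_continuous].
rewrite ge0_symfun_integralT//; last 2 first.
- by move=> u; rewrite divr_ge0// ltW.
- by move=> u /=; rewrite sqrrN.
rewrite -(set_itvcy 0) (@ge0_continuous_FTC2y _ _ (fun u => 2 * atan u) 0 pi).
- by rewrite atan0 mulr0 sube0 -EFinM.
- by move=> u _; rewrite divr_ge0// ltW.
- by apply: continuous_subspaceT => u; exact: cG.
- have -> : pi = 2 * (pi / 2) :> R by field.
  by apply: cvgM; [exact: cvg_cst|exact: cvgy_atan].
- by move=> u _; case: (is_derive1Z 2 (is_derive1_atan u)).
- apply: cvg_at_right_filter.
  exact: is_derive_continuous (is_derive1Z 2 (is_derive1_atan 0)).
- by move=> u _; rewrite derive1E; case: (is_derive1Z 2 (is_derive1_atan u)).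
Qed.

Variable e : R.
Hypothesis e0 : 0 < e.

Lemma poisson_den_gt0 (h : R) : 0 < e ^+ 2 + h ^+ 2.
Proof. by rewrite ltr_pwDl ?exprn_gt0// sqr_ge0. Qed.

Lemma poisson_kernel_ge0 h : 0 <= poisson_kernel e h.
Proof. by rewrite divr_ge0 ?mulr_ge0 ?(ltW e0)// ltW// poisson_den_gt0. Qed.

Lemma poisson_kernelN h : poisson_kernel e (- h) = poisson_kernel e h.
Proof. by rewrite /poisson_kernel sqrrN. Qed.

Lemma poisson_kernel_le h : poisson_kernel e h <= 2 / e.
Proof.
rewrite /poisson_kernel ler_pdivrMr ?poisson_den_gt0//.
rewrite -subr_ge0 (_ : _ - _ = 2 * h ^+ 2 / e); last by field; rewrite gt_eqF.
by apply: divr_ge0; [apply: mulr_ge0 => //; exact: sqr_ge0|exact: ltW].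
Qed.

Lemma continuous_poisson_kernel : continuous (poisson_kernel e).
Proof.
have H (h : R) : {for h, continuous (fun h : R => 2 * e / (e ^+ 2 + h ^+ 2))}.
  apply: continuousM; first exact: cvg_cst.
  apply: continuousV; first by rewrite gt_eqF// poisson_den_gt0.
  by apply: continuousD; [exact: cvg_cst|exact: exprn_continuous].
exact: H.
Qed.

Lemma measurable_poisson_kernel : measurable_fun setT (poisson_kernel e).
Proof. by apply: continuous_measurable_fun; exact: continuous_poisson_kernel. Qed.

Lemma integral_poisson_kernel (x : R) :
  (\int[leb]_y (poisson_kernel e (x - y))%:E)%E = (2 * pi)%:E.
Proof.
rewrite -integral_cauchy.
have d0 (u : R) : 0 < 1 + u ^+ 2 by rewrite ltr_pwDl// sqr_ge0.
pose F (y : R) := (y - x) / e.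
have dF (y : R) : is_derive y 1 F (e^-1).
  have := is_derive1M (is_derive1D (is_derive_id y (1 : R)) (is_derive_cst (- x) y 1))
    (is_derive_cst e^-1 y 1).
  by move/is_derive_eq; apply; rewrite addr0 mul1r mulr0 addr0.
have DF : F^`()%classic = cst e^-1.
  by apply/funext => y; rewrite derive1E; case: (dF y).
have cG (u : R) : {for u, continuous (fun u : R => 2 / (1 + u ^+ 2))}.
  apply: continuousM; first exact: cvg_cst.
  apply: continuousV; first by rewrite gt_eqF.
  by apply: continuousD; [exact: cvg_cst|exact: exprn_continuous].
rewrite (@increasing_ge0_integration_by_substitutionT _ F (fun u => 2 / (1 + u ^+ 2))).
- rewrite DF; apply: eq_integral => y _; congr _%:E => /=.
  have h2 := poisson_den_gt0 (y - x).
  rewrite /poisson_kernel -(sqrrN (x - y)) opprB fctE /= /F; field.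
  by rewrite !gt_eqF//= exprMn exprVn; apply: mulr_gt0.
- by move=> u v uv; rewrite ltr_pM2r ?invr_gt0// ltrD2r.
- by rewrite DF; exact: cst_continuous.
- by rewrite DF; exact: is_cvg_cst.
- by rewrite DF; exact: is_cvg_cst.
- by move=> y; case: (dF y).
- apply/cvgrNyPle => A; near=> y; rewrite ler_pdivrMr// lerBlDr.
  by near: y; apply: nbhs_ninfty_le; exact: num_real.
- apply/cvgryPge => A; near=> y; rewrite ler_pdivlMr// lerBrDr.
  by near: y; apply: nbhs_pinfty_ge; exact: num_real.
- exact: cG.
- by move=> u; rewrite divr_ge0// ltW.
Unshelve. all: by end_near. Qed.

Lemma integrable_poisson_kernel (x : R) :
  leb.-integrable setT (fun y => (poisson_kernel e (x - y))%:E).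
Proof.
apply/integrableP; split.
  apply/measurable_EFinP; apply: measurableT_comp; first exact: measurable_poisson_kernel.
  by apply: measurable_funB; [exact: measurable_cst|exact: measurable_id].
have -> : (\int[leb]_y `|(poisson_kernel e (x - y))%:E| =
    \int[leb]_y (poisson_kernel e (x - y))%:E)%E.
  by apply: eq_integral => y _; rewrite /= ger0_norm// poisson_kernel_ge0.
by rewrite integral_poisson_kernel ltry.
Qed.

Lemma abel_weight_ge0 y : 0 <= abel_weight e y.
Proof. exact: expR_ge0. Qed.

Lemma continuous_abel_weight : continuous (abel_weight e).
Proof.
move=> y; apply: (@continuous_comp _ _ _ (fun y : R => - (e * `|y|)) expR).
  apply: continuousN; apply: continuousM; first exact: cvg_cst.
  exact: norm_continuous.
exact: continuous_expR.
Qed.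

Lemma measurable_abel_weight : measurable_fun setT (abel_weight e).
Proof. by apply: continuous_measurable_fun; exact: continuous_abel_weight. Qed.

(** The summand 1 makes the integrand nonnegative, as the fundamental theorem on a half-line and the
    reduction to y >= 0 are used in their nonnegative form. The case h = 0 gives the weight alone,
    which is subtracted afterwards. *)
Lemma integral_abel_cos (h : R) :
  (\int[leb]_y (abel_weight e y * (1 + cos (y * h)))%:E)%E =
  (2 * (e^-1 + e / (e ^+ 2 + h ^+ 2)))%:E.
Proof.
have dn := poisson_den_gt0 h.
have cosB (y : R) : 0 <= 1 + cos (y * h) by have := cos_geN1 (y * h); lra.
have dC (y : R) : is_derive y 1 (fun y => cos (y * h)) (- sin (y * h) * h).
  exact: is_derive1_comp_lin (is_derive_cos (y * h)).
have dS (y : R) : is_derive y 1 (fun y => sin (y * h)) (cos (y * h) * h).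
  exact: is_derive1_comp_lin (is_derive_sin (y * h)).
rewrite ge0_symfun_integralT; last 3 first.
- by move=> y; rewrite mulr_ge0 ?abel_weight_ge0.
- move=> y; apply: continuousM; first exact: continuous_abel_weight.
  apply: continuousD; first exact: cvg_cst.
  exact: is_derive_continuous (dC y).
- by move=> y; rewrite /= /abel_weight normrN mulNr cosN.
rewrite -(set_itvcy 0).
pose f (y : R) := expR (- (e * y)) * (1 + cos (y * h)).
(* An antiderivative of e^(- e y) cos (h y) is e^(- e y) (h sin (h y) - e cos (h y)) / (e^2 +
   h^2). *)
pose F (y : R) := expR (- (e * y)) *
  (- e^-1 + (e ^+ 2 + h ^+ 2)^-1 * (h * sin (y * h) + (- e) * cos (y * h))).
have dF (y : R) : is_derive y 1 F (f y).
  have := is_derive1M (is_derive1_expRN e y) (is_derive1D (is_derive_cst (- e^-1) y 1)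
    (is_derive1Z ((e ^+ 2 + h ^+ 2)^-1)
      (is_derive1D (is_derive1Z h (dS y)) (is_derive1Z (- e) (dC y))))).
  move/is_derive_eq; apply; rewrite /f /cst.
  by field; rewrite !gt_eqF.
have -> : (\int[leb]_(y in `[0%R, +oo[) (abel_weight e y * (1 + cos (y * h)))%:E =
    \int[leb]_(y in `[0%R, +oo[) (f y)%:E)%E.
  apply: eq_integral => y; rewrite inE/= in_itv/= andbT => y0.
  by rewrite /abel_weight ger0_norm.
rewrite (@ge0_continuous_FTC2y _ f F 0 0).
- rewrite -EFinB -EFinM; congr _%:E; rewrite /F mulr0 oppr0 expR0 mul0r sin0 cos0.
  by field; rewrite !gt_eqF.
- by move=> y _; rewrite mulr_ge0 ?expR_ge0.
- have cf (y : R) : {for y, continuous f}.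
    apply: continuousM; first exact: continuous_expRN_at.
    apply: continuousD; first exact: cvg_cst.
    exact: is_derive_continuous (dC y).
  by apply: continuous_subspaceT => y; exact: cf.
- pose C : R := e^-1 + (e ^+ 2 + h ^+ 2)^-1 * (`|h| + e).
  have cE : C * expR (- (e * y)) @[y --> +oo] --> 0.
    rewrite -[X in _ --> X](mulr0 C); apply: cvgM; first exact: cvg_cst.
    apply: (@cvg_comp _ _ _ (fun y : R => e * y) (fun y => expR (- y)) _ _ _ _ (@cvgr_expR R)).
    apply/cvgryPge => A.
    have : \forall y \near +oo, e^-1 * A <= y by apply: nbhs_pinfty_ge; exact: num_real.
    by apply: filterS => y; rewrite ler_pdivrMl.
  have FC (y : R) : `|F y| <= C * expR (- (e * y)).
    rewrite /F normrM (ger0_norm (expR_ge0 _)) mulrC ler_wpM2r ?expR_ge0//.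
    rewrite (le_trans (ler_normD _ _))// /C normrN ger0_norm ?invr_ge0 ?(ltW e0)// lerD2l.
    rewrite normrM ger0_norm ?invr_ge0 ?(ltW dn)// ler_wpM2l ?invr_ge0 ?(ltW dn)//.
    rewrite (le_trans (ler_normD _ _))// !normrM normrN (ger0_norm (ltW e0)).
    rewrite lerD// ler_piMr ?normr_ge0 ?(ltW e0)//.
    + by rewrite ler_norml sin_geN1 sin_le1.
    + by rewrite ler_norml cos_geN1 cos_le1.
  have cE' : - (C * expR (- (e * y))) @[y --> +oo] --> 0.
    by rewrite -[X in _ --> X]oppr0; exact: cvgN.
  by apply: squeeze_cvgr cE' cE; near=> y; rewrite -ler_norml.
- by move=> y _; case: (dF y).
- by apply: cvg_at_right_filter; exact: is_derive_continuous (dF 0).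
- by move=> y _; rewrite derive1E; case: (dF y).
Unshelve. all: by end_near. Qed.

Lemma integrable_abel_cos (h : R) :
  leb.-integrable setT (fun y => (abel_weight e y * (1 + cos (y * h)))%:E).
Proof.
have cosB (y : R) : 0 <= 1 + cos (y * h) by have := cos_geN1 (y * h); lra.
apply/integrableP; split.
  apply/measurable_EFinP; apply: measurable_funM; first exact: measurable_abel_weight.
  apply: measurable_funD; first exact: measurable_cst.
  apply: continuous_measurable_fun => y.
  exact: is_derive_continuous (is_derive1_comp_lin (is_derive_cos (y * h))).
have -> : (\int[leb]_y `|(abel_weight e y * (1 + cos (y * h)))%:E| =
    \int[leb]_y (abel_weight e y * (1 + cos (y * h)))%:E)%E.
  by apply: eq_integral => y _; rewrite /= ger0_norm// mulr_ge0 ?abel_weight_ge0.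
by rewrite integral_abel_cos ltry.
Qed.

Lemma integrable_abel_weight : leb.-integrable setT (fun y => (abel_weight e y)%:E).
Proof.
apply: le_integrable (integrable_abel_cos 0) => //.
  by apply/measurable_EFinP; exact: measurable_abel_weight.
move=> y _ /=; rewrite lee_fin mulr0 cos0 !ger0_norm ?mulr_ge0 ?abel_weight_ge0//.
by rewrite ler_peMr ?abel_weight_ge0//; lra.
Qed.

Lemma Rintegral_abel_weight : \int[leb]_y abel_weight e y = 2 / e.
Proof.
have := integral_abel_cos 0.
have -> : (\int[leb]_y (abel_weight e y * (1 + cos (y * 0)))%:E =
   \int[leb]_y (2%:E * (abel_weight e y)%:E))%E.
  by apply: eq_integral => y _; rewrite mulr0 cos0 -EFinM mulrC; congr (_ * _)%:E; lra.
rewrite integralZl//; last exact: integrable_abel_weight.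
rewrite /Rintegral; have := integrable_fin_num measurableT integrable_abel_weight.
case: (\int[leb]_y _)%E => // r _ [] /= h.
apply: (@mulfI _ (2 : R)) => //; rewrite h expr0n addr0; field; rewrite gt_eqF//.
Qed.

Lemma fourier_abel_weight (h : R) :
  cintegral leb (fun y => cexp ('i%C * (y * h)%:C) * (abel_weight e y)%:C) =
  (poisson_kernel e h)%:C.
Proof.
have mcos : measurable_fun setT (fun y : R => cos (y * h)).
  apply: continuous_measurable_fun => y.
  exact: is_derive_continuous (is_derive1_comp_lin (is_derive_cos (y * h))).
have msin : measurable_fun setT (fun y : R => sin (y * h)).
  apply: continuous_measurable_fun => y.
  exact: is_derive_continuous (is_derive1_comp_lin (is_derive_sin (y * h))).
transitivity (cintegral leb (fun y =>
    (abel_weight e y * cos (y * h)) +i* (abel_weight e y * sin (y * h)))).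
  by apply: eq_cintegral => y; rewrite iM_real mulrC real_mulE /cexp/= expR0 !mul1r.
apply: ReIm_eq => /=.
- have -> : \int[leb]_y (abel_weight e y * cos (y * h)) =
      \int[leb]_y (abel_weight e y * (1 + cos (y * h)) - abel_weight e y).
    by apply: eq_Rintegral => y _; ring.
  rewrite RintegralB//; [|exact: integrable_abel_cos|exact: integrable_abel_weight].
  rewrite Rintegral_abel_weight /Rintegral integral_abel_cos /= /poisson_kernel.
  by field; rewrite !gt_eqF// poisson_den_gt0.
(* The imaginary part is the integral of an odd function, so it equals its own opposite. *)
- have mi : measurable_fun setT (fun y => abel_weight e y * sin (y * h)).
    by apply: measurable_funM => //; exact: measurable_abel_weight.
  have ii : leb.-integrable setT (fun y => (abel_weight e y * sin (y * h))%:E).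
    apply: le_integrable integrable_abel_weight => //; first exact/measurable_EFinP.
    move=> y _ /=; rewrite lee_fin normrM ler_piMr//.
    by rewrite ler_norml sin_geN1 sin_le1.
  have := Rintegral_oppr mi.
  have -> : \int[leb]_y (abel_weight e (- y) * sin (- y * h)) =
      \int[leb]_y (-1 * (abel_weight e y * sin (y * h))).
    by apply: eq_Rintegral => y _; rewrite /abel_weight normrN (mulNr y) sinN; ring.
  by rewrite RintegralZl//; lra.
Qed.

End poisson_kernel.

Section fourier_L1.
Variable R : realType.
Implicit Types (f g F G : R -> R[i]) (e r : R).
Local Notation leb := (@lebesgue_measure R).

Lemma measurable_swapM : measurable_fun setT (fun z : R * R => z.2 * z.1).
Proof. by apply: measurable_funM; [exact: measurable_snd|exact: measurable_fst]. Qed.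

Lemma cmeas_fourier_kernel F : cmeas F ->
  cmeas (fun z : R * R => cexp ('i%C * (z.2 * z.1)%:C) * F z.2).
Proof.
move=> mF; apply: cmeasM; last exact: (measurableT_comp mF (@measurable_snd _ _ R R)).
apply: cmeas_cexp; apply: cmeasM; first exact: cmeas_cst.
by apply: cmeas_real; exact: measurable_swapM.
Qed.

Lemma cmeas_fourier F : cmeas F -> cmeas (fourier F).
Proof.
move=> mF; have := @cmeas_cintegral_snd _ _ (measurableTypeR R) (measurableTypeR R) R leb
  (fun z : R * R => cexp ('i%C * (z.2 * z.1)%:C) * F z.2).
by apply; exact: cmeas_fourier_kernel.
Qed.

Lemma normc_fourier_kernel F x y : nc (cexp ('i%C * (x * y)%:C) * F x) = nc (F x).
Proof. by rewrite Normc.normcM normc_cexp iM_real expR0 mul1r. Qed.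

Lemma cintegrable_fourier_kernel F y : cintegrable leb F ->
  cintegrable leb (fun x => cexp ('i%C * (x * y)%:C) * F x).
Proof.
move=> iF; apply: (le_cintegrable _ (cintegrable_normc iF)).
  have := cintegrable_meas iF => mF; apply: cmeasM => //.
  apply: cmeas_cexp; apply: cmeasM; first exact: cmeas_cst.
  by apply: cmeas_real; apply: measurable_funM; [exact: measurable_id|exact: measurable_cst].
by move=> x; rewrite normc_fourier_kernel.
Qed.

Lemma normc_fourier_le F y : cintegrable leb F -> nc (fourier F y) <= \int[leb]_x nc (F x).
Proof.
move=> iF; apply: normc_cintegral_le; first exact: cintegrable_fourier_kernel.
  exact: cintegrable_normc.
by move=> x; rewrite normc_fourier_kernel.
Qed.

Lemma fourierB F G y : cintegrable leb F -> cintegrable leb G ->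
  fourier (fun x => F x - G x) y = fourier F y - fourier G y.
Proof.
move=> iF iG; rewrite /fourier -cintegralB; try exact: cintegrable_fourier_kernel.
by apply: eq_cintegral => x; rewrite mulrBr.
Qed.

Lemma fourierZ a F y : cintegrable leb F -> fourier (fun x => a * F x) y = a * fourier F y.
Proof.
move=> iF; rewrite /fourier -cintegralZ; last exact: cintegrable_fourier_kernel.
by apply: eq_cintegral => x; rewrite mulrCA.
Qed.

Lemma cintegrable_conj F : cintegrable leb F -> cintegrable leb (fun x => (F x)^*%C).
Proof.
move=> iF; have mF : cmeas F := cintegrable_meas iF.
apply: (le_cintegrable _ (cintegrable_normc iF)); first exact: (cmeas_conj mF).
by move=> x; rewrite normcJ_eq.
Qed.

Lemma cintegral_conj F : cintegrable leb F ->
  cintegral leb (fun x => (F x)^*%C) = (cintegral leb F)^*%C.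
Proof.
move=> [_ Fi]; apply: ReIm_eq => /=.
- by apply: eq_Rintegral => x _; case: (F x).
- rewrite -mulN1r -RintegralZl//.
  by apply: eq_Rintegral => x _; rewrite mulN1r; case: (F x).
Qed.

Lemma conj_cexp_i (x : R) : (cexp ('i%C * x%:C))^*%C = cexp ('i%C * (- x)%:C).
Proof. by rewrite !iM_real /cexp /= cosN sinN mulrN. Qed.

Lemma conjcM (z w : R[i]) : (z * w)^*%C = z^*%C * w^*%C.
Proof. exact: rmorphM. Qed.

Lemma conj_fourier F y : cintegrable leb F ->
  (fourier F y)^*%C = fourier (fun x => (F x)^*%C) (- y).
Proof.
move=> iF; rewrite /fourier -cintegral_conj; last exact: cintegrable_fourier_kernel.
by apply: eq_cintegral => x; rewrite conjcM conj_cexp_i mulrN.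
Qed.

(** Fubini moves the transform from one factor to the other. This multiplication formula serves
    twice: for the Abel means, and for the inner product of a truncated inversion with its
    target. *)
Lemma fourier_exchange F G : cintegrable leb F -> cintegrable leb G ->
  cintegral leb (fun y => fourier F y * G y) = cintegral leb (fun x => F x * fourier G x).
Proof.
move=> iF iG.
have mF := cintegrable_meas iF; have mG := cintegrable_meas iG.
have mK : cmeas (fun z : R * R =>
    cexp ('i%C * (z.2 * z.1)%:C) * F z.2 * G z.1).
  apply: cmeasM; first exact: cmeas_fourier_kernel.
  exact: (measurableT_comp mG (@measurable_fst _ _ R R)).
have := @cfubini _ _ (measurableTypeR R) (measurableTypeR R) R leb leb
  (fun z : R * R => cexp ('i%C * (z.2 * z.1)%:C) * F z.2 * G z.1)
  (fun y => nc (G y)) (fun x => nc (F x)) mK (cintegrable_normc iG) (cintegrable_normc iF).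
move=> /(_ _) /= H; transitivity (cintegral leb (fun y => cintegral leb (fun x =>
    cexp ('i%C * (x * y)%:C) * F x * G y))).
  apply: eq_cintegral => y; rewrite mulrC /fourier -cintegralZ; last exact: cintegrable_fourier_kernel.
  by apply: eq_cintegral => x; rewrite mulrC.
rewrite H; last by move=> y x; rewrite Normc.normcM normc_fourier_kernel mulrC.
apply: eq_cintegral => x; rewrite /fourier -cintegralZ; last exact: cintegrable_fourier_kernel.
by apply: eq_cintegral => y; rewrite [y * x]mulrC; ring.
Qed.

Definition poisson_smoothing e F (x : R) : R[i] :=
  cintegral leb (fun x' => (poisson_kernel e (x - x'))%:C * (F x')).

Lemma cintegrable_poisson_smoothing e F x : 0 < e -> cintegrable leb F ->
  cintegrable leb (fun x' => (poisson_kernel e (x - x'))%:C * F x').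
Proof.
move=> e0 iF; have mF := cintegrable_meas iF.
have i2 : leb.-integrable setT (EFin \o (fun x' => 2 / e * nc (F x'))).
  by have := integrableZl measurableT (2 / e) (cintegrable_normc iF); apply: eq_integrable.
apply: (le_cintegrable _ i2).
- apply: cmeasM => //; apply: cmeas_real; apply: measurableT_comp.
    exact: measurable_poisson_kernel.
  by apply: measurable_funB; [exact: measurable_cst|exact: measurable_id].
- move=> x'; rewrite normc_real_mul ger0_norm ?poisson_kernel_ge0// ler_wpM2r ?normc_ge0//.
  exact: poisson_kernel_le.
Qed.

Lemma measurable_poisson_kernelB e : 0 < e ->
  measurable_fun setT (fun z : R * R => poisson_kernel e (z.1 - z.2)).
Proof.
move=> e0; apply: measurableT_comp; first exact: measurable_poisson_kernel.
by apply: measurable_funB; [exact: measurable_fst|exact: measurable_snd].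
Qed.

Lemma cmeas_poisson_smoothing e F : 0 < e -> cmeas F -> cmeas (poisson_smoothing e F).
Proof.
move=> e0 mF; have := @cmeas_cintegral_snd _ _ (measurableTypeR R) (measurableTypeR R) R leb
  (fun z : R * R => (poisson_kernel e (z.1 - z.2))%:C * F z.2).
apply; apply: cmeasM; first by apply: cmeas_real; exact: measurable_poisson_kernelB.
exact: (measurableT_comp mF (@measurable_snd _ _ R R)).
Qed.

Lemma cintegrable_abel_fourier e F : 0 < e -> cintegrable leb F ->
  cintegrable leb (fun y => (abel_weight e y)%:C * fourier F y).
Proof.
move=> e0 iF.
have i2 : leb.-integrable setT (EFin \o (fun y => \int[leb]_x nc (F x) * abel_weight e y)).
  have := integrableZl measurableT (\int[leb]_x nc (F x)) (integrable_abel_weight e0).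
  exact: eq_integrable.
apply: (le_cintegrable _ i2).
- apply: cmeasM; first by apply: cmeas_real; exact: measurable_abel_weight.
  by have mF : cmeas F := cintegrable_meas iF; exact: cmeas_fourier mF.
- move=> y; rewrite normc_real_mul ger0_norm ?abel_weight_ge0// mulrC.
  by rewrite ler_wpM2r ?abel_weight_ge0// normc_fourier_le.
Qed.

(** The inserted weight makes the double integral absolutely convergent; in the other order the
    integral over frequencies is the transform of the weight at x - x', that is, the Poisson
    kernel. *)
Lemma fourier_abel_fourier e F x : 0 < e -> cintegrable leb F ->
  fourier (fun y => (abel_weight e y)%:C * fourier F (- y)) x = poisson_smoothing e F x.
Proof.
move=> e0 iF; have mF := cintegrable_meas iF.
pose k (z : R * R) : R[i] := cexp ('i%C * (z.1 * x)%:C) * ((abel_weight e z.1)%:C *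
  (cexp ('i%C * (z.2 * - z.1)%:C) * F z.2)).
have mk : cmeas k.
  apply: cmeasM.
    apply: cmeas_cexp; apply: cmeasM; first exact: cmeas_cst.
    apply: cmeas_real; apply: measurable_funM; last exact: measurable_cst.
    exact: measurable_fst.
  apply: cmeasM.
    apply: cmeas_real; apply: (measurableT_comp (measurable_abel_weight e)).
    exact: measurable_fst.
  apply: cmeasM; last exact: (measurableT_comp mF (@measurable_snd _ _ R R)).
  apply: cmeas_cexp; apply: cmeasM; first exact: cmeas_cst.
  apply: cmeas_real; apply: measurable_funM; first exact: measurable_snd.
  by apply: measurableT_comp; [exact: oppr_measurable|exact: measurable_fst].
have := @cfubini _ _ (measurableTypeR R) (measurableTypeR R) R leb leb k
  (abel_weight e) (fun x => nc (F x)) mk (integrable_abel_weight e0) (cintegrable_normc iF).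
move=> /(_ _) H; transitivity (cintegral leb (fun y => cintegral leb (fun x' => k (y, x')))).
  apply: eq_cintegral => y; have ik := cintegrable_fourier_kernel (- y) iF.
  by rewrite /fourier -(cintegralZ _ ik) -(cintegralZ _ (cintegrableZ _ ik)).
rewrite H; last first.
  move=> y x'; rewrite /k/= Normc.normcM normc_cexp iM_real expR0 mul1r normc_real_mul.
  by rewrite (ger0_norm (expR_ge0 _)) normc_fourier_kernel.
apply: eq_cintegral => x'; rewrite -(fourier_abel_weight e0 (x - x')).
rewrite [RHS]mulrC -cintegralZ; last first.
  apply: (le_cintegrable _ (integrable_abel_weight e0)).
    apply: cmeasM; last by apply: cmeas_real; exact: measurable_abel_weight.
    apply: cmeas_cexp; apply: cmeasM; first exact: cmeas_cst.
    by apply: cmeas_real; apply: measurable_funM; [exact: measurable_id|exact: measurable_cst].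
  move=> y; rewrite Normc.normcM normc_cexp iM_real expR0 mul1r normc_real.
  by rewrite (ger0_norm (expR_ge0 _)).
apply: eq_cintegral => y; rewrite /k /=.
have -> : (y * (x - x'))%:C = (y * x)%:C + (x' * - y)%:C.
  by rewrite -[RHS]rmorphD/=; congr _%:C; ring.
rewrite mulrDr cexpD; ring.
Qed.

Lemma Re_cintegral F : Re (cintegral leb F) = \int[leb]_x Re (F x).
Proof. by []. Qed.

(** The conjugate of [fourier F y] is the transform of the conjugate of F at - y. Moving the other
    transform by [fourier_exchange] leaves two successive transforms with the weight between them, a
    Poisson smoothing. *)
Lemma abel_sq_fourier e F : 0 < e -> cintegrable leb F ->
  \int[leb]_y (abel_weight e y * nc (fourier F y) ^+ 2) =
  Re (cintegral leb (fun x => F x * poisson_smoothing e (fun x => (F x)^*%C) x)).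
Proof.
move=> e0 iF; have icF := cintegrable_conj iF.
pose G y := (abel_weight e y)%:C * fourier (fun x => (F x)^*%C) (- y).
have iG : cintegrable leb G.
  have mcF : cmeas (fun x => (F x)^*%C) := cintegrable_meas icF.
  apply: (le_cintegrable _ (cintegrable_normc (cintegrable_abel_fourier e0 iF))).
    apply: cmeasM; first by apply: cmeas_real; exact: measurable_abel_weight.
    by apply: (@cmeas_oppr _ (fourier _)); exact: cmeas_fourier.
  by move=> y; rewrite /G -conj_fourier// !normc_real_mul normcJ_eq.
rewrite (_ : cintegral leb _ = cintegral leb (fun x => F x * fourier G x)); last first.
  by apply: eq_cintegral => x; rewrite /G fourier_abel_fourier.
rewrite -fourier_exchange// Re_cintegral; apply: eq_Rintegral => y _.
by rewrite /G -conj_fourier// [in RHS]mulrCA mul_conjc real_mulE.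
Qed.

(** Schur's test: 2 |F x| |F x'| <= |F x|^2 + |F x'|^2, and integrating the symmetric kernel over
    the variable absent from a square gives 2 pi each time. The right side may be infinite. *)
Lemma poisson_form_le e F : 0 < e -> cintegrable leb F ->
  ((Re (cintegral leb (fun x => F x * poisson_smoothing e (fun x => (F x)^*%C) x)))%:E
    <= (2 * pi)%:E * sqL2 F)%E.
Proof.
move=> e0 iF; have icF := cintegrable_conj iF.
have mF := cintegrable_meas iF; have mn := cmeas_normc mF.
pose H x := \int[leb]_x' (poisson_kernel e (x - x') * nc (F x')).
have ik x : leb.-integrable setT (fun x' => (poisson_kernel e (x - x') * nc (F x'))%:E).
  have := cintegrable_normc (cintegrable_poisson_smoothing x e0 iF).
  apply: eq_integrable => // x' _; rewrite normc_real_mul ger0_norm//.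
  exact: poisson_kernel_ge0.
have H0 x : 0 <= H x.
  by apply: Rintegral_ge0 => x' _; rewrite mulr_ge0 ?normc_ge0 ?poisson_kernel_ge0.
have smH x : nc (poisson_smoothing e (fun x => (F x)^*%C) x) <= H x.
  apply: normc_cintegral_le; [exact: cintegrable_poisson_smoothing|exact: ik|].
  by move=> x'; rewrite normc_real_mul normcJ_eq ger0_norm ?poisson_kernel_ge0.
pose L := \int[leb]_x nc (F x).
have HL x : H x <= 2 / e * L.
  rewrite /H /L -RintegralZl//; last exact: cintegrable_normc.
  apply: le_Rintegral => //; [exact: ik| |].
    exact: (integrableZl measurableT (2 / e) (cintegrable_normc iF)).
  by move=> x' _; rewrite ler_wpM2r ?normc_ge0// poisson_kernel_le.
have mH : measurable_fun setT H.
  have := @measurable_Rintegral_snd _ _ (measurableTypeR R) (measurableTypeR R) R leb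
    (fun z : R * R => poisson_kernel e (z.1 - z.2) * nc (F z.2)).
  apply; apply: measurable_funM; first exact: measurable_poisson_kernelB.
  exact: (measurableT_comp mn (@measurable_snd _ _ R R)).
have iFH : leb.-integrable setT (fun x => (nc (F x) * H x)%:E).
  have := integrableZl measurableT (2 / e * L) (cintegrable_normc iF).
  apply: le_integrable => //.
    by apply/measurable_EFinP; exact: measurable_funM.
  have L0 : 0 <= L by apply: Rintegral_ge0 => x' _; exact: normc_ge0.
  move=> x _ /=; rewrite lee_fin ger0_norm; last by rewrite mulr_ge0 ?normc_ge0.
  rewrite ger0_norm; first by rewrite mulrC ler_wpM2r ?normc_ge0.
  apply: mulr_ge0; last exact: normc_ge0.
  by apply: mulr_ge0 => //; apply: divr_ge0 => //; exact: ltW.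
have iFS : cintegrable leb (fun x => F x * poisson_smoothing e (fun x => (F x)^*%C) x).
  apply: (le_cintegrable _ iFH).
    by apply: cmeasM => //; apply: cmeas_poisson_smoothing => //; exact: cmeas_conj.
  by move=> x; rewrite Normc.normcM ler_wpM2l ?normc_ge0.
apply: (@le_trans _ _ (\int[leb]_x (nc (F x) * H x)%:E)%E).
  have := integrable_fin_num measurableT iFH => /fineK <-; rewrite lee_fin.
  rewrite (le_trans (ler_norm _))// (le_trans (Re_le_normc _))//.
  apply: normc_cintegral_le => //.
  by move=> x; rewrite Normc.normcM ler_wpM2l ?normc_ge0.
pose k (z : R * R) : R := nc (F z.1) ^+ 2 * poisson_kernel e (z.1 - z.2).
have k0 z : 0 <= k z by rewrite mulr_ge0 ?sqr_ge0 ?poisson_kernel_ge0.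
have mk : measurable_fun setT k.
  apply: measurable_funM; last exact: measurable_poisson_kernelB.
  by apply: measurable_funX; exact: (measurableT_comp mn (@measurable_fst _ _ R R)).
have K1 x : (\int[leb]_x' (k (x, x'))%:E = (nc (F x) ^+ 2)%:E * (2 * pi)%:E)%E.
  rewrite -(integral_poisson_kernel e0 x) -ge0_integralZl//.
  - apply/measurable_EFinP; apply: measurableT_comp; first exact: measurable_poisson_kernel.
    by apply: measurable_funB; [exact: measurable_cst|exact: measurable_id].
  - by move=> y _; rewrite lee_fin poisson_kernel_ge0.
  - by rewrite lee_fin sqr_ge0.
have S1 : (\int[leb]_x \int[leb]_x' (k (x, x'))%:E = (2 * pi)%:E * sqL2 F)%E.
  have -> : (\int[leb]_x \int[leb]_x' (k (x, x'))%:E =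
      \int[leb]_x ((nc (F x) ^+ 2)%:E * (2 * pi)%:E))%E.
    by apply: eq_integral => x _; exact: K1.
  rewrite ge0_integralZr//.
  - by rewrite muleC.
  - exact: measurable_sq_normc.
  - by move=> x _; rewrite lee_fin sqr_ge0.
  - by rewrite lee_fin mulr_ge0// pi_ge0.
have S2 : (\int[leb]_x \int[leb]_x' (k (x', x))%:E = (2 * pi)%:E * sqL2 F)%E.
  rewrite -S1; have := @fubini_tonelli _ _ (measurableTypeR R) (measurableTypeR R) R leb leb
    (EFin \o k); move=> -> //; exact/measurable_EFinP.
have mk1 x : measurable_fun setT (fun x' => (k (x, x'))%:E).
  by apply/measurable_EFinP; exact: (measurableT_comp mk (pair1_measurable x)).
have mk2 x : measurable_fun setT (fun x' => (k (x', x))%:E).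
  by apply/measurable_EFinP; exact: (measurableT_comp mk (pair2_measurable x)).
have mk12 x : measurable_fun setT (fun x' => (k (x, x'))%:E + (k (x', x))%:E)%E :=
  emeasurable_funD (mk1 x) (mk2 x).
have kk0 x x' : (0 <= (k (x, x'))%:E + (k (x', x))%:E)%E by rewrite adde_ge0 ?lee_fin.
have DE x : (\int[leb]_x' (k (x, x'))%:E + \int[leb]_x' (k (x', x))%:E =
    \int[leb]_x' ((k (x, x'))%:E + (k (x', x))%:E))%E.
  by rewrite ge0_integralD//; first [exact: mk1|exact: mk2|move=> x' _; rewrite lee_fin].
have mI1 : measurable_fun setT (fun x => \int[leb]_x' (k (x, x'))%:E)%E.
  have := @measurable_fun_fubini_tonelli_F _ _ (measurableTypeR R) (measurableTypeR R) R leb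
    (EFin \o k); apply; first exact/measurable_EFinP.
  by move=> z; rewrite lee_fin.
have mI2 : measurable_fun setT (fun x => \int[leb]_x' (k (x', x))%:E)%E.
  have := @measurable_fun_fubini_tonelli_G _ _ (measurableTypeR R) (measurableTypeR R) R leb
    (EFin \o k); apply; first exact/measurable_EFinP.
  by move=> z; rewrite lee_fin.
have I10 x : (0 <= \int[leb]_x' (k (x, x'))%:E)%E by apply: integral_ge0 => x' _; rewrite lee_fin.
have I20 x : (0 <= \int[leb]_x' (k (x', x))%:E)%E by apply: integral_ge0 => x' _; rewrite lee_fin.
have -> : ((2 * pi)%:E * sqL2 F = \int[leb]_x ((2^-1)%:E *
    (\int[leb]_x' (k (x, x'))%:E + \int[leb]_x' (k (x', x))%:E)))%E.
  rewrite ge0_integralZl//; last 2 first.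
  - exact: emeasurable_funD.
  - by move=> x _; rewrite adde_ge0.
  rewrite ge0_integralD// S1 S2.
  have : (0 <= (2 * pi)%:E * sqL2 F)%E.
    by rewrite mule_ge0 ?sqL2_ge0// lee_fin mulr_ge0// pi_ge0.
  case: ((2 * pi)%:E * sqL2 F)%E => [r| |]// _.
    by rewrite -EFinD -EFinM; congr EFin; field.
  by rewrite addye// gt0_muley// lte_fin invr_gt0.
apply: ge0_le_integral => //.
- by move=> x _; rewrite lee_fin mulr_ge0 ?normc_ge0.
- by apply/measurable_EFinP; exact: measurable_funM.
- by apply: measurable_funeM; exact: emeasurable_funD.
- move=> x _; rewrite DE -ge0_integralZl//; last exact: mk12.
  rewrite EFinM /H /Rintegral fineK; last exact: (integrable_fin_num measurableT (ik x)).
  rewrite -ge0_integralZl//; last 3 first.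
  - by case/integrableP: (ik x).
  - by move=> x' _; rewrite lee_fin mulr_ge0 ?poisson_kernel_ge0 ?normc_ge0.
  - by rewrite lee_fin normc_ge0.
  apply: ge0_le_integral => //.
  - by move=> x' _; rewrite mule_ge0 ?lee_fin ?normc_ge0// mulr_ge0 ?poisson_kernel_ge0 ?normc_ge0.
  - by apply: measurable_funeM; case/integrableP: (ik x).
  - by apply: measurable_funeM; exact: mk12.
  - move=> x' _; rewrite -EFinD -!EFinM lee_fin /k/=.
    rewrite -(poisson_kernelN e (x' - x)) opprB.
    have := poisson_kernel_ge0 e0 (x - x'); set p := poisson_kernel _ _ => p0.
    rewrite -subr_ge0 (_ : _ - _ = 2^-1 * p * (nc (F x) - nc (F x')) ^+ 2); last by field.
    by apply: mulr_ge0; [rewrite mulr_ge0// invr_ge0|exact: sqr_ge0].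
Qed.

End fourier_L1.

Section plancherel.
Variable R : realType.
Implicit Types (F G : R -> R[i]) (e r : R).
Local Notation leb := (@lebesgue_measure R).

Lemma le_cintegrable_lebesgue F (h : R -> R) : cmeas F ->
  leb.-integrable setT (EFin \o h) -> (forall x, nc (F x) <= h x) -> cintegrable leb F.
Proof. exact: (@le_cintegrable _ (measurableTypeR R) R leb). Qed.

Lemma Rintegral_poisson_kernelZ (e k x : R) : 0 < e ->
  \int[leb]_y (k * poisson_kernel e (x - y)) = k * (2 * pi).
Proof.
move=> e0; have ip := integrable_poisson_kernel e0 x.
by rewrite RintegralZl// /Rintegral integral_poisson_kernel.
Qed.

Lemma abel_weight_le1 e y : 0 <= e -> abel_weight e y <= 1.
Proof. by move=> e0; rewrite /abel_weight expR_le1 oppr_le0 mulr_ge0. Qed.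

Lemma cvg_abel_weight y : abel_weight (n.+1%:R^-1) y @[n --> \oo] --> (1 : R).
Proof.
rewrite [X in _ --> X](_ : 1 = expR (- (0 * `|y|))); last by rewrite mul0r oppr0 expR0.
apply: (@cvg_comp _ _ _ (fun n => - (n.+1%:R^-1 * `|y|)) expR); last exact: continuous_expR.
by apply: cvgN; apply: cvgM; [exact: cvg_harmonic|exact: cvg_cst].
Qed.

Lemma integrable_abel_sq_fourier e F : 0 < e -> cintegrable leb F ->
  leb.-integrable setT (fun y => (abel_weight e y * nc (fourier F y) ^+ 2)%:E).
Proof.
move=> e0 iF; have mF : cmeas F := cintegrable_meas iF.
have := integrableZl measurableT ((\int[leb]_x nc (F x)) ^+ 2) (integrable_abel_weight e0).
apply: le_integrable => //.
  apply/measurable_EFinP; apply: measurable_funM; first exact: measurable_abel_weight.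
  by apply: measurable_funX; apply: cmeas_normc; exact: cmeas_fourier.
move=> y _ /=; rewrite lee_fin ger0_norm; last first.
  by apply: mulr_ge0; [exact: expR_ge0|exact: sqr_ge0].
rewrite ger0_norm; last by apply: mulr_ge0; [exact: sqr_ge0|exact: expR_ge0].
rewrite mulrC ler_wpM2r ?expR_ge0//.
by rewrite lerXn2r ?nnegrE ?normc_ge0 ?normc_fourier_le// Rintegral_ge0// => x _; exact: normc_ge0.
Qed.

(** The bound on the Abel means does not depend on e, and the weights increase to 1 as e decreases
    to 0, so monotone convergence applies. F need not be square integrable. *)
Theorem sqL2_fourier_le F : cintegrable leb F ->
  (sqL2 (fourier F) <= (2 * pi)%:E * sqL2 F)%E.
Proof.
move=> iF; have mF : cmeas F := cintegrable_meas iF.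
have mfF := cmeas_fourier mF.
pose g n y := (abel_weight (n.+1%:R^-1) y * nc (fourier F y) ^+ 2)%:E.
have e0 n : (0 : R) < n.+1%:R^-1 by rewrite invr_gt0.
have gn n : (\int[leb]_y g n y <= (2 * pi)%:E * sqL2 F)%E.
  have ig := integrable_abel_sq_fourier (e0 n) iF.
  rewrite /g -(fineK (integrable_fin_num measurableT ig)).
  have := poisson_form_le (e0 n) iF; rewrite -(abel_sq_fourier (e0 n) iF).
  by [].
have mg n : measurable_fun setT (g n).
  by case/integrableP: (integrable_abel_sq_fourier (e0 n) iF).
have g0 n y : (0 <= g n y)%E by rewrite lee_fin mulr_ge0 ?expR_ge0 ?sqr_ge0.
have ndg y : {homo g^~ y : n m / (n <= m)%N >-> (n <= m)%E}.
  move=> n m nm; rewrite lee_fin ler_wpM2r ?sqr_ge0// ler_expR lerN2 ler_wpM2r//.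
  by rewrite lef_pV2 ?posrE// ler_nat.
have lg y : limn (g^~ y) = (nc (fourier F y) ^+ 2)%:E.
  apply/cvg_lim => //; apply: cvg_EFin; first exact: nearW.
  rewrite -[X in _ --> X]mul1r; apply: cvgM; last exact: cvg_cst.
  exact: cvg_abel_weight.
have -> : sqL2 (fourier F) = (\int[leb]_y limn (g^~ y))%E.
  by apply: eq_integral => y _; rewrite lg.
rewrite (@monotone_convergence _ _ _ leb _ measurableT g) //.
apply: lime_le; last by apply: nearW => n; exact: gn.
apply: ereal_nondecreasing_is_cvgn => n m nm.
by apply: ge0_le_integral => //; [exact: mg|exact: mg|move=> y _; exact: ndg].
Qed.

(* Jumps at the end points - A and A are allowed. *)
Definition nice (A C : R) G := [/\ cmeas G, forall x, nc (G x) <= C,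
  forall x, A <= `|x| -> G x = 0 &
  forall x, `|x| < A -> forall eta, 0 < eta ->
    exists2 delta, 0 < delta & forall x', `|x - x'| < delta -> nc (G x' - G x) <= eta].

Lemma integrable_indic_segment (A : R) :
  leb.-integrable setT (fun x => (\1_(`[(- A), A] : set R) x : R)%:E).
Proof. exact: (integrable_indic_itv (- A) A true false). Qed.

Lemma bounded_support_cintegrable (A C : R) G : cmeas G -> (forall x, nc (G x) <= C) ->
  (forall x, A < `|x| -> G x = 0) -> cintegrable leb G.
Proof.
move=> mG GC GA.
have i2 : leb.-integrable setT (EFin \o (fun x => C * \1_(`[(- A), A] : set R) x)).
  by have := integrableZl measurableT C (integrable_indic_segment A); apply: eq_integrable.
apply: (le_cintegrable_lebesgue mG i2) => x; rewrite indicE.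
case: (lerP `|x| A) => xA.
  by rewrite mem_set ?mulr1//= in_itv/= -ler_norml.
rewrite GA// Normc.normc0 mulr_ge0//.
by rewrite (le_trans (normc_ge0 (G x))).
Qed.

Lemma nice_cintegrable A C G : nice A C G -> cintegrable leb G.
Proof.
move=> [mG GC GA _]; apply: (bounded_support_cintegrable mG GC (A := A)).
by move=> x /ltW; exact: GA.
Qed.

Lemma nice_conj A C G : nice A C G -> nice A C (fun x => (G x)^*%C).
Proof.
move=> [mG GC GA Gc]; split.
- exact: cmeas_conj.
- by move=> x; rewrite normcJ_eq.
- by move=> x /GA ->; exact: conjc0.
- move=> x xA eta eta0; have [d d0 dP] := Gc x xA eta eta0.
  exists d => // x' /dP; rewrite -normcJ_eq.
  by rewrite (_ : (G x' - G x)^*%C = (G x')^*%C - (G x)^*%C)//; exact: rmorphB.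
Qed.

Lemma nice_smoothing_dist A C G x eta delta e : nice A C G -> 0 < eta -> 0 < delta -> 0 < e ->
  (forall x', `|x - x'| < delta -> nc (G x' - G x) <= eta) ->
  nc (poisson_smoothing e G x - (2 * pi)%:C * G x) <=
  2 * pi * (eta + 2 * C * e * (1 + delta ^- 2)).
Proof.
move=> nG eta0 d0 e0 H; have iG := nice_cintegrable nG; case: nG => mG GC GA Gc.
have C0 : 0 <= C by rewrite (le_trans (normc_ge0 (G x))).
(* At distance h >= delta the kernel of width e is at most e (1 + delta^(-2)) times the kernel of
   width 1, while |G x' - G x| <= 2 C. Dominating by the latter kernel keeps the bound integrable,
   with explicit integral 2 pi K. *)
pose K := 2 * C * e * (1 + delta ^- 2).
have K0 : 0 <= K.
  by rewrite !mulr_ge0 ?(ltW e0)// addr_ge0// invr_ge0 exprn_ge0 ?ltW.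
have ipx : cintegrable leb (fun x' => (poisson_kernel e (x - x'))%:C * G x).
  split.
  - have := integrableZr measurableT (Re (G x)) (integrable_poisson_kernel e0 x).
    by apply: eq_integrable => // x' _; rewrite real_mulE.
  - have := integrableZr measurableT (Im (G x)) (integrable_poisson_kernel e0 x).
    by apply: eq_integrable => // x' _; rewrite real_mulE.
have -> : (2 * pi)%:C * G x = cintegral leb (fun x' => (poisson_kernel e (x - x'))%:C * G x).
  have pE : \int[leb]_x' poisson_kernel e (x - x') = 2 * pi.
    by rewrite /Rintegral integral_poisson_kernel.
  have ip := integrable_poisson_kernel e0 x.
  rewrite /cintegral real_mulE -pE; congr (_ +i* _).
  - by rewrite -RintegralZr//; apply: eq_Rintegral => x' _; rewrite real_mulE.
  - by rewrite -RintegralZr//; apply: eq_Rintegral => x' _; rewrite real_mulE.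
have isx := cintegrable_poisson_smoothing x e0 iG.
rewrite -cintegralB//.
have ih : leb.-integrable setT (EFin \o (fun x' =>
    eta * poisson_kernel e (x - x') + K * poisson_kernel 1 (x - x'))).
  have h1 := integrableZl measurableT eta (integrable_poisson_kernel e0 x).
  have h2 := integrableZl measurableT K (integrable_poisson_kernel ltr01 x).
  by have := integrableD measurableT h1 h2; apply: eq_integrable.
have -> : 2 * pi * (eta + K) = \int[leb]_x'
    (eta * poisson_kernel e (x - x') + K * poisson_kernel 1 (x - x')).
  rewrite RintegralD//; last 2 first.
  - by have := integrableZl measurableT eta (integrable_poisson_kernel e0 x); apply: eq_integrable.
  - by have := integrableZl measurableT K (integrable_poisson_kernel ltr01 x); apply: eq_integrable.
  by rewrite !Rintegral_poisson_kernelZ//; ring.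
apply: normc_cintegral_le => //; first exact: cintegrableB.
move=> x'; rewrite -mulrBr normc_real_mul (ger0_norm (poisson_kernel_ge0 e0 _)).
have p1 := poisson_kernel_ge0 (@ltr01 R) (x - x').
have pe := poisson_kernel_ge0 e0 (x - x').
have [xd|xd] := ltP `|x - x'| delta.
  apply: (@le_trans _ _ (eta * poisson_kernel e (x - x'))); last by rewrite lerDl mulr_ge0.
  by rewrite mulrC ler_wpM2r// H.
apply: (@le_trans _ _ (K * poisson_kernel 1 (x - x'))); last first.
  by rewrite lerDr mulr_ge0// ltW.
have G2 : nc (G x' - G x) <= 2 * C.
  by rewrite (le_trans (normcB_le _ _))// mulr2n mulrDl !mul1r lerD.
apply: (@le_trans _ _ (poisson_kernel e (x - x') * (2 * C))); first by rewrite ler_wpM2l.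
rewrite /K -mulrA -(mulrA (2 * C)) mulrC ler_wpM2l ?mulr_ge0//.
set h := x - x' in xd *.
have h0 : 0 < h ^+ 2.
  by rewrite -(real_normK (num_real h)) exprn_gt0// (lt_le_trans d0).
have hd : delta ^+ 2 <= h ^+ 2.
  by rewrite -(real_normK (num_real h)) lerXn2r ?nnegrE ?(ltW d0).
rewrite /poisson_kernel expr1n mulr1.
apply: (@le_trans _ _ (2 * e / h ^+ 2)).
  rewrite ler_wpM2l ?mulr_ge0 ?(ltW e0)// lef_pV2 ?posrE//; last by rewrite addr_gt0// exprn_gt0.
  by rewrite lerDr exprn_ge0 ?ltW.
have dV : (h ^+ 2)^-1 <= (delta ^+ 2)^-1 by rewrite lef_pV2// posrE// exprn_gt0.
rewrite [leRHS](_ : _ = 2 * e * ((1 + delta ^- 2) / (1 + h ^+ 2))); last by ring.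
rewrite ler_wpM2l ?mulr_ge0 ?(ltW e0)// ler_pdivlMr ?addr_gt0//.
by rewrite mulrDr mulr1 mulVf ?gt_eqF// addrC lerD2l.
Qed.

Lemma nice_smoothing_le A C G x e : nice A C G -> 0 < e ->
  nc (poisson_smoothing e G x) <= 2 * pi * C.
Proof.
move=> nG e0; have iG := nice_cintegrable nG; case: nG => mG GC GA Gc.
have -> : 2 * pi * C = \int[leb]_x' (poisson_kernel e (x - x') * C).
  rewrite mulrC -(Rintegral_poisson_kernelZ C x e0).
  by apply: eq_Rintegral => x' _; rewrite mulrC.
apply: normc_cintegral_le; first exact: cintegrable_poisson_smoothing.
  by have := integrableZr measurableT C (integrable_poisson_kernel e0 x); apply: eq_integrable.
move=> x'; rewrite normc_real_mul (ger0_norm (poisson_kernel_ge0 e0 _)).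
by rewrite ler_wpM2l ?poisson_kernel_ge0.
Qed.

Lemma nice_poisson_form_cvg A C G : nice A C G ->
  (fun n => (Re (cintegral leb (fun x => G x *
     poisson_smoothing (n.+1%:R^-1) (fun x => (G x)^*%C) x)))%:E) @ \oo -->
  ((2 * pi)%:E * sqL2 G)%E.
Proof.
move=> nG; have iG := nice_cintegrable nG; have cG := nice_conj nG.
have e0 n : (0 : R) < n.+1%:R^-1 by rewrite invr_gt0.
have [mG GC GA Gc] := nG; have [mcG cGC cGA cGc] := cG.
have C0 : 0 <= C by rewrite (le_trans (normc_ge0 (G 0))).
pose S n x := poisson_smoothing (n.+1%:R^-1) (fun x => (G x)^*%C) x.
have mS n : cmeas (S n) by apply: cmeas_poisson_smoothing.
have mGS n : cmeas (fun x => G x * S n x) by exact: cmeasM.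
have dom n x : nc (G x * S n x) <= (2 * pi * C) * nc (G x).
  by rewrite Normc.normcM mulrC ler_wpM2r ?normc_ge0// (nice_smoothing_le _ cG).
have ib : leb.-integrable setT (EFin \o (fun x => (2 * pi * C) * nc (G x))).
  by have := integrableZl measurableT (2 * pi * C) (cintegrable_normc iG); apply: eq_integrable.
have iGS n : cintegrable leb (fun x => G x * S n x) :=
  le_cintegrable_lebesgue (mGS n) ib (dom n).
have cS x : Re (G x * S n x) @[n --> \oo] --> 2 * pi * nc (G x) ^+ 2.
  (* From A on, the possible jumps included, the outer factor G x is zero; continuity is needed at
     interior points only. *)
  have [xA|xA] := ltP `|x| A; last first.
    under eq_fun do rewrite (GA _ xA) mul0r.
    by rewrite (GA _ xA) Normc.normc0 expr0n mulr0; exact: cvg_cst.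
  apply/cvgrPdist_le => eps eps0.
  (* With this choice C times 2 pi (eta + eta) is eps C / (1 + C); the summand 1 keeps the quotient
     meaningful when C = 0. *)
  pose eta := eps / (4 * pi * (1 + C)).
  have p0 : (0 : R) < 4 * pi * (1 + C) by rewrite !mulr_gt0 ?pi_gt0// ltr_pwDl.
  have eta0 : 0 < eta by rewrite divr_gt0.
  have [delta d0 dP] := cGc x xA eta eta0.
  pose B := 2 * C * (1 + delta ^- 2).
  have B0 : 0 <= B by rewrite !mulr_ge0// addr_ge0// invr_ge0 exprn_ge0 ?ltW.
  have : \forall n \near \oo, B * n.+1%:R^-1 <= eta.
    have : B * n.+1%:R^-1 @[n --> \oo] --> 0.
      rewrite -[X in _ --> X](mulr0 B); apply: cvgM; first exact: cvg_cst.
      exact: cvg_harmonic.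
    by move/cvgr_le; apply.
  apply: filterS => n Bn.
  have := nice_smoothing_dist cG eta0 d0 (e0 n) dP; rewrite -/(S n x) => Sn.
  have -> : 2 * pi * nc (G x) ^+ 2 = Re (G x * ((2 * pi)%:C * (G x)^*%C)).
    by rewrite [in RHS]mulrCA mul_conjc real_mulE.
  rewrite distrC -cReN -cReD -mulrN -mulrDr (le_trans (Re_le_normc _))// Normc.normcM.
  apply: (@le_trans _ _ (C * (2 * pi * (eta + eta)))).
    rewrite ler_pM ?normc_ge0// (le_trans Sn)// ler_wpM2l ?mulr_ge0 ?pi_ge0// lerD2l.
    by rewrite (le_trans _ Bn)// /B -!mulrA [_^-1 * _]mulrC.
  rewrite (_ : C * _ = eps * (C / (1 + C))); last first.
    have pi0 : pi != 0 :> R by rewrite gt_eqF// pi_gt0.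
    have C1 : 1 + C != 0 by rewrite gt_eqF// ltr_pwDl.
    have E (p c z : R) : p != 0 -> 1 + c != 0 ->
        c * (2 * p * (z / (4 * p * (1 + c)) + z / (4 * p * (1 + c)))) = z * (c / (1 + c)).
      by move=> p0' c0'; field; rewrite p0' c0'.
    exact: E.
  by rewrite ler_piMr ?(ltW eps0)// ler_pdivrMr ?ltr_pwDl// mul1r lerDr.
have -> : (fun n => (Re (cintegral leb (fun x => G x * S n x)))%:E) =
    (fun n => \int[leb]_x (Re (G x * S n x))%:E)%E.
  apply/funext => n; rewrite /cintegral/= /Rintegral fineK//.
  by apply: integrable_fin_num => //; case: (iGS n).
have -> : ((2 * pi)%:E * sqL2 G = \int[leb]_x (2 * pi * nc (G x) ^+ 2)%:E)%E.
  rewrite /sqL2 -ge0_integralZl//.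
  - exact: measurable_sq_normc.
  - by move=> x _; rewrite lee_fin sqr_ge0.
  - by rewrite lee_fin mulr_ge0 ?pi_ge0.
have [] := @dominated_convergence _ _ _ leb setT measurableT
  (fun n x => (Re (G x * S n x))%:E) (fun x => (2 * pi * nc (G x) ^+ 2)%:E)
  (fun x => ((2 * pi * C) * nc (G x))%:E) => //.
- by move=> n; case/integrableP: (iGS n).1.
- by apply/measurable_EFinP; apply: measurable_funM => //; apply: measurable_funX; exact: cmeas_normc.
- by apply: filterE => x _; apply: cvg_EFin; [exact: nearW|exact: cS].
- by apply: filterE => x n _; rewrite lee_fin (le_trans (Re_le_normc _)).
Qed.

(** For the lower bound: the Abel means never exceed the full square norm because the weight is at
    most 1, and they converge to 2 pi times [sqL2 G]. *)
Lemma nice_sqL2_fourier A C G : nice A C G ->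
  sqL2 (fourier G) = ((2 * pi)%:E * sqL2 G)%E.
Proof.
move=> nG; have iG := nice_cintegrable nG; have [mG _ _ _] := nG.
apply/eqP; rewrite eq_le sqL2_fourier_le//=.
have e0 n : (0 : R) < n.+1%:R^-1 by rewrite invr_gt0.
have cv := nice_poisson_form_cvg nG.
rewrite -(cvg_lim _ cv)//; apply: lime_le; first by apply/cvg_ex; eexists; exact: cv.
apply: nearW => n; rewrite -(abel_sq_fourier (e0 n) iG).
have ig := integrable_abel_sq_fourier (e0 n) iG.
rewrite /Rintegral fineK; last exact: integrable_fin_num.
apply: ge0_le_integral => //.
- by move=> y _; rewrite lee_fin mulr_ge0 ?expR_ge0 ?sqr_ge0.
- by case/integrableP: ig.
- by apply: measurable_sq_normc; exact: cmeas_fourier.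
- by move=> y _; rewrite lee_fin ler_piMl ?sqr_ge0// abel_weight_le1// ltW.
Qed.

End plancherel.

(** * Approximation in L^2 and Fourier inversion *)

Section density.
Variable R : realType.
Implicit Types (F G : R -> R[i]) (A C e r : R).
Local Notation leb := (@lebesgue_measure R).

Lemma sqL2_segment F A : (forall x, A < `|x| -> F x = 0) ->
  sqL2 F = (\int[leb]_(x in `[(- A)%R, A]) ((nc (F x)) ^+ 2)%:E)%E.
Proof.
move=> FA; rewrite [RHS]integral_mkcond; apply: eq_integral => x _.
rewrite patchE; case: ifPn => //; rewrite notin_setE /= in_itv/= -ler_norml => /negP.
by rewrite -ltNge => /FA ->; rewrite Normc.normc0 expr0n.
Qed.

Lemma measurable_normc_le F (n : R) : cmeas F -> measurable [set x | nc (F x) <= n].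
Proof.
move=> mF; have := cmeas_normc mF measurableT (measurable_itv `]-oo, n]).
rewrite setTI; congr (measurable _).
Qed.

Lemma L2_bounded_approx F e : cmeas F -> (sqL2 F < +oo)%E -> 0 < e ->
  exists n : nat, (sqL2 (fun x => F x - F x * (\1_[set x | (nc (F x) <= n%:R)%R] x)%:C)%R
    <= e%:E)%E.
Proof.
move=> mF F2 e0.
pose f (n : nat) x : \bar R := ((nc (F x - F x * (\1_[set x | (nc (F x) <= n%:R)%R] x)%:C)) ^+ 2)%:E.
have mfn n : cmeas (fun x => F x - F x * (\1_[set x | (nc (F x) <= n%:R)%R] x)%:C).
  apply: cmeasB => //; apply: cmeasM => //; apply: cmeas_real.
  by apply: measurable_indic; exact: measurable_normc_le.
have iF : leb.-integrable setT (fun x => ((nc (F x)) ^+ 2)%:E).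
  apply/integrableP; split; first exact: measurable_sq_normc.
  move: F2; congr (_ < _)%E; apply: eq_integral => x _.
  by rewrite /= ger0_norm ?sqr_ge0.
have fE n x : nc (F x) <= n%:R -> f n x = 0%E.
  move=> xn; rewrite /f indicE mem_set//= mulr1 subrr Normc.normc0 expr0n//.
have [] := @dominated_convergence _ _ _ leb setT measurableT f (cst 0%E)
   (fun x => ((nc (F x)) ^+ 2)%:E) _ _ _ iF _ => //.
- by move=> n; exact: measurable_sq_normc.
- apply: filterE => x _; apply: cvg_near_cst; near=> n; apply: fE.
  by near: n; exact: nbhs_infty_ger.
- apply: filterE => x n _; rewrite /f /= ger0_norm ?sqr_ge0// lee_fin.
  rewrite lerXn2r ?nnegrE ?normc_ge0// indicE; case: (_ \in _) => /=.
    by rewrite mulr1 subrr Normc.normc0 normc_ge0.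
  by rewrite mulr0 subr0.
move=> _ _; rewrite integral0 => /(cvg_L2norm0 (F := fun n => \int[leb]_x f n x)%E).
move=> H0.
have : \forall n \near \oo, (\int[leb]_x f n x <= e%:E)%E.
  by apply: H0 => // n; apply: integral_ge0 => x _; rewrite lee_fin sqr_ge0.
by move=> [n _ /(_ n (leqnn n)) hn]; exists n.
Unshelve. all: by end_near. Qed.

Lemma bounded_continuous_approx (h : R -> R) A (n : R) e : 0 < e -> 0 <= n ->
  measurable_fun setT h -> (forall x, `|h x| <= n) ->
  exists g : R -> R, [/\ continuous g, forall x, `|g x| <= n &
    (\int[leb]_(x in `[(- A)%R, A]) `|(h x - g x)%R|%:E <= e%:E)%E].
Proof.
move=> e0 n0 mh hn.
have ih : leb.-integrable `[(- A)%R, A] (EFin \o h).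
  apply: measurable_bounded_integrable => //.
  - rewrite /= lebesgue_measure_itv/=; case: ifP => _ //; by rewrite -EFinD ltry.
  - exact: measurable_funTS.
  - exists n; split; first exact: num_real.
    by move=> M nM x _ /=; rewrite (le_trans (hn x))// ltW.
have fA : (leb `[(- A)%R, A] < +oo)%E.
  by rewrite /= lebesgue_measure_itv/=; case: ifP => _ //; rewrite -EFinD ltry.
have [g_ [cg ig /(cvg_L2norm0 (F := fun n => \int[leb]_(x in `[(- A)%R, A]) `|(h x - g_ n x)%R%:E|)%E) H]] :=
    approximation_continuous_integrable (measurable_itv _) fA ih.
have {}H : \forall n \near \oo, (\int[leb]_(x in `[(- A)%R, A]) `|(h x - g_ n x)%R%:E| <= e%:E)%E.
  by apply: H => // k; apply: integral_ge0.
have [k _ /(_ k (leqnn k)) hk] := H.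
(* Clamping to [- n, n] brings the approximant no farther from h, whose values lie in that
   interval. *)
have cm : continuous (fun x => Num.max (- n) (Num.min n (g_ k x))).
  move=> x; apply: (@continuous_max _ _ (cst (- n)) (cst n \min g_ k)); first exact: cvg_cst.
  by apply: continuous_min; [exact: cvg_cst|exact: cg].
exists (fun x => Num.max (- n) (Num.min n (g_ k x))); split => //.
- by move=> x; rewrite ler_norml le_max lexx/= ge_max ge_min lexx/= andbT; lra.
- apply: le_trans hk; apply: ge0_le_integral => //.
  + apply/measurable_EFinP; apply: measurableT_comp => //.
    apply: measurable_funB; first exact: measurable_funTS.
    by apply: measurable_funTS; exact: continuous_measurable_fun.
  + apply/measurable_EFinP; apply: measurableT_comp => //.
    apply: measurable_funB; first exact: measurable_funTS.
    by apply: measurable_funTS; apply: continuous_measurable_fun; exact: cg.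
  + move=> x _; rewrite lee_fin; have := hn x; rewrite ler_norml => /andP[h1 h2].
    have [gn|gn] := leP n (g_ k x).
      rewrite max_r; last by lra.
      rewrite ler0_norm; last by lra.
      by rewrite ler0_norm; lra.
    have [gn'|gn'] := leP (- n) (g_ k x).
      by [].
    rewrite ger0_norm; last by lra.
    by rewrite ger0_norm; lra.
Qed.

Lemma continuous_dist_le (g : R -> R) x e : {for x, continuous g} -> 0 < e ->
  exists2 d : R, 0 < d & forall x', `|x - x'| < d -> `|g x' - g x| <= e.
Proof.
move=> /cvgrPdist_le/[apply] -[d /= d0 H].
by exists d => // x' /H /=; rewrite distrC.
Qed.

(** F is first cut at height n. Its real and imaginary parts are then approximated in L^1 on
    [- A, A] by continuous functions bounded by n, and |u - v|^2 <= 2 n |u - v| turns this into an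
    L^2 approximation. Cutting these off at the end points creates the jumps that [nice] permits. *)
Lemma nice_dense F A e : 0 < A -> cmeas F -> (sqL2 F < +oo)%E ->
  (forall x, A <= `|x| -> F x = 0) -> 0 < e ->
  exists C G, nice A C G /\ (L2norm (fun x => (F x - G x)%R) <= e%:E)%E.
Proof.
move=> A0 mF F2 FA e0.
have e2 : 0 < (e / 2) ^+ 2 by rewrite exprn_gt0// divr_gt0.
have [n Hn] := L2_bounded_approx mF F2 e2.
pose H x := F x * (\1_[set x | (nc (F x) <= n%:R)%R] x)%:C.
have mH : cmeas H.
  by apply: cmeasM => //; apply: cmeas_real; apply: measurable_indic; exact: measurable_normc_le.
have Hb x : nc (H x) <= n%:R.
  rewrite /H indicE; have [|] := boolP (x \in _).
    by rewrite inE /= mulr1.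
  by rewrite mulr0 Normc.normc0.
have HA x : A <= `|x| -> H x = 0 by move=> /FA; rewrite /H => ->; rewrite mul0r.
have /cmeasP[mr mi] := mH.
have n0 : (0 : R) <= n%:R by [].
(* Chosen so that 2 n (eta + eta) <= (e / 2)^2; n + 1 in the denominator covers n = 0. *)
pose eta : R := (e / 2) ^+ 2 / (4 * (n%:R + 1)).
have eta0 : 0 < eta by rewrite divr_gt0// mulr_gt0// ltr_wpDl.
have [g1 [cg1 g1n h1]] := bounded_continuous_approx A eta0 n0 mr
  (fun x => le_trans (Re_le_normc (H x)) (Hb x)).
have [g2 [cg2 g2n h2]] := bounded_continuous_approx A eta0 n0 mi
  (fun x => le_trans (Im_le_normc (H x)) (Hb x)).
pose G x := (\1_(`](- A), A[ : set R) x)%:C * (g1 x +i* g2 x).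
have GI x : `|x| < A -> G x = g1 x +i* g2 x.
  by move=> xA; rewrite /G indicE mem_set ?mul1r//= in_itv/= -ltr_norml.
have GO x : A <= `|x| -> G x = 0.
  move=> xA; rewrite /G indicE memNset ?mul0r//= in_itv/= -ltr_norml => xA'.
  by move: xA; rewrite leNgt xA'.
have mg1 := continuous_measurable_fun cg1; have mg2 := continuous_measurable_fun cg2.
have mG : cmeas G.
  apply: cmeasM; last by apply/cmeasP; split.
  by apply: cmeas_real; exact: measurable_indic.
exists (2 * n%:R), G; split; first split => //.
- move=> x; have [xA|xA] := ltP `|x| A.
    rewrite GI// (le_trans (normc_le_ReIm _))//= mulr_natl mulr2n.
    by rewrite lerD.
  by rewrite GO// Normc.normc0 mulr_ge0.
- move=> x xA eps eps0.
  have eps2 : 0 < eps / 2 by rewrite divr_gt0.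
  have [d1 d10 d1P] := continuous_dist_le (cg1 x) eps2.
  have [d2 d20 d2P] := continuous_dist_le (cg2 x) eps2.
  exists (Num.min d1 (Num.min d2 (A - `|x|))).
    by rewrite !lt_min subr_gt0 xA andbT; apply/andP.
  move=> x'; rewrite !lt_min => /and3P[xd1 xd2 xd3].
  rewrite !GI//; last first.
    rewrite -(subrK x x') (le_lt_trans (ler_normD _ _))// -ltrBrDr distrC.
    by [].
  rewrite (le_trans (normc_le_ReIm _))//=.
  by rewrite [leRHS]splitr lerD// ?d1P ?d2P.
- apply: (@le_trans _ _ ((e / 2)%:E + (e / 2)%:E)%E); last by rewrite -EFinD lee_fin; lra.
  apply: (le_trans (L2normB_le mF mH mG)); apply: leeD.
    by apply: L2norm_le_real => //; rewrite divr_ge0 ?ltW.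
  apply: L2norm_le_real; first by rewrite divr_ge0 ?ltW.
  rewrite (@sqL2_segment _ A); last by move=> x /ltW xA; rewrite HA// GO// subrr.
  apply: (@le_trans _ _ (\int[leb]_(x in `[(- A)%R, A])
      ((2 * n%:R)%:E * (`|(Re (H x) - g1 x)%R|%:E + `|(Im (H x) - g2 x)%R|%:E)))%E).
    apply: ge0_le_integral => //.
    + by move=> x _; rewrite lee_fin sqr_ge0.
    + by apply: measurable_funTS; apply: measurable_sq_normc; exact: cmeasB.
    + apply: measurable_funTS; apply: measurable_funeM; apply: emeasurable_funD;
      apply/measurable_EFinP; apply: measurableT_comp => //; exact: measurable_funB.
    + move=> x _; rewrite -EFinD -EFinM lee_fin.
      have [xA|xA] := ltP `|x| A; last first.
        by rewrite HA// GO// subrr Normc.normc0 expr0n/= mulr_ge0 ?addr_ge0// mulr_ge0.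
      rewrite GI// sqr_normcE; have := Hb x => Hbx.
      have b1 := le_trans (Re_le_normc (H x)) Hbx.
      have b2 := le_trans (Im_le_normc (H x)) Hbx.
      have := g1n x; have := g2n x.
      case: (H x) b1 b2 => a b /= b1 b2 b3 b4.
      have K (u v : R) : `|u| <= n%:R -> `|v| <= n%:R -> (u - v) ^+ 2 <= 2 * n%:R * `|u - v|.
        move=> un vn; rewrite -(real_normK (num_real (u - v))) expr2 ler_wpM2r//.
        by rewrite (le_trans (ler_normB _ _))// mulr_natl mulr2n lerD.
      by rewrite mulrDr lerD// K.
  rewrite ge0_integralZl//; last 2 first.
  + apply: measurable_funTS; apply: emeasurable_funD;
      apply/measurable_EFinP; apply: measurableT_comp => //; exact: measurable_funB.
  + by move=> x _; rewrite adde_ge0.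
  rewrite ge0_integralD//; last 2 first.
  + by apply/measurable_EFinP; apply: measurableT_comp => //; apply: measurable_funTS; exact: measurable_funB.
  + by apply/measurable_EFinP; apply: measurableT_comp => //; apply: measurable_funTS; exact: measurable_funB.
  apply: (@le_trans _ _ ((2 * n%:R)%:E * (eta%:E + eta%:E))%E).
    by apply: lee_wpmul2l; rewrite ?lee_fin ?mulr_ge0 ?leeD.
  rewrite -EFinD -EFinM lee_fin /eta.
  rewrite (_ : 2 * n%:R * _ = (e / 2) ^+ 2 * (n%:R / (n%:R + 1))); last first.
    by field; rewrite gt_eqF// ltr_wpDl.
  by rewrite ler_piMr ?(ltW e2)// ler_pdivrMr ?ltr_wpDl// mul1r lerDl.
Qed.

End density.

Section inversion.
Variable R : realType.
Implicit Types (F G : R -> R[i]) (A C e r : R).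
Local Notation leb := (@lebesgue_measure R).

Lemma sqL2_integrable F : cmeas F -> (sqL2 F < +oo)%E ->
  leb.-integrable setT (fun x => ((nc (F x)) ^+ 2)%:E).
Proof.
move=> mF F2; apply/integrableP; split; first exact: measurable_sq_normc.
move: F2; congr (_ < _)%E; apply: eq_integral => x _.
by rewrite /= ger0_norm ?sqr_ge0.
Qed.

Lemma L2_integrable F : L2 F -> leb.-integrable setT (fun x => ((nc (F x)) ^+ 2)%:E).
Proof. by move=> /L2P[mF F2]; exact: sqL2_integrable. Qed.

Lemma L2_cintegrable F A : L2 F -> (forall x, A < `|x| -> F x = 0) -> cintegrable leb F.
Proof.
move=> F2 FA; have iF := L2_integrable F2; have [mF _] := F2.
have i2 : leb.-integrable setT
    (EFin \o (fun x => \1_(`[(- A), A] : set R) x + nc (F x) ^+ 2)).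
  by have := integrableD measurableT (integrable_indic_segment A) iF; apply: eq_integrable.
apply: (le_cintegrable_lebesgue mF i2) => x; rewrite indicE.
case: (lerP `|x| A) => xA.
  rewrite mem_set/= ?in_itv/= -?ler_norml//.
  have := normc_ge0 (F x); set c := nc (F x) => c0.
  have := sqr_ge0 (c - 2^-1); rewrite sqrrB; lra.
by rewrite FA// Normc.normc0 addr_ge0 ?sqr_ge0.
Qed.

Lemma cmeas_truncate r F : cmeas F -> cmeas (truncate r F).
Proof.
move=> mF; rewrite (_ : truncate r F = fun x => (\1_(`[(- r), r] : set R) x)%:C * F x).
  by apply: cmeasM => //; apply: cmeas_real; exact: measurable_indic.
apply/funext => x; rewrite /truncate indicE; case: ifPn => xr.
  by rewrite mem_set ?mul1r//= in_itv/= -ler_norml.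
by rewrite memNset ?mul0r//= in_itv/= -ler_norml; exact/negP.
Qed.

Lemma normc_truncate_le r F x : nc (truncate r F x) <= nc (F x).
Proof. by rewrite /truncate; case: ifP => // _; rewrite Normc.normc0 normc_ge0. Qed.

Lemma L2_truncate r F : L2 F -> L2 (truncate r F).
Proof.
move=> F2; apply: (L2_le _ F2); last exact: normc_truncate_le.
by apply: cmeas_truncate; case: F2.
Qed.

Lemma truncate_cintegrable r F : L2 F -> cintegrable leb (truncate r F).
Proof.
move=> /(L2_truncate r)/(@L2_cintegrable _ r); apply => x rx.
by rewrite /truncate leNgt rx.
Qed.

(** Convergence along the integers suffices because truncations only grow with r; one n then serves
    every real r >= n, as the limit over real r in [is_fourier] demands. *)
Lemma sqL2_truncate_tail F e : L2 F -> 0 < e -> exists n : nat, forall r, n%:R <= r ->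
  \int[leb]_x (nc (F x)) ^+ 2 - e <= \int[leb]_x (nc (truncate r F x)) ^+ 2.
Proof.
move=> F2 e0; have iF := L2_integrable F2; have [mF _] := F2.
pose f (n : nat) x : \bar R := ((nc (truncate n%:R F x)) ^+ 2)%:E.
have le1 r x : nc (truncate r F x) ^+ 2 <= nc (F x) ^+ 2.
  by rewrite lerXn2r ?nnegrE ?normc_ge0// normc_truncate_le.
have [] := @dominated_convergence _ _ _ leb setT measurableT f
   (fun x => ((nc (F x)) ^+ 2)%:E) (fun x => ((nc (F x)) ^+ 2)%:E) _ _ _ iF _ => //.
- by move=> n; apply: measurable_sq_normc; exact: cmeas_truncate.
- exact: measurable_sq_normc.
- apply: filterE => x _; apply: cvg_near_cst; near=> n; rewrite /f /truncate ifT//.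
  by near: n; exact: nbhs_infty_ger.
- by apply: filterE => x n _; rewrite /f /= ger0_norm ?sqr_ge0// lee_fin.
move=> _ _; rewrite -(fineK (integrable_fin_num measurableT iF)).
move=> /fine_cvg/cvgrPdist_le/(_ _ e0)[n _ /(_ n (leqnn n))] hn.
exists n => r nr; have {}hn := ler_normlW hn.
rewrite lerBlDr -lerBlDl (le_trans _ hn)// lerB//.
apply: le_Rintegral => //.
- exact: (L2_integrable (L2_truncate _ F2)).
- exact: (L2_integrable (L2_truncate _ F2)).
- move=> x _; rewrite lerXn2r ?nnegrE ?normc_ge0// /truncate; case: ifPn => xn.
    by rewrite (le_trans xn nr).
  by rewrite Normc.normc0 normc_ge0.
Unshelve. all: by end_near. Qed.

(** [inverse_fourier] at real points, written as a reflected forward transform so that the estimates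
    on [fourier] carry over. *)
Definition ift F (x : R) : R[i] := ((2 * pi)^-1)%:C * fourier F (- x).

Lemma inverse_fourier_real F (x : R) : inverse_fourier F x%:C = ift F x.
Proof.
rewrite /inverse_fourier /ift /fourier; congr (_ * _); apply: eq_cintegral => y.
by congr (cexp _ * _); rewrite -mulrA -rmorphM mulrN (mulrC x) rmorphN mulrN.
Qed.

Lemma cmeas_ift F : cmeas F -> cmeas (ift F).
Proof.
move=> mF; apply: cmeasM; first exact: cmeas_cst.
exact: (cmeas_oppr (cmeas_fourier mF)).
Qed.

Lemma sqL2_ift_fourier F : cmeas F ->
  ((2 * pi)%:E * sqL2 (ift F) = ((2 * pi)^-1)%:E * sqL2 (fourier F))%E.
Proof.
move=> mF; have mf := cmeas_fourier mF.
rewrite sqL2Z; last exact: (cmeas_oppr mf).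
rewrite sqL2_oppr// muleA -EFinM normc_real ger0_norm ?invr_ge0 ?mulr_ge0 ?pi_ge0//.
by rewrite expr2 mulrA divff ?mul1r// mulf_neq0 ?gt_eqF ?pi_gt0.
Qed.

Lemma sqL2_ift_le F : cintegrable leb F -> ((2 * pi)%:E * sqL2 (ift F) <= sqL2 F)%E.
Proof.
move=> iF; have mF : cmeas F := cintegrable_meas iF.
have pi2 : (0 : R) < 2 * pi by rewrite mulr_gt0 ?pi_gt0.
by rewrite sqL2_ift_fourier// lee_pdivrMl// sqL2_fourier_le.
Qed.

Lemma nice_sqL2_ift A C G : nice A C G -> ((2 * pi)%:E * sqL2 (ift G) = sqL2 G)%E.
Proof.
move=> nG; have [mG _ _ _] := nG; rewrite sqL2_ift_fourier// (nice_sqL2_fourier nG).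
have pi2 : (0 : R) < 2 * pi by rewrite mulr_gt0 ?pi_gt0.
by rewrite muleA -EFinM mulVf ?mul1e// gt_eqF.
Qed.

Lemma L2_ift F : cintegrable leb F -> L2 F -> L2 (ift F).
Proof.
move=> iF /L2P[mF F2]; apply/L2P; split; first exact: cmeas_ift.
have pi2 : (0 : R) < 2 * pi by rewrite mulr_gt0 ?pi_gt0.
rewrite -(@lte_pmul2l _ (2 * pi)%:E)//.
by rewrite (le_lt_trans (sqL2_ift_le iF))// gt0_muley ?lte_fin.
Qed.

Lemma iftB F G x : cintegrable leb F -> cintegrable leb G ->
  ift (fun x => F x - G x) x = ift F x - ift G x.
Proof. by move=> iF iG; rewrite /ift fourierB// mulrBr. Qed.

Lemma iftZ a F x : cintegrable leb F -> ift (fun x => a * F x) x = a * ift F x.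
Proof. by move=> iF; rewrite /ift fourierZ// mulrCA. Qed.

(** The factors 2 pi of the two transforms cancel and truncation only decreases the norm. The bound
    is uniform in r, which is what the passage from nice functions to general F rests on. *)
Lemma L2norm_truncated_inversion_le r F : cintegrable leb F -> L2 F ->
  (L2norm (fourier (truncate r (ift F))) <= L2norm F)%E.
Proof.
move=> iF F2; have i2 := L2_ift iF F2.
have pi2 : (0 : R) < 2 * pi by rewrite mulr_gt0 ?pi_gt0.
have := @L2norm_le_scale R (fourier (truncate r (ift F))) F 1 ler01.
rewrite expr1n !mul1e; apply.
apply: (le_trans (sqL2_fourier_le (truncate_cintegrable r i2))).
apply: (le_trans _ (sqL2_ift_le iF)); rewrite lee_pmul2l//.
by apply: le_sqL2; [apply: cmeas_truncate; case: i2|case: i2|exact: normc_truncate_le].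
Qed.

Lemma sqr_normcB (z w : R[i]) : nc (z - w) ^+ 2 = nc z ^+ 2 + nc w ^+ 2 - 2 * Re (z * w^*%C).
Proof. by rewrite !sqr_normcE cReM cReD cImD cReN cImN; case: w => a b /=; ring. Qed.

Lemma nice_L2 A C G : nice A C G -> L2 G.
Proof.
move=> nG; have iG := nice_cintegrable nG; have [mG GC _ _] := nG.
apply/L2P; split => //.
have : leb.-integrable setT (EFin \o (fun x => C * nc (G x))).
  by have := integrableZl measurableT C (cintegrable_normc iG); apply: eq_integrable.
case/integrableP => mh; apply: le_lt_trans; apply: ge0_le_integral => //.
- by move=> x _; rewrite lee_fin sqr_ge0.
- exact: measurable_sq_normc.
- exact: measurableT_comp.
- move=> x _; rewrite lee_fin (le_trans _ (ler_norm _))//.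
  by rewrite expr2 ler_wpM2r ?normc_ge0.
Qed.

Lemma L2_mul_cintegrable F G : L2 F -> L2 G -> cintegrable leb (fun x => F x * G x).
Proof.
move=> F2 G2; have iF := L2_integrable F2; have iG := L2_integrable G2.
have [mF _] := F2; have [mG _] := G2; have mFG := cmeasM mF mG.
have i2 : leb.-integrable setT (EFin \o (fun x => nc (F x) ^+ 2 + nc (G x) ^+ 2)).
  by have := integrableD measurableT iF iG; apply: eq_integrable.
apply: (le_cintegrable_lebesgue mFG i2) => x; rewrite Normc.normcM.
have := sqr_ge0 (nc (F x) - nc (G x)); rewrite sqrrB.
have := mulr_ge0 (normc_ge0 (F x)) (normc_ge0 (G x)); lra.
Qed.

(** With t the truncation of [ift G], expand the square of the difference. The transform of t
    contributes at most 2 pi |t|^2, the cross term exactly - 4 pi |t|^2, and G contributes 2 pi |ift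
    G|^2. The total is at most 2 pi times a tail of [ift G]. *)
Lemma nice_truncated_inversion A C G e : nice A C G -> 0 < e -> exists n : nat, forall r, n%:R <= r ->
  (sqL2 (fun x => (fourier (truncate r (ift G)) x - G x)%R) <= e%:E)%E.
Proof.
move=> nG e0; have iG := nice_cintegrable nG; have [mG GC GA _] := nG.
have pi2 : (0 : R) < 2 * pi by rewrite mulr_gt0 ?pi_gt0.
have G2 : L2 G := nice_L2 nG.
have i2 := L2_ift iG G2.
have [n Hn] := sqL2_truncate_tail i2 (divr_gt0 e0 pi2).
exists n => r nr; have {Hn} := Hn r nr.
set t := truncate r (ift G) => Ht.
have t2 : L2 t := L2_truncate r i2.
have it : cintegrable leb t := truncate_cintegrable r i2.
have mft : cmeas (fourier t) by apply: cmeas_fourier; case: t2.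
have sqt : (sqL2 (fourier t) <= (2 * pi)%:E * sqL2 t)%E := sqL2_fourier_le it.
have ft2 : L2 (fourier t).
  apply/L2P; split => //; apply: (le_lt_trans sqt).
  by case/L2P: t2 => _ ?; rewrite lte_mul_pinfty// lee_fin ltW.
have fin F : L2 F -> sqL2 F = (\int[leb]_x (nc (F x)) ^+ 2)%:E.
  move=> /L2_integrable ?; rewrite /Rintegral fineK//; exact: integrable_fin_num.
(* After the exchange t meets the conjugate of 2 pi [ift G], which agrees with 2 pi t wherever t is
   not cut off. *)
have E : cintegral leb (fun y => fourier t y * (G y)^*%C) =
    (2 * pi * \int[leb]_x (nc (t x)) ^+ 2)%:C.
  rewrite (fourier_exchange it (cintegrable_conj iG)).
  rewrite -RintegralZl//; last exact: L2_integrable.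
  rewrite -(cintegral_real leb); apply: eq_cintegral => x.
  rewrite -[x in fourier _ x]opprK -conj_fourier//.
  have -> : fourier G (- x) = (2 * pi)%:C * ift G x.
    by rewrite /ift mulrA -rmorphM divff ?mul1r// gt_eqF.
  rewrite conjcM mulrCA.
  have -> : (2 * pi * nc (t x) ^+ 2)%:C = (2 * pi)%:C * (t x * (t x)^*%C).
    by rewrite mul_conjc -rmorphM.
  rewrite (_ : ((2 * pi)%:C)^*%C = (2 * pi)%:C); last by rewrite /= oppr0.
  congr (_ * _); rewrite /t /truncate; case: ifP => // _.
  by rewrite !mul0r.
have ip : cintegrable leb (fun y => fourier t y * (G y)^*%C).
  apply: L2_mul_cintegrable => //; apply: (L2_le _ G2); first exact: cmeas_conj.
  by move=> x; rewrite normcJ_eq.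
have L : L2 (fun x => fourier t x - G x) by exact: L2B.
rewrite fin// lee_fin.
rewrite (_ : \int[leb]_x _ = \int[leb]_x nc (fourier t x) ^+ 2 + \int[leb]_x nc (G x) ^+ 2
     - 2 * Re (cintegral leb (fun y => fourier t y * (G y)^*%C))); last first.
  rewrite Re_cintegral -RintegralZl//; last by case: ip.
  rewrite -RintegralD//; try exact: L2_integrable.
  rewrite -RintegralB//.
  - by apply: eq_Rintegral => x _; exact: sqr_normcB.
  - have := integrableD measurableT (L2_integrable ft2) (L2_integrable G2).
    by apply: eq_integrable.
  - have := integrableZl measurableT 2 ip.1.
    by apply: eq_integrable.
rewrite E; have -> : forall x : R, Re x%:C = x by [].
move: sqt; rewrite !fin// -EFinM lee_fin => sqt.
have h : 2 * pi * \int[leb]_x (nc (ift G x)) ^+ 2 = \int[leb]_x (nc (G x)) ^+ 2.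
  by apply: EFin_inj; have := nice_sqL2_ift nG; rewrite !fin// -EFinM.
have aux (I J K H p : R) : 0 < p -> I - e / p <= J -> p * I = K -> H <= p * J ->
    H + K - 2 * (p * J) <= e.
  move=> p0; rewrite -(ler_pM2l p0) mulrBr [p * (e / p)]mulrC divfK ?gt_eqF//.
  by move=> h1 h2 h3; lra.
exact: aux pi2 Ht h sqt.
Qed.

Theorem is_fourier_ift F A : L2 F -> (forall x, A < `|x| -> F x = 0) -> is_fourier (ift F) F.
Proof.
move=> F2 FA; have iF := L2_cintegrable F2 FA; have i2 := L2_ift iF F2.
have [mF _] := F2.
split => //; apply/cvg_L2norm0; first by move=> r; exact: L2norm_ge0.
move=> e e0; have e3 : 0 < e / 3 by rewrite divr_gt0.
(* [nice_dense] asks for a positive radius and for F to vanish already at the end points; enlarging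
   the radius provides both. *)
pose A' := `|A| + 1.
have A'0 : 0 < A' by rewrite ltr_wpDl.
have FA' x : A' <= `|x| -> F x = 0.
  by move=> h; apply: FA; rewrite (le_lt_trans (ler_norm A))// (lt_le_trans _ h)// ltrDl.
have /L2P[_ F2'] := F2.
have [C [G [nG FG]]] := nice_dense A'0 mF F2' FA' e3.
have iG := nice_cintegrable nG; have [mG _ _ _] := nG.
have e32 : 0 < (e / 3) ^+ 2 by rewrite exprn_gt0.
have [n Hn] := nice_truncated_inversion nG e32.
exists n%:R; split; first exact: num_real.
move=> r /ltW nr.
have FGL : L2 (fun x => F x - G x).
  by split; [exact: cmeasB|rewrite (le_lt_trans FG)// ltry].
have iFG := cintegrableB iF iG.
have G2 : L2 G.
  have := L2B F2 FGL; by under eq_fun do rewrite opprB addrCA subrr addr0.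
have m1 := cmeas_fourier (cmeas_truncate r (cmeas_ift mF)).
have m2 := cmeas_fourier (cmeas_truncate r (cmeas_ift mG)).
rewrite (_ : e%:E = ((e / 3)%:E + ((e / 3)%:E + (e / 3)%:E))%E); last first.
  by rewrite -!EFinD; congr (_%:E); lra.
apply: (le_trans (L2normB_le m1 m2 mF)); apply: leeD.
  rewrite (_ : (fun x => _) = fourier (truncate r (ift (fun x => F x - G x)))).
    by apply: (le_trans (L2norm_truncated_inversion_le r iFG FGL)).
  apply/funext => y; rewrite -fourierB; try exact: (truncate_cintegrable _ (L2_ift _ _)).
  congr (fourier _ y); apply/funext => x; rewrite /truncate; case: ifP => _.
    by rewrite iftB.
  by rewrite subr0.
apply: (le_trans (L2normB_le m2 mG mF)); apply: leeD; last by rewrite L2norm_distC.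
by apply: L2norm_le_real; [exact: ltW|exact: Hn].
Qed.

End inversion.

(** * Uniqueness of semigroup orbits *)

Section real_induction.
Variable R : realType.

(** Let c be the supremum of the r for which P holds on [0, r]. The condition from the left gives P
    c, and if c < s the condition to the right would extend the segment beyond c. *)
Lemma real_induction (s : R) (P : R -> Prop) : 0 <= s -> P 0 ->
  (forall r, 0 <= r -> r < s -> P r ->
     exists2 delta, 0 < delta & forall r', r < r' -> r' < r + delta -> r' <= s -> P r') ->
  (forall r, 0 < r -> r <= s -> (forall r', 0 <= r' -> r' < r -> P r') -> P r) ->
  P s.
Proof.
move=> s0 P0 Pr Pl.
pose E : set R := [set r | 0 <= r <= s /\ forall r', 0 <= r' -> r' <= r -> P r'].
have E0 : E 0.
  split; first by rewrite lexx s0.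
  by move=> r' r0 r0'; rewrite (_ : r' = 0)//; apply/eqP; rewrite eq_le r0'.
have ubE : ubound E s by move=> r [/andP[]].
have hE : has_sup E by split; [exists 0|exists s].
pose c := sup E.
have cs : c <= s by apply: ge_sup => //; exists 0.
have c0 : 0 <= c by apply: sup_upper_bound.
have Plt r : 0 <= r -> r < c -> P r.
  move=> r0 rc; have [e Ee re] := sup_adherent (eps := c - r) ltac:(by rewrite subr_gt0) hE.
  by case: Ee => _; apply => //; apply: ltW; move: re; rewrite subKr.
have Pc : P c.
  move: c0; rewrite le_eqVlt => /predU1P[<-//|c0].
  by apply: Pl.
have [sc|cs'] := leP s c; first by have -> : s = c by apply/eqP; rewrite eq_le sc.
have [dl d0 dP] := Pr c c0 cs' Pc.
pose c' := Num.min (c + dl / 2) s.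
have cc' : c < c' by rewrite lt_min cs' andbT ltrDl divr_gt0.
suff : E c' by move=> /(sup_upper_bound hE); rewrite leNgt cc'.
split; first by rewrite ge_min lexx orbT andbT (le_trans c0 (ltW cc')).
move=> r' r0; rewrite le_min => /andP[rd rs].
have [rc|rc|->//] := ltgtP r' c; first exact: Plt.
apply: dP => //; rewrite (le_lt_trans rd)// ltrD2l.
by rewrite ltr_pdivrMr// ltr_pMr// ltr1n.
Qed.

End real_induction.

Section semigroup_orbit.
Variable R : realType.
Implicit Types (f g : R -> R[i]) (r s t h e : R).
Local Notation leb := (@lebesgue_measure R).

Definition L2dist f g : \bar R := L2norm (fun x => f x - g x).

Lemma L2dist_triangle f g k : L2 f -> L2 g -> L2 k -> (L2dist f k <= L2dist f g + L2dist g k)%E.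
Proof. by move=> [mf _] [mg _] [mh _]; exact: L2normB_le. Qed.

Lemma L2distC f g : L2dist f g = L2dist g f.
Proof. exact: L2norm_distC. Qed.

Lemma aeeq_L2dist f f' g g' : L2 f -> L2 f' -> L2 g -> L2 g' -> aeeq f f' -> aeeq g g' ->
  L2dist f g = L2dist f' g'.
Proof.
move=> [mf _] [mf' _] [mg _] [mg' _] ff gg; apply: aeeq_L2norm.
- exact: cmeasB.
- exact: cmeasB.
- exact: aeeqB.
Qed.

Lemma L2dist_refl f : L2dist f f = 0%E.
Proof.
rewrite /L2dist; apply/eqP; rewrite eq_le L2norm_ge0 andbT.
apply: L2norm_le_real => //; rewrite /sqL2.
under eq_integral do rewrite subrr Normc.normc0 expr0n/=.
by rewrite integral0 expr0n.
Qed.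

Variable T : R -> (R -> R[i]) -> (R -> R[i]).
Hypothesis hT : contraction_semigroup T.

Lemma L2dist_contraction t f g : 0 <= t -> L2 f -> L2 g ->
  (L2dist (T t f) (T t g) <= L2dist f g)%E.
Proof.
move=> t0 f2 g2; have Tf := csg_L2 hT t0 f2; have Tg := csg_L2 hT t0 g2.
(* Linearity is given only almost everywhere and for combinations a f + g, so the difference is
   written with a = -1. *)
have fg : L2 (fun x => -1 * g x + f x) by apply: L2D => //; exact: L2Z.
have := csg_linear hT (-1) t0 g2 f2 => H.
have -> : L2dist (T t f) (T t g) = L2norm (T t (fun x => -1 * g x + f x)).
  apply: aeeq_L2norm.
  - by apply: cmeasB; [case: Tf|case: Tg].
  - by case: (csg_L2 hT t0 fg).
  - by apply: aeeq_trans (aeeq_sym H); apply: filterE => x; rewrite mulN1r addrC.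
apply: (le_trans (csg_contraction hT t0 fg)).
by rewrite /L2dist; under eq_fun do rewrite mulN1r addrC.
Qed.

Lemma L2dist_semigroupD s t f g : 0 <= s -> 0 <= t -> L2 f -> L2 g ->
  (L2dist (T (s + t) f) (T s g) <= L2dist (T t f) g)%E.
Proof.
move=> s0 t0 f2 g2; have Tf := csg_L2 hT t0 f2.
rewrite (@aeeq_L2dist _ (T s (T t f)) _ (T s g)).
- exact: L2dist_contraction.
- by apply: csg_L2 => //; rewrite addr_ge0.
- exact: csg_L2.
- exact: csg_L2.
- exact: csg_L2.
- exact: csg_add.
- exact: aeeq_refl.
Qed.

Variables (v w : R -> R -> R[i]) (C : R).
Hypothesis C0 : 0 <= C.
Hypothesis hgen : forall r, 0 <= r -> generator_graph T (v r) (w r).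
Hypothesis hderiv : forall r h, 0 <= r -> 0 <= h ->
  (L2norm (fun x => (v (r + h) x - v r x - h%:C * w r x)%R) <= (C * h ^+ 2)%:E)%E.
Hypothesis hlip : forall r h, 0 <= r -> 0 <= h -> (L2dist (v r) (v (r + h)) <= (C * h)%:E)%E.

Let L2v r : 0 <= r -> L2 (v r).
Proof. by move=> /hgen[]. Qed.

(** Over a short time h both T h (v r) and v (r + h) equal v r + h w r up to e h / 2: the first
    because w r is the generator's value at v r, the second because its error C h^2 is of smaller
    order. *)
Lemma orbit_step r e : 0 <= r -> 0 < e -> exists2 delta, 0 < delta &
  forall h, 0 < h -> h < delta -> (L2dist (T h (v r)) (v (r + h)) <= (e * h)%:E)%E.
Proof.
move=> r0 e0; have e2 : 0 < e / 2 by rewrite divr_gt0.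
have [vr wr /cvg_L2norm0] := hgen r0.
move=> /(_ (fun h => L2norm_ge0 _))/(_ _ e2)[d1 /= d10 d1P].
have C1 : 0 < C + 1 by rewrite ltr_wpDl.
exists (Num.min d1 (e / 2 / (C + 1))); first by rewrite lt_min d10 divr_gt0.
move=> h h0; rewrite lt_min => /andP[hd1 hd2].
have h0' := ltW h0.
have := d1P h; rewrite /= sub0r normrN gtr0_norm// => /(_ hd1 h0) H1.
have vrh : L2 (v (r + h)) by apply: L2v; rewrite addr_ge0.
have Tv : L2 (T h (v r)) by exact: csg_L2.
pose k x := v r x + h%:C * w r x.
have k2 : L2 k by apply: L2D => //; exact: L2Z.
apply: (le_trans (L2dist_triangle Tv k2 vrh)).
rewrite [e]splitr mulrDl EFinD; apply: leeD.
- rewrite /L2dist /k.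
  rewrite (_ : (fun x => _) = fun x => h%:C * ((h^-1)%:C * (T h (v r) x - v r x) - w r x)); last first.
    apply/funext => x; rewrite mulrBr mulrA -rmorphM divff ?gt_eqF// mul1r.
    by rewrite opprD addrA.
  have mk : cmeas (fun x => (h^-1)%:C * (T h (v r) x - v r x) - w r x).
    by apply: (L2B (L2Z _ (L2B _ _)) _).1.
  apply: (le_trans (L2normZ_le _ mk)).
  rewrite normc_real gtr0_norm// mulrC EFinM.
  by apply: lee_wpmul2l; rewrite ?lee_fin.
- rewrite L2distC /L2dist /k; under eq_fun do rewrite opprD addrA.
  apply: (le_trans (hderiv r0 h0')); rewrite lee_fin expr2 mulrA ler_wpM2r//.
  move: hd2; rewrite ltr_pdivlMr// => hd2.
  by rewrite (le_trans _ (ltW hd2))// mulrC ler_wpM2l// lerDl.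
Qed.

(* For every e > 0, the distance of T (s - r) (v r) to T s (v 0) grows at rate at
   most e in r. *)
Lemma orbit_unique s : 0 <= s -> aeeq (v s) (T s (v 0)).
Proof.
move=> s0.
have Ts0 : L2 (T s (v 0)) by apply: csg_L2 => //; exact: L2v.
have Tsv r : 0 <= r -> r <= s -> L2 (T (s - r) (v r)).
  by move=> r0 rs; apply: csg_L2; rewrite ?subr_ge0//; exact: L2v.
suff H e : 0 < e -> (L2dist (T (s - s) (v s)) (T s (v 0)) <= (e * s)%:E)%E.
  have E0 : L2dist (T (s - s) (v s)) (T s (v 0)) = 0%E.
    apply/eqP; rewrite eq_le L2norm_ge0 andbT; apply/lee_addgt0Pr => e e0.
    have s1 : 0 < s + 1 by rewrite ltr_wpDl.
    rewrite add0e (le_trans (H _ (divr_gt0 e0 s1)))// lee_fin.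
    by rewrite mulrAC ler_pdivrMr// ler_wpM2l ?lerDl// ltW.
  have Tss := Tsv s s0 (lexx s).
  apply: aeeq_trans (L2norm_eq0 Tss.1 Ts0.1 E0).
  by rewrite subrr; apply: aeeq_sym; apply: csg_0 => //; exact: L2v.
move=> e0.
apply: (@real_induction _ s (fun r => (L2dist (T (s - r) (v r)) (T s (v 0)) <= (e * r)%:E)%E)) => //.
- by rewrite subr0 L2dist_refl mulr0.
(* Since s - r = (s - r') + (r' - r), the contraction T (s - r') reduces the increment to one step
   of length r' - r. *)
- move=> r r0 rs Pr; have [dl d0 dP] := orbit_step r0 e0.
  exists dl => // r' rr' r'd r's.
  have h0 : 0 < r' - r by rewrite subr_gt0.
  have r'0 : 0 <= r' by rewrite (le_trans r0 (ltW rr')).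
  apply: (le_trans (L2dist_triangle (Tsv _ r'0 r's) (Tsv _ r0 (ltW rs)) Ts0)).
  rewrite (_ : e * r' = e * (r' - r) + e * r); last by rewrite mulrBr subrK.
  rewrite EFinD; apply: leeD => //; rewrite L2distC.
  have -> : s - r = (s - r') + (r' - r) by rewrite addrA subrK.
  apply: (le_trans (L2dist_semigroupD _ _ _ _)); rewrite ?subr_ge0 ?(ltW rr')//; try exact: L2v.
  have {2}-> : r' = r + (r' - r) by rewrite addrC subrK.
  by apply: dP => //; rewrite ltrBlDl.
(* Closedness from the left: the orbit point at r - h differs from the one at r by at most the
   distance of T h (v (r - h)) to v r. The Lipschitz bound handles the move from r - h to r, strong
   continuity of T at v r the rest. *)
- move=> r r0 rs Pr.
  have vr := L2v (ltW r0).
  apply/lee_addgt0Pr => n n0; have n2 : 0 < n / 2 by rewrite divr_gt0.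
  move/cvg_L2norm0: (csg_continuous hT vr).
  move=> /(_ (fun h => L2norm_ge0 _))/(_ _ n2)[d1 /= d10 d1P].
  have C1 : 0 < C + 1 by rewrite ltr_wpDl.
  pose h := Num.min (d1 / 2) (Num.min r (n / 2 / (C + 1))).
  have h0 : 0 < h by rewrite !lt_min r0 !divr_gt0.
  have hr : h <= r by rewrite !ge_min lexx orbT.
  have hd : h < d1.
    by rewrite gt_min ltr_pdivrMr// ltr_pMr// ltr1n.
  have hC : C * h <= n / 2.
    have : h <= n / 2 / (C + 1) by rewrite !ge_min lexx !orbT.
    rewrite ler_pdivlMr// => hC; rewrite (le_trans _ hC)// mulrC ler_wpM2l ?lerDl//.
    exact: ltW.
  have rh0 : 0 <= r - h by rewrite subr_ge0.
  have rhs : r - h <= s by rewrite (le_trans _ rs)// gerBl ltW.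
  have Pr' := Pr (r - h) rh0; rewrite gtrBl h0 in Pr'.
  apply: (le_trans (L2dist_triangle (Tsv _ (ltW r0) rs) (Tsv _ rh0 rhs) Ts0)).
  rewrite addeC; apply: leeD.
    by apply: (le_trans (Pr' isT)); rewrite lee_fin ler_wpM2l ?gerBl// ltW.
  have -> : s - (r - h) = (s - r) + h by rewrite opprB addrA addrAC.
  have vrh := L2v rh0.
  rewrite L2distC; apply: (le_trans (L2dist_semigroupD _ _ _ _)); rewrite ?subr_ge0// ?(ltW h0)//.
  apply: (le_trans (L2dist_triangle (csg_L2 hT (ltW h0) vrh) (csg_L2 hT (ltW h0) vr) vr)).
  rewrite [n]splitr EFinD; apply: leeD.
    apply: (le_trans (L2dist_contraction (ltW h0) vrh vr)).
    have := hlip rh0 (ltW h0); rewrite subrK => /le_trans; apply.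
    by rewrite lee_fin.
  by apply: d1P => //=; rewrite sub0r normrN gtr0_norm.
Qed.

End semigroup_orbit.

(** * The semigroup as a Fourier multiplier *)

Section fourier_multiplier_semigroup.
Variable R : realType.
Implicit Types (F G : R -> R[i]) (A C e r h : R) (N : nat).
Local Notation leb := (@lebesgue_measure R).

Lemma L2norm_ift_le F : cintegrable leb F -> (L2norm (ift F) <= L2norm F)%E.
Proof.
move=> iF; have := @L2norm_le_scale R (ift F) F 1 ler01.
rewrite expr1n !mul1e; apply; apply: (le_trans _ (sqL2_ift_le iF)).
rewrite -[leLHS]mul1e lee_wpmul2r ?sqL2_ge0// lee_fin.
by have := pi_ge2 R; lra.
Qed.

Lemma L2norm_le_bounded F G c : 0 <= c -> cmeas F -> cmeas G ->
  (forall y, nc (G y) <= c * nc (F y)) -> (L2norm G <= c%:E * L2norm F)%E.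
Proof.
move=> c0 mF mG GF.
have mcF : cmeas (fun y => c%:C * F y) by apply: cmeasM => //; exact: cmeas_cst.
apply: (@le_trans _ _ (L2norm (fun y => c%:C * F y))).
  by apply: L2norm_le => // y; rewrite normc_real_mul ger0_norm.
by apply: (le_trans (L2normZ_le _ mF)); rewrite normc_real ger0_norm.
Qed.

Lemma expRN_le1 (x : R) : 0 <= x -> expR (- x) <= 1.
Proof. by move=> x0; rewrite -[leRHS]expR0 ler_expR oppr_le0. Qed.

Lemma expRN_taylor1 (x : R) : 0 <= x -> `|expR (- x) - 1| <= x.
Proof.
move=> x0; rewrite distrC ger0_norm ?subr_ge0 ?expRN_le1//.
by have := expR_ge1Dx (- x); lra.
Qed.

(** From e^(-x) <= 1 / (1 + x) and (1 - x + x^2) (1 + x) = 1 + x^3. *)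
Lemma expRN_taylor2 (x : R) : 0 <= x -> `|expR (- x) - 1 + x| <= x ^+ 2.
Proof.
move=> x0; have h1 := expR_ge1Dx (- x); rewrite ger0_norm; last by lra.
suff : expR (- x) <= 1 - x + x ^+ 2 by lra.
have x1 : 0 < 1 + x by rewrite ltr_wpDr.
rewrite expRN; apply: (@le_trans _ _ (1 + x)^-1).
  by rewrite lef_pV2 ?posrE ?expR_gt0// expR_ge1Dx.
rewrite -div1r ler_pdivrMr//.
have -> : (1 - x + x ^+ 2) * (1 + x) = 1 + x ^+ 3 by ring.
by rewrite lerDl exprn_ge0.
Qed.

Variables (N : nat) (A : R) (F : R -> R[i]).
Hypotheses (A0 : 0 <= A) (F2 : L2 F) (FA : forall y, A < `|y| -> F y = 0).

Definition multiplier (k : R -> R) (y : R) : R[i] := (k y)%:C * F y.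

Lemma cmeas_multiplier k : measurable_fun setT k -> cmeas (multiplier k).
Proof. by move=> mk; apply: cmeasM; [exact: cmeas_real|case: F2]. Qed.

Lemma normc_multiplier k c y : 0 <= c -> (`|y| <= A -> `|k y| <= c) ->
  nc (multiplier k y) <= c * nc (F y).
Proof.
move=> c0 kc; rewrite /multiplier normc_real_mul; have [yA|yA] := leP `|y| A.
  by rewrite ler_wpM2r ?normc_ge0// kc.
by rewrite FA// Normc.normc0 !mulr0.
Qed.

Lemma L2norm_multiplier (k : R -> R) c : measurable_fun setT k -> 0 <= c ->
  (forall y : R, `|y| <= A -> `|k y| <= c) -> (L2norm (multiplier k) <= c%:E * L2norm F)%E.
Proof.
move=> mk c0 kc; apply: L2norm_le_bounded => //; first by case: F2.
  exact: cmeas_multiplier.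
by move=> y; apply: normc_multiplier => //; exact: kc.
Qed.

Lemma L2_multiplier (k : R -> R) c : measurable_fun setT k -> 0 <= c ->
  (forall y : R, `|y| <= A -> `|k y| <= c) -> L2 (multiplier k).
Proof.
move=> mk c0 kc; split; first exact: cmeas_multiplier.
apply: (le_lt_trans (L2norm_multiplier mk c0 kc)).
by case: F2 => _ f2; rewrite lte_mul_pinfty ?lee_fin.
Qed.

Lemma multiplier_support k y : A < `|y| -> multiplier k y = 0.
Proof. by move=> yA; rewrite /multiplier FA// mulr0. Qed.

(** The symbols of exp(- r B^N) and of B^N exp(- r B^N). Where F lives they are bounded by 1 and
    A^N, which keeps every remainder below uniform in r. *)
Let ek r (y : R) : R := expR (- (r * `|y| ^+ N)).
Let hk r (y : R) : R := `|y| ^+ N * ek r y.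

Let mNy : measurable_fun setT (fun y : R => `|y| ^+ N).
Proof. by apply: measurable_funX; exact: normr_measurable. Qed.

Let mek r : measurable_fun setT (ek r).
Proof.
apply: measurableT_comp => //; apply: measurableT_comp => //.
by apply: measurable_funM; [exact: measurable_cst|exact: mNy].
Qed.

Let mhk r : measurable_fun setT (hk r).
Proof. exact: (measurable_funM mNy (mek r)). Qed.

Let yN (y : R) : `|y| <= A -> `|y| ^+ N <= A ^+ N.
Proof. by move=> yA; rewrite lerXn2r// nnegrE. Qed.

Let ek_le r y : 0 <= r -> `|ek r y| <= 1.
Proof.
move=> r0; rewrite ger0_norm ?expR_ge0// expRN_le1// mulr_ge0// exprn_ge0//.
Qed.

Let hk_le r y : 0 <= r -> `|y| <= A -> `|hk r y| <= A ^+ N.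
Proof.
move=> r0 yA; rewrite normrM (ger0_norm (exprn_ge0 _ _))// -[leRHS]mulr1.
by rewrite ler_pM// ?exprn_ge0// ?ek_le// yN.
Qed.

Let AN0 : 0 <= A ^+ N. Proof. exact: exprn_ge0. Qed.

Let L2e r : 0 <= r -> L2 (multiplier (ek r)).
Proof. by move=> r0; apply: (L2_multiplier (mek r) ler01) => y _; exact: ek_le. Qed.

Let L2h r : 0 <= r -> L2 (multiplier (hk r)).
Proof. by move=> r0; apply: (L2_multiplier (mhk r) AN0) => y; exact: hk_le. Qed.

Let ie r : 0 <= r -> cintegrable leb (multiplier (ek r)).
Proof. by move=> r0; apply: (L2_cintegrable (L2e r0)) => y; exact: multiplier_support. Qed.

Let ih r : 0 <= r -> cintegrable leb (multiplier (hk r)).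
Proof. by move=> r0; apply: (L2_cintegrable (L2h r0)) => y; exact: multiplier_support. Qed.

Let mulE : forall r y, multiplier (hk r) y = (`|y| ^+ N)%:C * multiplier (ek r) y.
Proof. by move=> r y; rewrite /multiplier mulrA -rmorphM. Qed.

Lemma BN_graph_multiplier r : 0 <= r ->
  BN_graph N (ift (multiplier (ek r))) (ift (multiplier (hk r))).
Proof.
move=> r0; exists (multiplier (ek r)); split.
- by apply: (is_fourier_ift (L2e r0)) => y; exact: multiplier_support.
- have /L2P[_] := L2h r0; congr (_ < _)%E; apply: eq_integral => y _.
  rewrite mulE normc_real_mul exprMn real_normK ?num_real//.
  by rewrite -exprM mulnC exprM real_normK ?num_real// -exprM.
- have := is_fourier_ift (L2h r0) (A := A) (fun y => @multiplier_support (hk r) y).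
  by congr (is_fourier _ _); apply/funext => y; exact: mulE.
Qed.

Variable T : R -> (R -> R[i]) -> (R -> R[i]).
Hypothesis hT : generated_by_opp_BN N T.

Lemma semigroup_multiplier s : 0 <= s ->
  aeeq (ift (multiplier (ek s))) (T s (ift F)).
Proof.
move=> s0; have [csT genT] := hT.
pose c := fine (L2norm F).
have cE : L2norm F = c%:E.
  by rewrite /c fineK// ge0_fin_numE ?L2norm_ge0//; case: F2.
have c0 : 0 <= c by rewrite -lee_fin -cE L2norm_ge0.
(* One constant for two hypotheses of [orbit_unique]: the Lipschitz bound uses A^N c and the
   quadratic remainder (A^N)^2 c. *)
pose C := (A ^+ N + (A ^+ N) ^+ 2) * c.
have C0 : 0 <= C by rewrite mulr_ge0// addr_ge0// exprn_ge0.
have -> : ift F = ift (multiplier (ek 0)).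
  congr ift; apply/funext => y; rewrite /multiplier /ek mul0r oppr0 expR0.
  by rewrite mul1r.
apply: (@orbit_unique _ _ csT (fun r => ift (multiplier (ek r)))
  (fun r x => - ift (multiplier (hk r)) x) C) => //.
- move=> r r0; apply/genT.
  have := BN_graph_multiplier r0; congr (BN_graph _ _ _).
  by apply/funext => y; rewrite opprK.
- move=> r h r0 h0; have rh0 : 0 <= r + h by rewrite addr_ge0.
  (* The symbol of the first-order remainder of the curve; it factors as e^(- r theta) (e^(- h
     theta) - 1 + h theta) with theta = |y|^N, and the last factor is at most (h theta)^2. *)
  pose k (y : R) := ek (r + h) y - ek r y - (- h) * hk r y.
  have mk : measurable_fun setT k.
    apply: measurable_funB; first exact: (measurable_funB (mek _) (mek _)).
    by apply: measurable_funM; [exact: measurable_cst|exact: mhk].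
  have kb y : `|y| <= A -> `|k y| <= (A ^+ N) ^+ 2 * h ^+ 2.
    move=> yA; have -> : k y = ek r y * (expR (- (h * `|y| ^+ N)) - 1 + h * `|y| ^+ N).
      by rewrite /k /hk /ek mulrDl opprD expRD; ring.
    rewrite normrM -[leRHS]mul1r ler_pM// ?ek_le//.
    rewrite (le_trans (expRN_taylor2 _)) ?mulr_ge0 ?exprn_ge0//.
    rewrite exprMn mulrC ler_wpM2r ?sqr_ge0// lerXn2r ?nnegrE// ?exprn_ge0//.
    exact: yN.
  rewrite (_ : (fun x => _) = ift (multiplier k)); last first.
    apply/funext => x.
    have -> (z : R[i]) : h%:C * - z = (- h)%:C * z by rewrite rmorphN mulrN mulNr.
    rewrite -(iftZ _ _ (ih r0)) -(iftB _ (ie rh0) (ie r0)).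
    rewrite -(iftB _ (cintegrableB (ie rh0) (ie r0)) (cintegrableZ _ (ih r0))).
    congr (ift _ x); apply/funext => y; rewrite /multiplier.
    have -> : (k y)%:C = (ek (r + h) y)%:C - (ek r y)%:C - (- h)%:C * (hk r y)%:C.
      by rewrite -rmorphM -!rmorphB.
    by rewrite !mulrBl mulrA.
  have kc : 0 <= (A ^+ N) ^+ 2 * h ^+ 2 by rewrite mulr_ge0 ?sqr_ge0.
  have k2 := L2_multiplier mk kc kb.
  have ik : cintegrable leb (multiplier k).
    by apply: (L2_cintegrable k2) => y; exact: multiplier_support.
  apply: (le_trans (L2norm_ift_le ik)); apply: (le_trans (L2norm_multiplier mk kc kb)).
  rewrite cE -EFinM lee_fin /C [leRHS]mulrAC ler_wpM2r// ler_wpM2r ?sqr_ge0//.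
  by rewrite lerDr.
- move=> r h r0 h0; have rh0 : 0 <= r + h by rewrite addr_ge0.
  pose k (y : R) := ek r y - ek (r + h) y.
  have mk : measurable_fun setT k := measurable_funB (mek _) (mek _).
  have kb y : `|y| <= A -> `|k y| <= A ^+ N * h.
    move=> yA; have -> : k y = ek r y * (1 - expR (- (h * `|y| ^+ N))).
      by rewrite /k /hk /ek mulrDl opprD expRD; ring.
    rewrite normrM -[leRHS]mul1r ler_pM// ?ek_le// distrC.
    rewrite (le_trans (expRN_taylor1 _)) ?mulr_ge0 ?exprn_ge0//.
    by rewrite mulrC ler_wpM2r// yN.
  rewrite /L2dist (_ : (fun x => _) = ift (multiplier k)); last first.
    apply/funext => x; rewrite -(iftB _ (ie r0) (ie rh0)).
    by congr (ift _ x); apply/funext => y; rewrite /multiplier -mulrBl -rmorphB.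
  have kc : 0 <= A ^+ N * h by rewrite mulr_ge0.
  have k2 := L2_multiplier mk kc kb.
  have ik : cintegrable leb (multiplier k).
    by apply: (L2_cintegrable k2) => y; exact: multiplier_support.
  apply: (le_trans (L2norm_ift_le ik)); apply: (le_trans (L2norm_multiplier mk kc kb)).
  rewrite cE -EFinM lee_fin /C [leRHS]mulrAC ler_wpM2r// ler_wpM2r//.
  by rewrite lerDl sqr_ge0.
Qed.

End fourier_multiplier_semigroup.

(** * Independence *)

Section integral_weight.
Context d1 d2 (T1 : measurableType d1) (T2 : measurableType d2) (R : realType).
Variables (mu : {measure set T1 -> \bar R}) (nu : {measure set T2 -> \bar R}).
Variables (h : T1 -> R) (Y : T1 -> T2).
Hypotheses (mh : measurable_fun setT h) (h0 : forall x, 0 <= h x).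
Hypothesis mY : measurable_fun setT Y.
Hypothesis hY : forall B, measurable B -> (\int[mu]_(x in Y @^-1` B) (h x)%:E = nu B)%E.

Import HBNNSimple.

(** The hypothesis says that nu is the image under Y of the measure with density h, and simple
    functions extend it from sets to integrands. One statement thus covers independence (h an
    indicator), products of independent variables (h the product of the other factors) and the law
    of a jump (Y the identity). *)
Lemma integral_weight (g : T2 -> \bar R) : measurable_fun setT g ->
  (forall y, 0 <= g y)%E ->
  (\int[mu]_x ((h x)%:E * g (Y x)) = \int[nu]_y g y)%E.
Proof.
move=> mg g0; pose g_ := nnsfun_approx measurableT mg.
have gE y : (g_ n y)%:E @[n --> \oo] --> g y by apply: cvg_nnsfun_approx.
have ndg x m n : (m <= n)%N -> ((g_ m x)%:E <= (g_ n x)%:E)%E.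
  by move=> mn; rewrite lee_fin; exact/lefP/nd_nnsfun_approx.
have mgY n : measurable_fun setT (fun x => (g_ n (Y x))%:E).
  by apply/measurable_EFinP; exact: measurableT_comp.
have mhE : measurable_fun setT (EFin \o h) by exact/measurable_EFinP.
have mpre (B : set T2) : measurable B -> measurable (Y @^-1` B).
  by move=> mB; rewrite -[X in measurable X]setTI; exact: mY.
transitivity (limn (fun n => \int[nu]_y (g_ n y)%:E)%E); last first.
  rewrite -monotone_convergence//.
  - by apply: eq_integral => y _; apply/cvg_lim => //; exact: gE.
  - by move=> n; exact/measurable_EFinP.
  - by move=> n y _; rewrite lee_fin.
  - by move=> y _ m n; exact: ndg.
transitivity (\int[mu]_x limn (fun n => (h x)%:E * (g_ n (Y x))%:E))%E.
  apply: eq_integral => x _; apply/esym/cvg_lim => //.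
  by apply: cvgeZl => //; exact: gE.
rewrite monotone_convergence//.
- congr (limn _); apply/funext => n.
  transitivity (\int[mu]_x \sum_(k \in range (g_ n))
      (k%:E * ((h x)%:E * (\1_(Y @^-1` (g_ n @^-1` [set k])) x)%:E)))%E.
    apply: eq_integral => x _; rewrite fimfunE -fsumEFin// ge0_mule_fsumr//.
    by apply: eq_fsbigr => k _; rewrite EFinM muleCA.
    by move=> k; exact: nnfun_muleindic_ge0.
  rewrite ge0_integral_fsum//; last 2 first.
  - move=> k; apply: measurable_funeM; apply: emeasurable_funM => //.
    by apply/measurable_EFinP; apply: measurable_indic; exact: mpre.
  - move=> k x _; rewrite muleCA mule_ge0 ?lee_fin//.
    exact: (nnfun_muleindic_ge0 (g_ n) k (Y x)).
  rewrite integral_nnsfun// patch_setT sintegralE; apply: eq_fsbigr => k /set_mem[y _ <-].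
  rewrite ge0_integralZl ?lee_fin//.
  + rewrite -hY// [in RHS]integral_mkcond; congr (_ * _)%E; apply: eq_integral => x _.
    by rewrite patchE indicE; case: ifP; rewrite ?mule1 ?mule0.
  + apply: emeasurable_funM => //.
    by apply/measurable_EFinP; apply: measurable_indic; exact: mpre.
  + by move=> x _; rewrite mule_ge0 ?lee_fin.
- by move=> n; exact: emeasurable_funM.
- by move=> n x _; rewrite mule_ge0 ?lee_fin.
- by move=> x _ m n mn; apply: lee_wpmul2l; [rewrite lee_fin|exact: ndg].
Qed.

End integral_weight.

Section independence.
Context d (T : measurableType d) (R : realType) (P : probability T R).
Context d' (T' : measurableType d').
Variables (A : set T) (W : T -> T').
Hypotheses (mA : measurable A) (mW : measurable_fun setT W).
Hypothesis indep : forall B, measurable B -> P (A `&` W @^-1` B) = (P A * P (W @^-1` B))%E.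

Lemma indep_ge0_integral (g : T' -> \bar R) : measurable_fun setT g ->
  (forall y, 0 <= g y)%E ->
  (\int[P]_x ((\1_A x)%:E * g (W x)) = P A * \int[P]_x g (W x))%E.
Proof.
move=> mg g0; have PA0 : 0 <= fine (P A) by rewrite fine_ge0.
have PAE : (fine (P A))%:E = P A by rewrite fineK// fin_num_measure.
rewrite (@integral_weight _ _ _ _ _ P (mscale (NngNum PA0) (pushforward P W)) (\1_A) W)//; last first.
- move=> B mB; rewrite integral_indic//; last by rewrite -[X in measurable X]setTI; exact: mW.
  by apply: (etrans (indep mB)); rewrite -{1}PAE.
by rewrite ge0_integral_mscale//= PAE ge0_integral_pushforward.
Qed.

Lemma indep_integral (g : T' -> R) : measurable_fun setT g ->
  P.-integrable setT (EFin \o (g \o W)) ->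
  \int[P]_x (\1_A x * g (W x)) = fine (P A) * \int[P]_x g (W x).
Proof.
move=> mg ig; have PAE : (fine (P A))%:E = P A by rewrite fineK// fin_num_measure.
have mge : measurable_fun setT (EFin \o g) by exact/measurable_EFinP.
rewrite /Rintegral integralE [in RHS]integralE.
have h0 x : (0 <= (\1_A x)%:E :> \bar R)%E by rewrite lee_fin.
have ep : ((fun x => (\1_A x * g (W x))%:E)^\+ = (fun x => (\1_A x)%:E * (EFin \o g)^\+ (W x)))%E.
  apply/funext => x; rewrite !funeposE indicE; case: (_ \in _) => /=.
    by rewrite mul1r mul1e.
  by rewrite mul0r mul0e maxxx.
have en : ((fun x => (\1_A x * g (W x))%:E)^\- = (fun x => (\1_A x)%:E * (EFin \o g)^\- (W x)))%E.
  apply/funext => x; rewrite !funenegE indicE; case: (_ \in _) => /=.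
    by rewrite mul1r mul1e.
  by rewrite mul0r oppr0 mul0e maxxx.
rewrite ep en !indep_ge0_integral//; last 2 first.
- exact: measurable_funeneg.
- exact: measurable_funepos.
have fp := integrable_pos_fin_num measurableT ig.
have fn := integrable_neg_fin_num measurableT ig.
have E1 : (\int[P]_x (EFin \o g)^\+ (W x) = \int[P]_x (EFin \o (g \o W))^\+ x)%E.
  by apply: eq_integral => x _; rewrite !funeposE.
have E2 : (\int[P]_x (EFin \o g)^\- (W x) = \int[P]_x (EFin \o (g \o W))^\- x)%E.
  by apply: eq_integral => x _; rewrite !funenegE.
rewrite E1 E2; set p := (\int[P]_x _)%E in fp *; set n := (\int[P]_x _)%E in fn *.
change (fine (P A * p - P A * n) = fine (P A) * fine (p - n)).
by rewrite -PAE -(fineK fp) -(fineK fn) /= mulrBr.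
Qed.

Lemma indep_cintegral (g : T' -> R[i]) : cmeas g ->
  cintegrable P (g \o W) ->
  cintegral P (fun x => (\1_A x)%:C * g (W x)) =
    (fine (P A))%:C * cintegral P (fun x => g (W x)).
Proof.
move=> /cmeasP[m1 m2] [i1 i2]; rewrite real_mulE /cintegral; congr (_ +i* _).
- apply: (etrans _ (indep_integral m1 i1)).
  by apply: eq_Rintegral => x _; rewrite real_mulE.
- apply: (etrans _ (indep_integral m2 i2)).
  by apply: eq_Rintegral => x _; rewrite real_mulE.
Qed.

End independence.

Lemma indicIE (T : Type) (R : pzRingType) (A B : set T) (x : T) :
  \1_(A `&` B) x = \1_A x * \1_B x :> R.
Proof. by rewrite indicI. Qed.

Section finite_combinations.
Context d (T : measurableType d) (R : realType) (mu : {measure set T -> \bar R}).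

Lemma cintegral_indic (A : set T) : measurable A ->
  cintegral mu (fun x => (\1_A x)%:C) = (fine (mu A))%:C.
Proof. by move=> mA; rewrite cintegral_real /Rintegral integral_indic// setIT. Qed.

Lemma cintegral_sum I (s : seq I) (f : I -> T -> R[i]) : (forall i, cintegrable mu (f i)) ->
  cintegral mu (fun x => \sum_(i <- s) f i x) = \sum_(i <- s) cintegral mu (f i).
Proof.
move=> fi; suff [//] : cintegral mu (fun x => \sum_(i <- s) f i x) = \sum_(i <- s) cintegral mu (f i)
    /\ cintegrable mu (fun x => \sum_(i <- s) f i x).
elim: s => [|i s [IH1 IH2]].
  rewrite big_nil; split.
    under eq_cintegral do rewrite big_nil.
    by rewrite (cintegral_real mu (cst 0)) /Rintegral integral0.
  under eq_fun do rewrite big_nil.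
  by split; exact: integrable0.
split; last by under eq_fun do rewrite big_cons; exact: cintegrableD.
under eq_cintegral do rewrite big_cons.
by rewrite cintegralD// big_cons IH1.
Qed.

Lemma cmeas_prod (f : nat -> T -> R[i]) k : (forall j, cmeas (f j)) ->
  cmeas (fun x => \prod_(j < k) f j x).
Proof.
move=> mf; elim: k => [|k IH].
  by under eq_fun do rewrite big_ord0; exact: cmeas_cst.
by under eq_fun do rewrite big_ord_recr/=; exact: cmeasM.
Qed.

Lemma cmeas_sum (f : nat -> T -> R[i]) k : (forall j, cmeas (f j)) ->
  cmeas (fun x => \sum_(j < k) f j x).
Proof.
move=> mf; elim: k => [|k IH].
  by under eq_fun do rewrite big_ord0; exact: cmeas_cst.
by under eq_fun do rewrite big_ord_recr/=; exact: cmeasD.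
Qed.

(* A substitute for g that is bounded everywhere, and not only almost surely. *)
Definition finite_comb (s : seq T) (g : T -> R[i]) (x : T) : R[i] :=
  \sum_(y <- s) g y * (\1_[set y] x)%:C.

Lemma normc_finite_comb_le s g x : nc (finite_comb s g x) <= \sum_(y <- s) nc (g y).
Proof.
rewrite (le_trans (normc_sum _ _))//; apply: ler_sum => y _.
rewrite mulrC normc_real_mul -[leRHS]mul1r ler_wpM2r ?normc_ge0// indicE.
by case: (_ \in _); rewrite ?normr1 ?normr0.
Qed.

Lemma cmeas_finite_comb d0 (T0 : measurableType d0) (Y : T0 -> T) s g : measurable_fun setT Y ->
  (forall y : T, measurable [set y]) ->
  cmeas (fun x => finite_comb s g (Y x)).
Proof.
move=> mY m1; rewrite /finite_comb; elim: s => [|y s IH].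
  by under eq_fun do rewrite big_nil; exact: cmeas_cst.
under eq_fun do rewrite big_cons.
apply: cmeasD => //; apply: cmeasM; first exact: cmeas_cst.
by apply: cmeas_real; apply: measurableT_comp => //; exact: measurable_indic.
Qed.

Lemma finite_combE (s : seq T) (g : T -> R[i]) (x : T) : uniq s -> x \in s ->
  finite_comb s g x = g x.
Proof.
move=> us xs; rewrite /finite_comb (big_rem x)//= indicE mem_set// mulr1.
rewrite big_seq big1 ?addr0// => y; rewrite mem_rem_uniq// inE => /andP[yx _].
rewrite indicE memNset ?mulr0//= => xy; by move: yx; rewrite xy eqxx.
Qed.

End finite_combinations.

Lemma normc_prod (R : realType) k (f : 'I_k -> R[i]) :
  nc (\prod_(j < k) f j) = \prod_(j < k) nc (f j).
Proof.
elim/big_rec2: _ => [|i x y _ <-]; first exact: Normc.normc1.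
exact: Normc.normcM.
Qed.

Lemma bounded_cintegrable d (T : measurableType d) (R : realType) (P : probability T R)
  (f : T -> R[i]) (C : R) : cmeas f ->
  (forall x, nc (f x) <= C) -> cintegrable P f.
Proof.
move=> mf fC; apply: (@le_cintegrable _ _ _ _ _ (cst C)) => //.
exact: finite_measure_integrable_cst.
Qed.

Section independent_products.
Context d (T : measurableType d) (R : realType) (P : probability T R).
Context (I : choiceType) (G : I -> set (set T)).
Hypothesis indepG : mutually_independent P G.
Hypothesis measG : forall i A, G i A -> measurable A.

(** Adjoins one event at a fresh index. The inductions below absorb the variables Y_k one at a time
    into the finite family to which independence refers. *)
Definition extend_family (A : I -> set T) (i0 : I) (E : set T) (i : I) : set T :=
  if i == i0 then E else A i.

Lemma bigcap_extend_family (J : {fset I}) A i0 E : i0 \notin J ->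
  \bigcap_(i in [set` (i0 |` J)%fset]) extend_family A i0 E i =
  E `&` \bigcap_(i in [set` J]) A i.
Proof.
move=> i0J; rewrite /extend_family; apply/seteqP; split=> [x h|x [Ex h] i /=].
  split; first by have := h i0; rewrite /= fset1U1 eqxx; apply.
  move=> i /= iJ; have := h i; rewrite /= fset1Ur// => /(_ isT).
  by case: eqP => // ii; move: i0J; rewrite -ii iJ.
by rewrite in_fset1U; case: eqP => //= _; exact: h.
Qed.

Lemma prod_extend_family (J : {fset I}) (p : set T -> R) A i0 E : i0 \notin J ->
  \prod_(i <- (i0 |` J)%fset) p (extend_family A i0 E i) =
  p E * \prod_(i <- J) p (A i).
Proof.
move=> i0J; rewrite big_fsetU1//= /extend_family eqxx; congr (_ * _).
rewrite big_seq [RHS]big_seq; apply: eq_bigr => i iJ.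
by case: eqP => // ii; move: i0J; rewrite -ii iJ.
Qed.

Lemma extend_family_in (J : {fset I}) A i0 E : G i0 E ->
  (forall i, i \in J -> G i (A i)) ->
  forall i, i \in (i0 |` J)%fset -> G i (extend_family A i0 E i).
Proof.
move=> GE GA i; rewrite in_fset1U /extend_family.
by case: eqP => [->|_ /= iJ]//; exact: GA.
Qed.

Lemma measurable_bigcap_fset (J : {fset I}) A : (forall i, i \in J -> G i (A i)) ->
  measurable (\bigcap_(i in [set` J]) A i).
Proof.
move=> GA; apply: fin_bigcap_measurable => // i iJ.
by apply: measG; exact: GA.
Qed.

Lemma probability_bigcap (J : {fset I}) A : (forall i, i \in J -> G i (A i)) ->
  P (\bigcap_(i in [set` J]) A i) = (\prod_(i <- J) fine (P (A i)))%:E.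
Proof.
move=> GA; rewrite indepG// big_seq [in RHS]big_seq.
elim/big_rec2: _ => // i p q iJ ->; rewrite EFinM fineK//.
by rewrite fin_num_measure//; apply: measG; exact: GA.
Qed.

Context d' (T' : measurableType d') (Y : nat -> T -> T') (iota : nat -> I).
Hypothesis iota_inj : injective iota.
Hypothesis mY : forall j, measurable_fun setT (Y j).
Hypothesis GY : forall j B, measurable B -> G (iota j) (Y j @^-1` B).

(** Induction on k for all families J at once. To split off the last factor, the weight formed by
    the others must be integrated over the event that Y_k lies in B, and this is the induction
    hypothesis for J with that event adjoined. *)
Lemma indep_prod_integral (h : T' -> R) (L : R) k (J : {fset I}) A :
  measurable_fun setT h -> (forall y, 0 <= h y) -> 0 <= L ->
  (forall j, \int[P]_x (h (Y j x))%:E = L%:E)%E ->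
  (forall i, i \in J -> G i (A i)) -> (forall j, (j < k)%N -> iota j \notin J) ->
  (\int[P]_x (\1_(\bigcap_(i in [set` J]) A i) x * \prod_(j < k) h (Y j x))%:E =
    (\prod_(i <- J) fine (P (A i)) * L ^+ k)%:E)%E.
Proof.
move=> mh h0 L0 hL; elim: k J A => [|k IH] J A GA iJ.
  under eq_integral do rewrite big_ord0 mulr1.
  rewrite integral_indic//; last exact: measurable_bigcap_fset.
  by rewrite setIT expr0 mulr1; exact: probability_bigcap.
pose H x : R := \1_(\bigcap_(i in [set` J]) A i) x * \prod_(j < k) h (Y j x).
have mbig := measurable_bigcap_fset GA.
have mhY j : measurable_fun setT (fun x => h (Y j x)) by exact: measurableT_comp.
have mH : measurable_fun setT H.
  apply: measurable_funM; first exact: measurable_indic.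
  by apply: measurable_prod => j _; exact: mhY.
have H0 x : 0 <= H x by rewrite mulr_ge0 ?prodr_ge0.
pose c := \prod_(i <- J) fine (P (A i)) * L ^+ k.
have c0 : 0 <= c by rewrite mulr_ge0 ?exprn_ge0// prodr_ge0// => i _; rewrite fine_ge0.
have ikJ : iota k \notin J by exact: iJ.
transitivity (\int[P]_x ((H x)%:E * (h (Y k x))%:E))%E.
  by apply: eq_integral => x _; rewrite big_ord_recr/= mulrA EFinM.
rewrite (@integral_weight _ _ _ _ _ P (mscale (NngNum c0) (pushforward P (Y k))) H (Y k) mH H0
  (mY k) _ (fun y => (h y)%:E))//.
- rewrite ge0_integral_mscale//=; last by move=> x _; rewrite lee_fin.
    rewrite ge0_integral_pushforward//=; last by move=> y _; rewrite lee_fin.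
      by rewrite hL exprSr mulrA EFinM.
    exact/measurable_EFinP.
  exact/measurable_EFinP.
- move=> B mB; have GB := extend_family_in (GY k mB) GA.
  transitivity (\int[P]_x (\1_(\bigcap_(i in [set` (iota k |` J)%fset])
      extend_family A (iota k) (Y k @^-1` B) i) x * \prod_(j < k) h (Y j x))%:E)%E.
    rewrite integral_mkcond; apply: eq_integral => x _.
    rewrite bigcap_extend_family// indicIE patchE [\1_(Y k @^-1` B) x]indicE.
    by case: ifP => _; rewrite ?mul1r// !mul0r.
  rewrite IH//; last first.
    move=> j jk; rewrite in_fset1U negb_or iJ ?andbT; last by rewrite ltnS ltnW.
    by apply/eqP => /iota_inj jk'; rewrite jk' ltnn in jk.
  rewrite (prod_extend_family (fun A => fine (P A)))// -mulrA mulrC EFinM fineK//.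
  by rewrite fin_num_measure//; apply: measG (GY k mB).
- exact/measurable_EFinP.
Qed.

(** Complex factors cannot serve as weights. As finite combinations of indicators they can be
    expanded instead, and each indicator of the last factor becomes an event adjoined to J. *)
Lemma indep_prod_cintegral (s : seq T') (g : T' -> R[i]) (p : T' -> R) k (J : {fset I}) A :
  (forall y : T', measurable [set y]) ->
  (forall j y, fine (P (Y j @^-1` [set y])) = p y) ->
  (forall i, i \in J -> G i (A i)) -> (forall j, (j < k)%N -> iota j \notin J) ->
  cintegral P (fun x => (\1_(\bigcap_(i in [set` J]) A i) x)%:C *
      \prod_(j < k) finite_comb s g (Y j x)) =
    (\prod_(i <- J) fine (P (A i)))%:C * (\sum_(y <- s) g y * (p y)%:C) ^+ k.
Proof.
move=> m1 hp; elim: k J A => [|k IH] J A GA iJ.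
  rewrite expr0 mulr1; under eq_cintegral do rewrite big_ord0 mulr1.
  rewrite cintegral_indic; last exact: measurable_bigcap_fset.
  by congr (_ %:C); have := congr1 fine (probability_bigcap GA).
pose H x : R[i] := (\1_(\bigcap_(i in [set` J]) A i) x)%:C *
   \prod_(j < k) finite_comb s g (Y j x).
have mbig := measurable_bigcap_fset GA.
have ikJ : iota k \notin J by exact: iJ.
have GB y := extend_family_in (GY k (m1 y)) GA.
pose Hy y x : R[i] := (\1_(\bigcap_(i in [set` (iota k |` J)%fset])
      extend_family A (iota k) (Y k @^-1` [set y]) i) x)%:C *
      \prod_(j < k) finite_comb s g (Y j x).
have iHy y : cintegrable P (Hy y).
  apply: (@bounded_cintegrable _ _ _ _ _ ((\sum_(y <- s) nc (g y)) ^+ k)).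
    apply: cmeasM; first by apply: cmeas_real; apply: measurable_indic; exact: measurable_bigcap_fset (GB y).
    apply: (@cmeas_prod _ _ _ (fun j x => finite_comb s g (Y j x))) => j.
    exact: cmeas_finite_comb.
  move=> x; rewrite Normc.normcM normc_real normc_prod -[leRHS]mul1r.
  rewrite ler_pM ?prodr_ge0//; first by move=> j _; exact: normc_ge0.
    by rewrite indicE; case: (_ \in _); rewrite ?normr1 ?normr0.
  rewrite -[k in leRHS]card_ord -prodr_const; apply: ler_prod => j _.
  by rewrite normc_ge0 normc_finite_comb_le.
transitivity (cintegral P (fun x => \sum_(y <- s) g y * Hy y x)).
  apply: eq_cintegral => x; rewrite big_ord_recr/= mulrA {2}/finite_comb mulr_sumr.
  apply: eq_bigr => y _; rewrite mulrCA; congr (_ * _).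
  rewrite /Hy bigcap_extend_family// indicIE mulrAC; congr (_ * _).
  by rewrite mulrC -rmorphM.
rewrite cintegral_sum; last by move=> y; exact: cintegrableZ.
rewrite exprSr mulrA mulr_sumr; apply: eq_bigr => y _.
rewrite cintegralZ// (IH _ _ (GB y)); last first.
  move=> j jk; rewrite in_fset1U negb_or iJ ?andbT; last by rewrite ltnS ltnW.
  by apply/eqP => /iota_inj jk'; rewrite jk' ltnn in jk.
rewrite (prod_extend_family (fun A => fine (P A)))// hp rmorphM.
ring.
Qed.

End independent_products.

Section nat_mixtures.
Context d (T : measurableType d) (R : realType).

Lemma measurable_nat_comp d' (T' : measurableType d') (tau : T -> nat) (F : nat -> T -> T') :
  (forall k, measurable (tau @^-1` [set k])) -> (forall k, measurable_fun setT (F k)) ->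
  measurable_fun setT (fun x => F (tau x) x).
Proof.
move=> mt mF _ B mB; rewrite setTI.
rewrite (_ : _ @^-1` B = \bigcup_k (tau @^-1` [set k] `&` F k @^-1` B)).
  apply: bigcupT_measurable => k; apply: measurableI => //.
  by rewrite -[X in measurable X]setTI; exact: mF.
apply/seteqP; split=> [x /= Bx|x [k _ [/= <-]]//].
by exists (tau x).
Qed.

Variables (mu : {measure set T -> \bar R}) (tau : T -> nat).
Hypothesis mtau : forall k, measurable (tau @^-1` [set k]).

Lemma bigcup_preimage_nat : \bigcup_k tau @^-1` [set k] = setT.
Proof. by apply/seteqP; split => // x _; exists (tau x). Qed.

Lemma trivIset_preimage_nat : trivIset setT (fun k => tau @^-1` [set k]).
Proof. by move=> i j _ _ [x [/= <- <-]]. Qed.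

Lemma ge0_integral_nat (f : T -> \bar R) : measurable_fun setT f -> (forall x, 0 <= f x)%E ->
  (\int[mu]_x f x = \sum_(k <oo) \int[mu]_(x in tau @^-1` [set k]) f x)%E.
Proof.
move=> mf f0; rewrite -bigcup_preimage_nat ge0_integral_bigcup//.
- by rewrite bigcup_preimage_nat.
- exact: trivIset_preimage_nat.
Qed.

Lemma eq_integral_nat (f g : T -> R) :
  mu.-integrable setT (EFin \o f) -> mu.-integrable setT (EFin \o g) ->
  (forall k, \int[mu]_x (\1_(tau @^-1` [set k]) x * f x) =
             \int[mu]_x (\1_(tau @^-1` [set k]) x * g x)) ->
  \int[mu]_x f x = \int[mu]_x g x.
Proof.
move=> fi gi fg; rewrite /Rintegral -bigcup_preimage_nat.
rewrite !integral_bigcup//; try exact: trivIset_preimage_nat; try by rewrite bigcup_preimage_nat.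
congr fine; apply: eq_eseriesr => k _.
have E h : mu.-integrable setT (EFin \o h) ->
    (\int[mu]_(x in tau @^-1` [set k]) (h x)%:E)%E =
    (\int[mu]_x (\1_(tau @^-1` [set k]) x * h x))%:E.
  move=> hi; rewrite /Rintegral fineK.
    rewrite integral_mkcond; apply: eq_integral => x _; rewrite patchE indicE.
    by case: ifP => _; rewrite ?mul1r ?mul0r.
  have hk := integrableS measurableT (mtau k) (@subsetT _ _) hi.
  have := integrable_fin_num (mtau k) hk; congr (_ \is a fin_num).
  rewrite integral_mkcond; apply: eq_integral => x _; rewrite patchE indicE.
  by case: ifP => _; rewrite ?mul1r ?mul0r.
by have := fg k; rewrite !E// => ->.
Qed.

Lemma eq_cintegral_nat (f g : T -> R[i]) : cintegrable mu f -> cintegrable mu g ->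
  (forall k, cintegral mu (fun x => (\1_(tau @^-1` [set k]) x)%:C * f x) =
             cintegral mu (fun x => (\1_(tau @^-1` [set k]) x)%:C * g x)) ->
  cintegral mu f = cintegral mu g.
Proof.
move=> [f1 f2] [g1 g2] fg; rewrite /cintegral; congr (_ +i* _).
- apply: eq_integral_nat => // k.
  have /(congr1 (@complex.Re _)) E := fg k.
  have F h : \int[mu]_x (\1_(tau @^-1` [set k]) x * Re (h x)) =
      Re (cintegral mu (fun x => (\1_(tau @^-1` [set k]) x)%:C * h x)).
    by apply: eq_Rintegral => x _; rewrite real_mulE.
  by rewrite !F.
- apply: eq_integral_nat => // k.
  have /(congr1 (@complex.Im _)) E := fg k.
  have F h : \int[mu]_x (\1_(tau @^-1` [set k]) x * Im (h x)) =
      Im (cintegral mu (fun x => (\1_(tau @^-1` [set k]) x)%:C * h x)).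
    by apply: eq_Rintegral => x _; rewrite real_mulE.
  by rewrite !F.
Qed.

End nat_mixtures.

Lemma nneseries_expR (R : realType) (r : R) : 0 <= r ->
  (\sum_(k <oo) (r ^+ k / (k`!)%:R)%:E = (expR r)%:E)%E.
Proof.
move=> r0; rewrite expRE -EFin_lim; last first.
  rewrite /pseries (_ : (fun _ => _) = exp_coeff r).
    exact: is_cvg_series_exp_coeff.
  by apply/funext => n; rewrite exp_coeffE.
congr (limn _); apply/funext => n /=; rewrite /pseries /series/= -sumEFin.
by apply: eq_bigr => i _; rewrite mulrC.
Qed.

(** * The subordinator *)

Section subordinator_laplace.
Context d (T : measurableType d) (R : realType) (P : probability T R).
Variables (a s : R) (m : nat) (X : {RV P >-> nat}) (Y : nat -> {RV P >-> R}).
Hypotheses (a01 : 0 < a < 1) (s0 : 0 <= s) (m2 : (2 <= m)%N).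
Hypothesis hXY : subordinator_data a s m X Y.
Local Notation leb := (@lebesgue_measure R).

Let rate := (Gamma (1 - a))^-1 * s * m%:R `^ (2 * a).

Let rate0 : 0 <= rate.
Proof. by rewrite !mulr_ge0 ?invr_ge0 ?powR_ge0// ltW// Gamma_gt0. Qed.

Lemma jump_density_ge0 y : 0 <= jump_density a m y.
Proof.
have [a0 a1] := andP a01; rewrite /jump_density !mulr_ge0 ?powR_ge0//; first exact: ltW.
rewrite invr_ge0 mulr_ge0 ?powR_ge0// subr_ge0 powRN invf_le1 ?powR_gt0 ?ltr0n ?(ltnW m2)//.
by rewrite -[leLHS](powRr0 m%:R) ler_powR ?ler1n ?(ltnW m2)// mulr_ge0// ltW.
Qed.

Lemma measurable_jump_density : measurable_fun setT (jump_density a m).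
Proof.
have H := @jump_integrable R a m (cst 1) m2 (fun y _ => @cst_continuous _ _ (1 : R) y).
have /measurable_EFinP := measurable_int _ H.
by under eq_fun do rewrite mulr1.
Qed.

Lemma ge0_jump_expectation j (g : R -> R) : measurable_fun setT g -> (forall y, 0 <= g y) ->
  (\int[P]_w (g (Y j w))%:E = \int[leb]_y (jump_density a m y * g y)%:E)%E.
Proof.
move=> mg g0; have mge : measurable_fun setT (EFin \o g) by exact/measurable_EFinP.
have H B : measurable B -> (\int[leb]_(y in id @^-1` B) (jump_density a m y)%:E =
    distribution P (Y j) B)%E.
  by move=> mB; rewrite preimage_id /distribution /pushforward (sd_density hXY).
have := @integral_weight _ _ _ _ R leb (distribution P (Y j)) (jump_density a m) id
  measurable_jump_density jump_density_ge0 (@measurable_id _ _ _) H (EFin \o g) mge.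
rewrite ge0_integral_distribution//=.
by move=> <-//; apply: eq_integral.
Qed.

Let G (o : option nat) : set (set T) :=
  if o is Some j then sigma_of (Y j) else sigma_of X.

Let measG o A : G o A -> measurable A.
Proof.
by case: o => [j|] [B mB <-]; rewrite -[X in measurable X]setTI; exact: measurable_funP.
Qed.

Lemma measurable_preimage_X k : measurable (X @^-1` [set k]).
Proof. by rewrite -[X in measurable X]setTI; exact: measurable_funP. Qed.

(** On X = k there are k + 1 factors, so independence gives P(X = k) L^(k+1), and the exponential
    series sums these. *)
Lemma subordinator_mixture (g : R -> R) (L : R) : measurable_fun setT g ->
  (forall y, 0 <= g y) -> 0 <= L ->
  (\int[leb]_y (jump_density a m y * g y)%:E = L%:E)%E ->
  (\int[P]_w (\prod_(0 <= j < (X w).+1) g (Y j w))%:E = (L * expR (rate * (L - 1)))%:E)%E.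
Proof.
move=> mg g0 L0 hL.
have mgY j : measurable_fun setT (fun w => g (Y j w)).
  by apply: measurableT_comp => //; exact: measurable_funP.
have mprod k : measurable_fun setT (fun w => \prod_(0 <= j < k.+1) g (Y j w)).
  by apply: measurable_prod => j _; exact: mgY.
rewrite (@ge0_integral_nat _ _ _ P X measurable_preimage_X); last 2 first.
- apply/measurable_EFinP.
  exact: (@measurable_nat_comp _ _ _ _ X (fun k w => \prod_(0 <= j < k.+1) g (Y j w)) measurable_preimage_X mprod).
- by move=> w; rewrite lee_fin prodr_ge0.
transitivity (\sum_(k <oo) ((expR (- rate) * L)%:E * ((rate * L) ^+ k / (k`!)%:R)%:E))%E; last first.
  rewrite nneseriesZl; last first.
    by move=> k _; rewrite lee_fin divr_ge0 ?exprn_ge0// mulr_ge0.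
  rewrite (nneseries_expR (mulr_ge0 rate0 L0)) -EFinM; congr (_%:E).
  by rewrite mulrAC -expRD mulrC; congr (_ * expR _); ring.
apply: eq_eseriesr => k _.
have GA o : o \in [fset None]%fset -> G o (X @^-1` [set k]).
  by rewrite inE => /eqP ->; exists [set k].
have := @indep_prod_integral _ T R P _ G (sd_independent hXY) measG _ _ Y Some
  (@Some_inj _) (fun j => @measurable_funP _ _ _ _ _ (Y j))
  (fun j B mB => ex_intro2 _ _ B mB erefl) g L k.+1 [fset None]%fset
  (fun=> X @^-1` [set k]) mg g0 L0 _ GA _.
rewrite big_seq_fset1 /= (sd_poisson hXY) -/rate /=.
rewrite (_ : \bigcap_(i in [set` [fset None]%fset]) _ = X @^-1` [set k]); last first.
  apply/seteqP; split => [w h|w h i _]//; by have := h None; rewrite /= inE eqxx; apply.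
move=> H; rewrite -EFinM (_ : (expR _ * L) * _ = rate ^+ k / (k`!)%:R * expR (- rate) * L ^+ k.+1); last first.
  by rewrite exprMn exprS; ring.
rewrite -H//.
- rewrite integral_mkcond; apply: eq_integral => w _; rewrite patchE indicE.
  case: ifPn => [|_]; last by rewrite mul0r.
  by rewrite inE /= => ->; rewrite mul1r big_mkord.
- by move=> j; rewrite ge0_jump_expectation.
- by move=> j _; rewrite inE.
Qed.

Definition jump_laplace (theta : R) : R :=
  \int[leb]_y (jump_density a m y * expR (- (theta * y / m%:R))).

Lemma continuous_jump_kernel (theta y : R) :
  {for y, continuous (fun y : R => expR (- (theta * y / m%:R)))}.
Proof.
have E : (fun y : R => expR (- (theta * y / m%:R))) = fun y => expR (- (theta / m%:R * y)).
  by apply/funext => x; rewrite mulrAC.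
by rewrite E; exact: continuous_expRN_at.
Qed.

Lemma jump_laplace_ge0 theta : 0 <= jump_laplace theta.
Proof. by apply: Rintegral_ge0 => y _; rewrite mulr_ge0 ?jump_density_ge0 ?expR_ge0. Qed.

Lemma measurable_subordinator : measurable_fun setT (subordinator m X Y).
Proof.
apply: measurable_funM; first exact: measurable_cst.
apply: (@measurable_nat_comp _ _ _ _ X (fun k w => \sum_(0 <= j < k.+1) Y j w)).
  exact: measurable_preimage_X.
by move=> k; apply: measurable_sum => j; exact: measurable_funP.
Qed.

(** The sign of theta is free: the jumps are bounded by m^2, so the same formula also yields the
    exponential moments on which the estimates for the walk depend. *)
Lemma subordinator_laplaceE theta :
  (\int[P]_w (expR (- (theta * subordinator m X Y w)))%:E =
   (jump_laplace theta * expR (rate * (jump_laplace theta - 1)))%:E)%E.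
Proof.
have mk : measurable_fun setT (fun y : R => expR (- (theta * y / m%:R))).
  by apply: continuous_measurable_fun => y; exact: continuous_jump_kernel.
rewrite -(@subordinator_mixture (fun y => expR (- (theta * y / m%:R))))//.
- apply: eq_integral => w _; rewrite /subordinator; congr (_%:E).
  rewrite mulr_sumr mulr_sumr -sumrN expR_sum.
  by apply: eq_bigr => j _; rewrite mulrCA [_^-1 * _]mulrC.
- exact: jump_laplace_ge0.
- rewrite /jump_laplace /Rintegral fineK//.
  have H := @jump_integrable R a m _ m2 (fun y _ => @continuous_jump_kernel theta y).
  exact: (integrable_fin_num measurableT H).
Qed.

Lemma subordinator_ge0 : {ae P, forall w, 0 <= subordinator m X Y w}.
Proof.
have H j : {ae P, forall w, 0 <= Y j w}.
  exists (Y j @^-1` `]-oo, 0[); split.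
  - by rewrite -[X in measurable X]setTI; exact: measurable_funP.
  - transitivity (\int[leb]_(y in `]-oo, 0%R[) (jump_density a m y)%:E)%E.
      by apply: (sd_density hXY); exact: measurable_itv.
    apply: integral0_eq => y; rewrite /= in_itv/= => y0.
    rewrite /jump_density indicE memNset ?mulr0//= in_itv/= => /andP[h _].
    by move: h; apply/negP; rewrite -leNgt (le_trans (ltW y0))// invr_ge0.
  - by move=> w /= /negP; rewrite -ltNge in_itv.
have : {ae P, forall w, forall j, 0 <= Y j w} by exact: ae_foralln.
apply: filterS => w hw; rewrite mulr_ge0 ?invr_ge0// sumr_ge0//.
Qed.

End subordinator_laplace.

Section almost_everywhere_bounds.
Context d (T : measurableType d) (R : realType) (P : probability T R).

Lemma cexpectationE (f : T -> R[i]) : cexpectation P f = cintegral P f.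
Proof. by rewrite /cexpectation unlock. Qed.

Lemma le_ae_cintegrable (f : T -> R[i]) (h : T -> R) : cmeas f ->
  P.-integrable setT (EFin \o h) -> {ae P, forall x, nc (f x) <= h x} -> cintegrable P f.
Proof.
move=> mf ih fh; apply: (cintegrableP mf); apply/integrableP.
have mn : measurable_fun setT (fun x => (nc (f x))%:E).
  by apply/measurable_EFinP; exact: cmeas_normc.
split => //; have /integrableP[mh] := ih; apply: le_lt_trans.
apply: ae_ge0_le_integral => //.
- exact: measurableT_comp.
- exact: measurableT_comp.
- apply: (filterS _ fh) => x fx _ /=.
  by rewrite lee_fin ger0_norm ?normc_ge0// (le_trans fx)// ler_norm.
Qed.

End almost_everywhere_bounds.

Lemma cpairK (R : realType) (z : R[i]) : (cpair z).1 +i* (cpair z).2 = z.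
Proof. by case: z. Qed.

Lemma cpair_inj (R : realType) : injective (@cpair R).
Proof. by move=> z w /(congr1 (fun p => p.1 +i* p.2)); rewrite !cpairK. Qed.

(** * The stopped walk *)

Section root_law.
Context d (T : measurableType d) (R : realType) (P : probability T R).
Variables (K : nat) (b : R[i]) (xi : nat -> T -> R[i]).
Hypotheses (K0 : (0 < K)%N) (hxi : root_steps P K b xi).

Let root k : R[i] := b * cexp ('i%C * (2 * pi * k%:R / K%:R)%:C).
(** Pairs rather than complex numbers, since events live in R * R; duplicates are removed for
    [finite_combE], as all roots coincide if b = 0. *)
Let roots : seq (R * R) := undup [seq cpair (root k) | k <- iota 0 K].

Definition root_average (c : R[i]) : R[i] := K%:R^-1 * \sum_(k < K) cexp (c * root k).

Let root_in k : (k < K)%N -> cpair (root k) \in roots.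
Proof. by move=> kK; rewrite mem_undup; apply/mapP; exists k; rewrite // mem_iota. Qed.

Let measurable_set1_pair (y : R * R) : measurable [set y].
Proof.
rewrite (_ : [set y] = [set y.1] `*` [set y.2]); first exact: measurableX.
by apply/seteqP; split=> [_ ->|[u v] [/= -> ->]]//; case: y.
Qed.

(** [rs_uniform] holds for every g, in particular for the indicator of the complement of the set of
    roots, whose average over the roots is 0. *)
Lemma root_step_in_roots : {ae P, forall w j, cpair (xi j w) \in roots}.
Proof.
apply: ae_foralln => j.
have mZ : measurable [set` roots].
  rewrite (_ : [set` roots] = \bigcup_(y in [set` roots]) [set y]).
    by apply: fin_bigcup_measurable => // y _; exact: measurable_set1_pair.
  by apply/seteqP; split=> [y yZ|y [z zZ ->]]//; exists y.
have mN : measurable ((cpair \o xi j) @^-1` (~` [set` roots])).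
  by rewrite -[X in measurable X]setTI; apply: (rs_measurable hxi) => //; exact: measurableC.
exists ((cpair \o xi j) @^-1` (~` [set` roots])); split => //.
have := rs_uniform hxi j (fun z => (\1_(~` [set` roots]) (cpair z))%:C).
rewrite cexpectationE (_ : _ \o _ = fun w => (\1_((cpair \o xi j) @^-1` (~` [set` roots])) w)%:C)//.
rewrite cintegral_indic// big1 ?mulr0.
  move=> [E]; rewrite -[LHS]fineK ?fin_num_measure//; congr (_%:E); exact: E.
move=> k _; rewrite indicE memNset//= => h; apply: h; exact: root_in.
Qed.

Lemma normc_root_step : {ae P, forall w j, nc (xi j w) = nc b}.
Proof.
apply: filterS root_step_in_roots => w h j; have := h j.
rewrite mem_undup => /mapP[k _ /cpair_inj ->].
by rewrite Normc.normcM normc_cexp iM_real/= expR0 mulr1.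
Qed.

Let g (c : R[i]) (y : R * R) := cexp (c * (y.1 +i* y.2)).

Let finite_comb_step c : {ae P, forall w j, finite_comb roots (g c) (cpair (xi j w)) = cexp (c * xi j w)}.
Proof.
apply: filterS root_step_in_roots => w h j.
by rewrite finite_combE ?undup_uniq// /g cpairK.
Qed.

(** Almost surely the exponential of a step agrees with a finite combination of indicators of the
    roots, to which the product formula applies with an empty family of extra events. The mean of
    one factor is again read off [rs_uniform]. *)
Lemma cintegral_cexp_sum_steps c k :
  cintegral P (fun w => cexp (c * \sum_(j < k) xi j w)) = root_average c ^+ k.
Proof.
have mxi j := rs_measurable hxi j.
pose p y := fine (P ((cpair \o xi 0%N) @^-1` [set y])).
have hp j y : fine (P ((cpair \o xi j) @^-1` [set y])) = p y.
  have mj i : measurable ((cpair \o xi i) @^-1` [set y]).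
    by rewrite -[X in measurable X]setTI; exact: mxi.
  have E i : (fine (P ((cpair \o xi i) @^-1` [set y])))%:C =
      cexpectation P ((fun z => (\1_[set y] (cpair z))%:C) \o xi i).
    by rewrite cexpectationE -cintegral_indic.
  have := etrans (E j) (rs_uniform hxi j _).
  by rewrite -(etrans (E 0%N) (rs_uniform hxi 0%N _)) => -[].
have measG j A : sigma_of (cpair \o xi j) A -> measurable A.
  by move=> [B mB <-]; rewrite -[X in measurable X]setTI; exact: mxi.
have := @indep_prod_cintegral _ T R P _ _ (rs_independent hxi) measG _ _
  (fun j => cpair \o xi j) id (@inj_id _) mxi (fun j B mB => ex_intro2 _ _ B mB erefl)
  roots (g c) p k fset0 (fun=> set0) measurable_set1_pair hp.
have -> : \bigcap_(i in [set` (fset0 : {fset nat})]) set0 = [set: T].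
  by apply/seteqP; split => // w _ i /=; rewrite in_fset0.
rewrite big_seq_fset0 mul1r => H.
have <- : \sum_(y <- roots) g c y * (p y)%:C = root_average c.
  have := rs_uniform hxi 0%N (fun z => finite_comb roots (g c) (cpair z)).
  rewrite cexpectationE => E.
  transitivity (cintegral P ((fun z => finite_comb roots (g c) (cpair z)) \o xi 0%N)).
    pose f y w := (\1_((cpair \o xi 0%N) @^-1` [set y]) w)%:C : R[i].
    have m0 y : measurable ((cpair \o xi 0%N) @^-1` [set y]).
      by rewrite -[X in measurable X]setTI; exact: mxi.
    have iF y : cintegrable P (f y).
      apply: (@bounded_cintegrable _ _ _ _ _ 1).
        by apply: cmeas_real; exact: measurable_indic.
      by move=> w; rewrite normc_real indicE; case: (_ \in _); rewrite ?normr1 ?normr0.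
    rewrite (_ : _ \o _ = fun w => \sum_(y <- roots) g c y * f y w)//.
    rewrite cintegral_sum; last by move=> y; exact: cintegrableZ.
    by apply: eq_bigr => y _; rewrite cintegralZ// cintegral_indic.
  rewrite E /root_average; congr (_ * _); apply: eq_bigr => i _.
  by rewrite finite_combE ?undup_uniq ?root_in// /g cpairK.
rewrite -H//; apply: ae_eq_cintegral.
- apply: cmeas_cexp; apply: cmeasM; first exact: cmeas_cst.
  exact: cmeas_sum.
- apply: cmeasM; first by apply: cmeas_real; exact: measurable_indic.
  apply: (@cmeas_prod _ _ _ (fun j w => finite_comb roots (g c) (cpair (xi j w)))) => j.
  exact: (cmeas_finite_comb _ _ (mxi j)).
- apply: filterS (finite_comb_step c) => w h; rewrite indicT mul1r mulr_sumr cexp_sum.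
  by apply: eq_bigr => j _; rewrite h.
Qed.

End root_law.

Section stopped_walk.
Context d (T : measurableType d) (R : realType) (P : probability T R).
Variables (K : nat) (b : R[i]) (xi : nat -> T -> R[i]) (n : nat) (S : T -> R).
Hypotheses (K0 : (0 < K)%N) (n0 : (0 < n)%N) (hxi : root_steps P K b xi).
Hypotheses (mS : measurable_fun setT S) (S0 : forall w, 0 <= S w).
Hypothesis hindep : walk_indep_subordinator P K xi n S.
Hypothesis expS : forall a, P.-integrable setT (fun w => (expR (a * S w))%:E).

Let tau w := Num.truncn (n%:R * S w).
Let scale : R := n%:R `^ (- K%:R^-1).

Let nR0 : (0 : R) < n%:R. Proof. by rewrite ltr0n. Qed.

Lemma measurable_truncn_preimage (c : R) k : 0 <= c ->
  measurable [set x : R | Num.truncn (c * x) = k].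
Proof.
move=> c0; have mle (r : R) : measurable [set x : R | r <= c * x].
  have mc : measurable_fun setT (fun x : R => c * x).
    by apply: measurable_funM; [exact: measurable_cst|exact: measurable_id].
  have := mc measurableT _ (measurable_itv `[r, +oo[); rewrite setTI.
  by congr measurable; apply/seteqP; split=> x /=; rewrite in_itv/= andbT.
have mgt j : measurable [set x : R | (j < Num.truncn (c * x))%N].
  by under eq_set do rewrite truncn_gt_nat; exact: mle.
rewrite (_ : [set x | _] = [set x : R | (k.-1 < Num.truncn (c * x))%N || (k == 0%N)]
    `&` ~` [set x : R | (k < Num.truncn (c * x))%N]).
  apply: measurableI; last exact: measurableC.
  case: k => [|k] /=; last by under eq_set do rewrite orbF; exact: mgt.
  by under eq_set do rewrite orbT; rewrite (_ : [set x | _] = setT)//; apply/seteqP.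
apply/seteqP; split=> x /=.
  by move=> <-; rewrite ltnn; split => //; case: (Num.truncn _) => //= t; rewrite ltnSn.
move=> [h1 /negP]; rewrite -leqNgt => h2; apply/eqP; rewrite eqn_leq h2.
by case: k h1 {h2} => //= k; rewrite orbF.
Qed.

Let mtau k : measurable (tau @^-1` [set k]).
Proof.
have := mS measurableT (measurable_truncn_preimage k (ltW nR0)).
by rewrite setTI.
Qed.

Let sum_step k w : R[i] := \sum_(j < k) xi j w.

Let msum k : cmeas (sum_step k).
Proof. by apply: cmeas_sum => j; exact: (rs_measurable hxi). Qed.

Let swalk k w : R[i] := scale%:C * sum_step k w.

Lemma stopped_walkE w : walk K xi n (S w) w = scale%:C * sum_step (tau w) w.
Proof. by []. Qed.

Lemma cmeas_stopped_walk : cmeas (fun w => walk K xi n (S w) w).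
Proof.
apply: cmeasM; first exact: cmeas_cst.
exact: (@measurable_nat_comp _ _ _ _ tau (fun k => cpair \o sum_step k) mtau msum).
Qed.

(* The sum of the first k steps is a multiple of the walk at time k / n. *)
Lemma indep_tau_sum k (B : set (R * R)) : measurable B ->
  P (tau @^-1` [set k] `&` (cpair \o swalk k) @^-1` B) =
  (P (tau @^-1` [set k]) * P ((cpair \o swalk k) @^-1` B))%E.
Proof.
move=> mB; pose A c : set T := if c then
  (cpair \o swalk k) @^-1` B else tau @^-1` [set k].
have /(_ [fset true; false]%fset A) := hindep; rewrite big_fsetU1/= ?inE// big_seq_fset1 /A /=.
rewrite muleC (_ : \bigcap_(i in _) _ = tau @^-1` [set k] `&`
    (cpair \o swalk k) @^-1` B); last first.
  apply/seteqP; split=> [w h|w [h1 h2] [] _]//.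
  by split; [have := h false; rewrite /= !inE; apply|have := h true; rewrite /= !inE; apply].
apply => -[_|_] /=; last first.
  exists [set x : R | Num.truncn (n%:R * x) = k] => //.
  exact: measurable_truncn_preimage.
apply: sub_sigma_algebra; exists (k%:R / n%:R); first by rewrite /= divr_ge0.
exists B => //; rewrite /walk mulrC divfK ?gt_eqF//.
by rewrite natrK.
Qed.

Lemma sum_step_le : {ae P, forall w k, nc (sum_step k w) <= nc b * k%:R}.
Proof.
apply: filterS (normc_root_step hxi) => w h k.
rewrite (le_trans (normc_sum _ _))//; under eq_bigr do rewrite h.
by rewrite sumr_const card_ord mulr_natr.
Qed.

Lemma tau_le w : (tau w)%:R <= n%:R * S w.
Proof. by rewrite truncn_le mulr_ge0. Qed.

Lemma root_average_le c : nc (root_average K b c) <= expR (nc c * nc b).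
Proof.
rewrite /root_average Normc.normcM.
have -> : nc (K%:R^-1 : R[i]) = K%:R^-1.
  by rewrite (_ : K%:R^-1 = (K%:R^-1)%:C) ?normc_real ?ger0_norm// rmorphV ?rmorph_nat ?unitfE ?pnatr_eq0 -?lt0n.
rewrite ler_pdivrMl ?ltr0n// (le_trans (normc_sum _ _))//.
apply: (@le_trans _ _ (\sum_(k < K) expR (nc c * nc b))); last by rewrite sumr_const card_ord mulr_natl.
apply: ler_sum => k _; rewrite normc_cexp ler_expR.
rewrite (le_trans (ler_norm _))// (le_trans (Re_le_normc _))// !Normc.normcM.
by rewrite normc_cexp iM_real/= expR0 mulr1.
Qed.

(** Up to time S at most n S steps of modulus |b| are made, so the integrand is dominated by an
    exponential of S. *)
Lemma cintegrable_cexp_stopped_walk z :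
  cintegrable P (fun w => cexp (z * walk K xi n (S w) w)).
Proof.
apply: (le_ae_cintegrable _ (expS (nc z * scale * nc b * n%:R))).
  by apply: cmeas_cexp; apply: cmeasM; [exact: cmeas_cst|exact: cmeas_stopped_walk].
apply: filterS sum_step_le => w h; rewrite normc_cexp ler_expR.
rewrite (le_trans (ler_norm _))// (le_trans (Re_le_normc _))// Normc.normcM stopped_walkE.
rewrite normc_real_mul ger0_norm ?powR_ge0// -!mulrA.
rewrite ler_wpM2l ?normc_ge0// ler_wpM2l ?powR_ge0// (le_trans (h _))//.
by rewrite ler_wpM2l ?normc_ge0// tau_le.
Qed.

Lemma cintegrable_root_average_tau c :
  cintegrable P (fun w => root_average K b c ^+ tau w).
Proof.
apply: (le_cintegrable _ (expS (nc c * nc b * n%:R))).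
  exact: (@measurable_nat_comp _ _ _ _ tau (fun k => cpair \o (fun=> root_average K b c ^+ k))
    mtau (fun k => cmeas_cst _)).
move=> w; rewrite normcX (@le_trans _ _ (expR (nc c * nc b) ^+ tau w))//.
  by rewrite lerXn2r ?nnegrE ?normc_ge0 ?expR_ge0// root_average_le.
rewrite -expRM_natl ler_expR mulrC -[leRHS]mulrA ler_wpM2l ?mulr_ge0 ?normc_ge0//.
exact: tau_le.
Qed.

(** On the event [tau] = k the stopped walk is a sum of k steps, which is independent of that event
    and has the k-th power of a one-step mean as expectation; summing over k restores [tau] in the
    exponent. *)
Lemma stopped_walk_cf z :
  cintegral P (fun w => cexp (z * walk K xi n (S w) w)) =
  cintegral P (fun w => root_average K b (z * scale%:C) ^+ tau w).
Proof.
apply: (@eq_cintegral_nat _ _ _ P tau mtau).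
- exact: cintegrable_cexp_stopped_walk.
- exact: cintegrable_root_average_tau.
move=> k; transitivity (cintegral P (fun w => (\1_(tau @^-1` [set k]) w)%:C *
    cexp (z * swalk k w))).
  apply: eq_cintegral => w; rewrite indicE; case: (boolP (w \in _)) => [|_].
    by rewrite inE /= => <-; rewrite stopped_walkE.
  by rewrite !mul0r.
pose g (y : R * R) := cexp (z * (y.1 +i* y.2)).
have mg : cmeas g.
  apply: cmeas_cexp; apply: cmeasM; first exact: cmeas_cst.
  by apply/cmeasP; split; [exact: measurable_fst|exact: measurable_snd].
have mW : cmeas (swalk k).
  by apply: cmeasM; [exact: cmeas_cst|exact: msum].
have gE w : g ((cpair \o swalk k) w) = cexp (z * swalk k w).
  by rewrite /g cpairK.
have ig : cintegrable P (g \o (cpair \o swalk k)).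
  apply: (@le_ae_cintegrable _ _ _ _ _ (cst (expR (nc z * scale * (nc b * k%:R))))).
  - exact: (measurableT_comp mg mW).
  - exact: finite_measure_integrable_cst.
  - apply: filterS sum_step_le => w h; have -> : (g \o (cpair \o swalk k)) w = cexp (z * swalk k w) := gE w.
    rewrite normc_cexp ler_expR.
    rewrite (le_trans (ler_norm _))// (le_trans (Re_le_normc _))// Normc.normcM.
    rewrite normc_real_mul ger0_norm ?powR_ge0// -mulrA.
    by rewrite ler_wpM2l ?normc_ge0// ler_wpM2l ?powR_ge0// h.
have := indep_cintegral (mtau k) mW (@indep_tau_sum k) mg ig.
under eq_cintegral do rewrite gE.
under [X in _ = _ * X -> _]eq_cintegral do rewrite gE.
move=> ->.
have -> : cintegral P (fun w => cexp (z * swalk k w)) =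
    root_average K b (z * scale%:C) ^+ k.
  rewrite -(cintegral_cexp_sum_steps hxi).
  by apply: eq_cintegral => w; rewrite mulrA.
rewrite -(@cintegral_indic _ _ _ P)// mulrC -cintegralZ.
  apply: eq_cintegral => w; rewrite indicE; case: (boolP (w \in _)) => [|_].
    by rewrite inE /= => <-; rewrite mulrC.
  by rewrite mul0r mulr0.
apply: (@bounded_cintegrable _ _ _ _ _ 1); first by apply: cmeas_real; exact: measurable_indic.
by move=> w; rewrite normc_real indicE; case: (_ \in _); rewrite ?normr1 ?normr0.
Qed.

End stopped_walk.

(** By x^(k+1) - y^(k+1) = x (x^k - y^k) + (x - y) y^k; since M >= 1, the exponent k - 1 of the
    sharp bound may be raised to k. *)
Lemma expr_dist_le (R : realType) (x y : R[i]) (M : R) k : nc x <= M -> nc y <= M -> 1 <= M ->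
  nc (x ^+ k - y ^+ k) <= k%:R * nc (x - y) * M ^+ k.
Proof.
move=> xM yM M1; have M0 : 0 <= M by rewrite (le_trans ler01).
elim: k => [|k IH]; first by rewrite !expr0 subrr Normc.normc0 !mul0r.
have -> : x ^+ k.+1 - y ^+ k.+1 = x * (x ^+ k - y ^+ k) + (x - y) * y ^+ k.
  by rewrite !exprS; ring.
rewrite (le_trans (normcD_le _ _))// !Normc.normcM normcX.
rewrite -natr1 !mulrDl mul1r lerD//.
  rewrite (@le_trans _ _ (M * (k%:R * nc (x - y) * M ^+ k)))//.
    by rewrite ler_pM ?normc_ge0.
  by rewrite exprS mulrCA.
rewrite ler_wpM2l ?normc_ge0// (@le_trans _ _ (M ^+ k))//.
  by rewrite lerXn2r ?nnegrE ?normc_ge0.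
by rewrite exprS ler_peMl// exprn_ge0.
Qed.

Section characteristic_function_estimate.
Context d (T : measurableType d) (R : realType) (P : probability T R).
Variables (L : nat) (b : R[i]) (xi : nat -> T -> R[i]) (n : nat) (S : T -> R).
Let K := (2 * L)%N.
Hypotheses (L0 : (0 < L)%N) (n0 : (0 < n)%N) (hxi : root_steps P K b xi).
Hypothesis hb : b ^+ K = (-1) ^+ L.+1 * (K`!)%:R.
Hypotheses (mS : measurable_fun setT S) (S0 : forall w, 0 <= S w).
Hypothesis hindep : walk_indep_subordinator P K xi n S.
Hypothesis expS : forall a, P.-integrable setT (fun w => (expR (a * S w))%:E).

Let K0 : (0 < K)%N. Proof. by rewrite muln_gt0. Qed.
Let nR0 : (0 : R) < n%:R. Proof. by rewrite ltr0n. Qed.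
Let scale : R := n%:R `^ (- K%:R^-1).
Let scale0 : 0 <= scale. Proof. exact: powR_ge0. Qed.

Let scaleK : scale ^+ K = n%:R^-1.
Proof.
rewrite -powR_mulrn// -powRrM mulNr mulVf ?pnatr_eq0 -?lt0n//.
by rewrite powR_inv1.
Qed.

Let scale1 : scale <= 1.
Proof.
rewrite -(@ler_pXn2r _ K)// ?nnegrE// scaleK expr1n invf_le1//.
by rewrite ler1n.
Qed.

Let minus_i (y : R) : R[i] := - ('i%C * y%:C).

Let minus_iK y : minus_i y ^+ K = ((-1) ^+ L * y ^+ K)%:C.
Proof.
have E : minus_i y ^+ 2 = (- y ^+ 2)%:C.
  rewrite /minus_i sqrrN iM_real expr2; apply: ReIm_eq; rewrite ?cReM ?cImM /=.
    by rewrite mulr0 sub0r expr2.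
  by rewrite mulr0 mul0r addr0.
rewrite /K exprM E -rmorphXn; congr (_%:C).
by rewrite exprM; exact: exprNn.
Qed.

(** With K = 2L, (- i y)^K = (-1)^L y^K, and the sign (-1)^(L+1) in b^K leaves exactly - y^K / n
    after division by K!. The remainder carries scale^(2K) = n^(-2). *)
Lemma root_average_dist (y : R) :
  nc (root_average K b (minus_i y * scale%:C) - (1 - y ^+ K / n%:R)%:C) <=
  (`|y| * nc b) ^+ (2 * K) * expR (`|y| * nc b) / n%:R ^+ 2.
Proof.
set u := minus_i y * scale%:C * b.
have ncu : nc u = `|y| * nc b * scale.
  rewrite /u /minus_i !Normc.normcM normcN_eq Normc.normcM !normc_real (ger0_norm scale0).
  have -> : nc ('i%C : R[i]) = 1 by rewrite /= expr0n add0r expr1n sqrtr1.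
  by rewrite mul1r mulrAC.
have := root_average_cexp K0 u.
have -> : 1 + ((K`!)%:R^-1)%:C * u ^+ K = (1 - y ^+ K / n%:R)%:C.
  have -> : u ^+ K = (- (y ^+ K / n%:R) * (K`!)%:R)%:C.
    rewrite /u !exprMn minus_iK hb -rmorphXn/= scaleK.
    have -> : (-1) ^+ L.+1 * (K`!)%:R = ((-1) ^+ L.+1 * (K`!)%:R)%:C :> R[i].
      by rewrite rmorphM rmorphXn rmorphN1 rmorph_nat.
    rewrite -!rmorphM/=; congr (_%:C); rewrite exprS.
    have := sqrr_sign R L; rewrite expr2; move: ((-1) ^+ L) => e ee.
    transitivity (- (e * e) * (y ^+ K / n%:R * (K`!)%:R)); first by ring.
    by rewrite ee; ring.
  rewrite -rmorphM -(rmorph1 (real_complex R)) -rmorphD; congr (_%:C).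
  by rewrite mulrC mulfK// pnatr_eq0 -lt0n fact_gt0.
rewrite /root_average.
under [X in nc (_ * X - _) <= _ -> _]eq_bigr do rewrite /u -mulrA.
move=> /le_trans; apply; rewrite ncu exprMn (mulnC 2%N) (exprM scale) scaleK exprVn.
rewrite mulrAC ler_wpM2r ?invr_ge0 ?sqr_ge0// ler_wpM2l ?exprn_ge0 ?mulr_ge0 ?normc_ge0//.
by rewrite ler_expR ler_piMr// mulr_ge0 ?normc_ge0.
Qed.

Lemma root_average_exp_dist (y A : R) : `|y| <= A ->
  nc (root_average K b (minus_i y * scale%:C) - (expR (- (y ^+ K / n%:R)))%:C) <=
  ((A * nc b) ^+ (2 * K) * expR (A * nc b) + A ^+ (2 * K)) / n%:R ^+ 2.
Proof.
move=> yA; have A0 : 0 <= A by apply: le_trans yA.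
have th0 : 0 <= y ^+ K / n%:R by rewrite divr_ge0// exprM exprn_ge0 ?sqr_ge0.
have -> : root_average K b (minus_i y * scale%:C) - (expR (- (y ^+ K / n%:R)))%:C =
  (root_average K b (minus_i y * scale%:C) - (1 - y ^+ K / n%:R)%:C) -
  (expR (- (y ^+ K / n%:R)) - 1 + y ^+ K / n%:R)%:C.
  have E : (1 - y ^+ K / n%:R)%:C + (expR (- (y ^+ K / n%:R)) - 1 + y ^+ K / n%:R)%:C =
      (expR (- (y ^+ K / n%:R)))%:C.
    by rewrite -rmorphD/=; congr (_%:C); ring.
  by rewrite -addrA -opprD E.
rewrite (le_trans (normcB_le _ _))// mulrDl lerD//.
  rewrite (le_trans (root_average_dist _))// ler_wpM2r ?invr_ge0 ?sqr_ge0//.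
  have h : `|y| * nc b <= A * nc b by rewrite ler_wpM2r ?normc_ge0.
  by rewrite ler_pM ?expR_ge0 ?exprn_ge0 ?mulr_ge0 ?normc_ge0 ?ler_expR//
    lerXn2r ?nnegrE ?mulr_ge0 ?normc_ge0.
rewrite normc_real (le_trans (expRN_taylor2 th0))// exprMn exprVn.
rewrite ler_wpM2r ?invr_ge0 ?sqr_ge0// -exprM mulnC.
by rewrite (le_trans (ler_norm _))// normrX lerXn2r ?nnegrE.
Qed.

(** Divided by n^2, this bounds the error of a single step, uniformly for |y| <= A. *)
Definition cf_constant (A : R) : R :=
  (A * nc b) ^+ (2 * K) * expR (A * nc b) + A ^+ (2 * K).

Let cf_constant_ge0 A : 0 <= A -> 0 <= cf_constant A.
Proof.
by move=> A0; rewrite addr_ge0 ?mulr_ge0 ?exprn_ge0 ?expR_ge0// mulr_ge0 ?normc_ge0.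
Qed.

Let tau w := Num.truncn (n%:R * S w).

(** Two errors add up. Replacing the one-step mean by e^(- y^K / n) in each of at most n S factors
    costs (B / n) S e^(B S), where S <= e^S merges the last two factors. Replacing [tau] / n by S
    costs at most A^K / n. *)
Lemma root_average_power_dist (y A : R) w : `|y| <= A ->
  nc (root_average K b (minus_i y * scale%:C) ^+ tau w - (expR (- (y ^+ K * S w)))%:C) <=
  cf_constant A / n%:R * expR ((cf_constant A + 1) * S w) + A ^+ K / n%:R.
Proof.
move=> yA; have A0 : 0 <= A by apply: le_trans yA.
have B0 := cf_constant_ge0 A0; set B := cf_constant A in B0 *.
have yK0 : 0 <= y ^+ K by rewrite exprM exprn_ge0 ?sqr_ge0.
have yKA : y ^+ K <= A ^+ K by rewrite (le_trans (ler_norm _))// normrX lerXn2r ?nnegrE.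
have th0 : 0 <= y ^+ K / n%:R by rewrite divr_ge0.
set phi := root_average _ _ _; set q := expR (- (y ^+ K / n%:R)).
have phiq : nc (phi - q%:C) <= B / n%:R ^+ 2 := root_average_exp_dist yA.
have q1 : q <= 1 by exact: expRN_le1.
have q0 : 0 <= q by exact: expR_ge0.
have BM : B / n%:R ^+ 2 <= B / n%:R.
  rewrite ler_wpM2l// lef_pV2 ?posrE ?exprn_gt0// expr2 ler_pMl//.
  by rewrite ler1n.
(* The one-step mean may exceed 1 in modulus, but not M, and M to the power [tau] is at most e^(B
   S). *)
pose M := expR (B / n%:R).
have M1 : 1 <= M by rewrite -[leLHS]expR0 ler_expR divr_ge0.
have MB : 1 + B / n%:R <= M by exact: expR_ge1Dx.
have phiM : nc phi <= M.
  have -> : phi = (phi - q%:C) + q%:C by rewrite subrK.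
  rewrite (le_trans (normcD_le _ _))// normc_real ger0_norm//.
  by move: phiq BM MB q1; lra.
have qM : nc q%:C <= M by rewrite normc_real ger0_norm// (le_trans q1).
have tS : (tau w)%:R <= n%:R * S w.
  by rewrite truncn_le mulr_ge0.
have tS' : n%:R * S w < (tau w)%:R + 1 by rewrite natr1 truncnS_gt.
have -> : phi ^+ tau w - (expR (- (y ^+ K * S w)))%:C =
   (phi ^+ tau w - q%:C ^+ tau w) + (q ^+ tau w - expR (- (y ^+ K * S w)))%:C.
  by rewrite rmorphB/= rmorphXn/=; ring.
rewrite (le_trans (normcD_le _ _))// lerD//.
  rewrite (le_trans (expr_dist_le _ phiM qM M1))//.
  apply: (@le_trans _ _ ((n%:R * S w) * (B / n%:R ^+ 2) * expR (B * S w))).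
    have M0 : 0 <= M by exact: expR_ge0.
    apply: ler_pM; [by rewrite mulr_ge0 ?normc_ge0|exact: exprn_ge0| |].
      by apply: ler_pM; rewrite ?normc_ge0.
    rewrite /M -expRM_natl ler_expR mulrCA ler_wpM2l// ler_pdivrMr//.
    by rewrite mulrC.
  have -> : n%:R * S w * (B / n%:R ^+ 2) * expR (B * S w) = B / n%:R * (S w * expR (B * S w)).
    by field; rewrite gt_eqF.
  rewrite ler_wpM2l ?divr_ge0//.
  have -> : (B + 1) * S w = S w + B * S w by ring.
  rewrite expRD ler_wpM2r ?expR_ge0//.
  by rewrite (le_trans _ (expR_ge1Dx _))// lerDr.
rewrite normc_real /q -expRM_natl mulrN mulrC.
have -> : y ^+ K / n%:R * (tau w)%:R = y ^+ K * ((tau w)%:R / n%:R) by rewrite mulrAC mulrA.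
set t := (tau w)%:R / n%:R.
have tle : t <= S w by rewrite ler_pdivrMr// mulrC.
have tge : S w - t <= n%:R^-1.
  rewrite lerBlDr -div1r -mulrDl ler_pdivlMr// mulrC addrC ltW//.
have t0 : 0 <= t by rewrite divr_ge0.
have -> : expR (- (y ^+ K * t)) - expR (- (y ^+ K * S w)) =
    expR (- (y ^+ K * t)) * (1 - expR (- (y ^+ K * (S w - t)))).
  by rewrite mulrBr mulr1 -expRD; congr (_ - expR _); ring.
rewrite normrM ger0_norm ?expR_ge0// -[leRHS]mul1r ler_pM ?expR_ge0//.
  by rewrite expRN_le1// mulr_ge0.
rewrite distrC (le_trans (expRN_taylor1 _)) ?mulr_ge0 ?subr_ge0//.
by rewrite ler_pM ?subr_ge0.
Qed.

(** The exponential moment on the right is finite for each S separately; uniformity over different S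
    is not claimed, in accordance with the order of the two limits. *)
Lemma stopped_walk_cf_dist (y A : R) : `|y| <= A ->
  nc (cintegral P (fun w => cexp (minus_i y * walk K xi n (S w) w)) -
      (\int[P]_w expR (- (y ^+ K * S w)))%:C) <=
  (cf_constant A * \int[P]_w expR ((cf_constant A + 1) * S w) + A ^+ K) / n%:R.
Proof.
move=> yA; rewrite (stopped_walk_cf K0 n0 hxi mS S0 hindep expS) -/scale.
rewrite -cintegral_real.
have i1 : cintegrable P (fun w => root_average K b (minus_i y * scale%:C) ^+ tau w).
  exact: cintegrable_root_average_tau.
have e2 : P.-integrable setT (EFin \o (fun w => expR (- (y ^+ K * S w)))).
  by have := expS (- y ^+ K); apply: eq_integrable => // w _ /=; rewrite mulNr.
have i2 : cintegrable P (fun w => (expR (- (y ^+ K * S w)))%:C).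
  by split => //=; exact: integrable0.
rewrite -cintegralB//.
have ih : P.-integrable setT (EFin \o (fun w =>
    cf_constant A / n%:R * expR ((cf_constant A + 1) * S w) + A ^+ K / n%:R)).
  have h1 : P.-integrable setT (EFin \o cst (A ^+ K / n%:R)) by exact: finite_measure_integrable_cst.
  have h2 := integrableZl measurableT (cf_constant A / n%:R) (expS (cf_constant A + 1)).
  by have := integrableD measurableT h2 h1; apply: eq_integrable.
apply: (le_trans (normc_cintegral_le (cintegrableB i1 i2) ih _)).
  by move=> w; exact: root_average_power_dist.
rewrite le_eqVlt; apply/orP; left; apply/eqP.
have h2 : P.-integrable setT (EFin \o (fun w => cf_constant A / n%:R * expR ((cf_constant A + 1) * S w))).
  by have := integrableZl measurableT (cf_constant A / n%:R) (expS (cf_constant A + 1)); apply: eq_integrable.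
rewrite RintegralD//; last exact: finite_measure_integrable_cst.
rewrite RintegralZl//; last exact: expS.
rewrite Rintegral_cst// [RHS]mulrDl [X in _ = X + _]mulrAC; congr (_ + _).
by rewrite (_ : fine _ = 1) ?mulr1//; have /(congr1 fine) := probability_setT P.
Qed.

End characteristic_function_estimate.

(** * Complex limits and expectations of inverse transforms *)

Lemma ccvgP (R : realType) (u : nat -> R[i]) (l : R[i]) :
  ccvg u l <-> nc (u n - l) @[n --> \oo] --> (0 : R).
Proof.
have normE (z : R[i]) : `|z| = (nc z)%:C by [].
split=> [/cvgrPdist_le H|/cvgrPdist_le H].
  apply/cvgrPdist_le => e e0; have e0' : 0 < e%:C by rewrite ltcR.
  apply: filterS (H _ e0') => n; rewrite normE lecR => h.
  by rewrite sub0r normrN ger0_norm ?normc_ge0// distcC.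
(* A positive element of R[i] has imaginary part 0 and positive real part, so real bounds
   suffice. *)
apply/cvgrPdist_le => -[r i]; rewrite ltcE /= => /andP[/eqP -> r0].
apply: filterS (H _ r0) => n; rewrite sub0r normrN ger0_norm ?normc_ge0// distcC => h.
by rewrite normE lecR.
Qed.

Lemma ccvg_le (R : realType) (u : nat -> R[i]) (l : R[i]) (c : nat -> R) :
  (\forall n \near \oo, nc (u n - l) <= c n) -> c n @[n --> \oo] --> 0 -> ccvg u l.
Proof.
move=> uc c0; apply/ccvgP.
apply: (@squeeze_cvgr _ _ _ _ (cst 0) c) => //; last exact: cvg_cst.
by apply: filterS uc => n ->; rewrite normc_ge0.
Qed.

Section expectation_of_inverse_fourier.
Context d (T : measurableType d) (R : realType) (P : probability T R).
Variables (F : R -> R[i]) (A : R) (W : T -> R[i]) (H : T -> R).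
Local Notation leb := (@lebesgue_measure R).
Hypotheses (iF : cintegrable leb F) (FA : forall y, A < `|y| -> F y = 0).
Hypotheses (mW : cmeas W) (iH : P.-integrable setT (EFin \o H)).
Hypothesis WH : {ae P, forall w, expR (A * nc (W w)) <= H w}.

Let kernel (V : T -> R[i]) (x : R) (w : T) (y : R) : R[i] :=
  cexp (- ('i%C * (x%:C + V w) * y%:C)) * F y.

Let cmeas_kernel V x : cmeas V ->
  cmeas (fun z : T * R => kernel V x z.1 z.2).
Proof.
move=> mV; have mF : cmeas F := cintegrable_meas iF.
apply: cmeasM; last exact: (measurableT_comp mF (@measurable_snd _ _ T R)).
apply: cmeas_cexp; apply: cmeasN; apply: cmeasM.
  apply: cmeasM; first exact: cmeas_cst.
  apply: cmeasD; first exact: cmeas_cst.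
  exact: (measurableT_comp mV (@measurable_fst _ _ T R)).
by apply: cmeas_real; exact: measurable_snd.
Qed.

Let kernelE V x w y : kernel V x w y =
  cexp (- ('i%C * x%:C * y%:C)) * cexp (- ('i%C * y%:C) * V w) * F y.
Proof. by rewrite /kernel -cexpD; congr (cexp _ * _); ring. Qed.

Let normc_kernel V x w y : nc (kernel V x w y) <= expR (A * nc (V w)) * nc (F y).
Proof.
rewrite kernelE !Normc.normcM !normc_cexp.
have -> : Re (- ('i%C * x%:C * y%:C)) = 0.
  by rewrite -mulrA -rmorphM iM_real /= oppr0.
rewrite expR0 mul1r; have [yA|yA] := leP `|y| A; last by rewrite FA// Normc.normc0 !mulr0.
rewrite ler_wpM2r ?normc_ge0// ler_expR (le_trans (ler_norm _))//.
rewrite (le_trans (Re_le_normc _))// Normc.normcM normcN_eq iM_real.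
have -> : nc (0 +i* y) = `|y| by rewrite /= expr0n add0r sqrtr_sqr.
by rewrite ler_wpM2r ?normc_ge0.
Qed.

(* Fubini's bound has to hold everywhere, hence W is set to 0 off this event. *)
Let good : set T := [set w | expR (A * nc (W w)) <= H w].

Let mgood : measurable good.
Proof.
have mH : measurable_fun setT H by case/integrableP: iH => /measurable_EFinP.
have : measurable_fun setT (fun w => H w - expR (A * nc (W w))).
  apply: measurable_funB => //; apply: measurableT_comp => //.
  by apply: measurable_funM; [exact: measurable_cst|exact: cmeas_normc].
move=> /(_ measurableT _ (measurable_itv `[0, +oo[)); rewrite setTI.
by congr measurable; apply/seteqP; split=> w /=; rewrite in_itv/= andbT subr_ge0.
Qed.

Let W' w : R[i] := (\1_good w)%:C * W w.

Let mW' : cmeas W'.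
Proof. by apply: cmeasM => //; apply: cmeas_real; exact: measurable_indic. Qed.

Let WW' : {ae P, forall w, W w = W' w}.
Proof. by apply: filterS WH => w h; rewrite /W' indicE mem_set// mul1r. Qed.

(** On the support of F the kernel is at most e^(A |W|) |F y| in modulus, and H makes this
    integrable over the product space; Fubini then exchanges expectation and frequency integral. *)
Lemma cexpectation_inverse_fourier x :
  cintegral P (fun w => inverse_fourier F (x%:C + W w)) =
  ((2 * pi)^-1)%:C * cintegral leb (fun y => cexp (- ('i%C * x%:C * y%:C)) *
    cintegral P (fun w => cexp (- ('i%C * y%:C) * W w)) * F y).
Proof.
have cmI V : cmeas V -> cmeas (fun w => cintegral leb (kernel V x w)).
  move=> mV; have := @cmeas_cintegral_snd _ _ T (measurableTypeR R) R leb
    (fun z => kernel V x z.1 z.2).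
  by apply; exact: cmeas_kernel.
transitivity (cintegral P (fun w => ((2 * pi)^-1)%:C * cintegral leb (kernel W' x w))).
  apply: ae_eq_cintegral.
  - by apply: cmeasM; [exact: cmeas_cst|exact: cmI].
  - by apply: cmeasM; [exact: cmeas_cst|exact: cmI].
  - by apply: filterS WW' => w E; rewrite /inverse_fourier /kernel E.
(* Off [good] the modified variable is 0 and the exponential is 1, which accounts for the added
   1. *)
have iH' : P.-integrable setT (EFin \o (fun w => `|H w| + 1)).
  have h1 : P.-integrable setT (EFin \o cst (1 : R)) by exact: finite_measure_integrable_cst.
  by have := integrableD measurableT (integrable_norm iH) h1; apply: eq_integrable.
have bound w y : nc (kernel W' x w y) <= (`|H w| + 1) * nc (F y).
  rewrite (le_trans (normc_kernel _ _ _ _))// ler_wpM2r ?normc_ge0// /W' indicE.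
  case: (boolP (w \in good)) => [|_] /=.
    by rewrite inE mul1r => h; rewrite (le_trans h)// (le_trans (ler_norm _))// lerDl.
  by rewrite mul0r Normc.normc0 mulr0 expR0 lerDr.
have mk := cmeas_kernel x mW'.
have := @cfubini _ _ T (measurableTypeR R) R P leb (fun z => kernel W' x z.1 z.2) _ _
  mk iH' (cintegrable_normc iF) bound.
have iK w : cintegrable leb (kernel W' x w).
  have mkw : cmeas (kernel W' x w).
    exact: (measurableT_comp mk (pair1_measurable w)).
  have ib : leb.-integrable setT (EFin \o (fun y => (`|H w| + 1) * nc (F y))).
    by have := integrableZl measurableT (`|H w| + 1) (cintegrable_normc iF); apply: eq_integrable.
  exact: (le_cintegrable_lebesgue mkw ib).
rewrite cintegralZ; last first.
  have ib : P.-integrable setT (EFin \o (fun w => (\int[leb]_y nc (F y)) * (`|H w| + 1))).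
    by have := integrableZl measurableT (\int[leb]_y nc (F y)) iH'; apply: eq_integrable.
  apply: (le_cintegrable (cmI _ mW') ib) => w; rewrite mulrC -RintegralZl//; last exact: cintegrable_normc.
  apply: normc_cintegral_le => //.
  by have := integrableZl measurableT (`|H w| + 1) (cintegrable_normc iF); apply: eq_integrable.
move=> /= ->; congr (_ * _); apply: eq_cintegral => y.
have [yA|yA] := leP `|y| A; last first.
  rewrite FA// mulr0; under eq_cintegral do rewrite /kernel FA// mulr0.
  by rewrite (cintegral_real P (cst 0)) /Rintegral integral0.
have mexp (V : T -> R[i]) : cmeas V -> cmeas (fun w : T => cexp (- ('i%C * y%:C) * V w)).
  by move=> mV; apply: cmeas_cexp; apply: cmeasM => //; exact: cmeas_cst.
under eq_cintegral do rewrite kernelE mulrAC.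
rewrite cintegralZ; last first.
  apply: (le_cintegrable (mexp _ mW') iH') => w.
  rewrite normc_cexp (@le_trans _ _ (expR (A * nc (W' w))))//.
    rewrite ler_expR (le_trans (ler_norm _))// (le_trans (Re_le_normc _))//.
    rewrite Normc.normcM normcN_eq iM_real.
    have -> : nc (0 +i* y) = `|y| by rewrite /= expr0n add0r sqrtr_sqr.
    by rewrite ler_wpM2r ?normc_ge0.
  rewrite /W' indicE; case: (boolP (w \in good)) => [|_] /=.
    by rewrite inE mul1r => h; rewrite (le_trans h)// (le_trans (ler_norm _))// lerDl.
  by rewrite mul0r Normc.normc0 mulr0 expR0 lerDr.
rewrite mulrAC; congr (_ * _ * _); apply: ae_eq_cintegral.
- exact: mexp.
- exact: mexp.
- by apply: filterS WW' => w E; rewrite E.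
Qed.

End expectation_of_inverse_fourier.

Lemma normc_fourier_phase (R : realType) (x y : R) :
  nc (cexp (- ('i%C * x%:C * y%:C))) = 1.
Proof.
rewrite normc_cexp; have -> : Re (- ('i%C * x%:C * y%:C)) = 0.
  by rewrite -mulrA -rmorphM iM_real /= oppr0.
exact: expR0.
Qed.

Lemma cmeas_fourier_phase (R : realType) (x : R) :
  cmeas (fun y : R => cexp (- ('i%C * x%:C * y%:C))).
Proof.
apply: cmeas_cexp; apply: cmeasN; apply: cmeasM; first exact: cmeas_cst.
by apply: cmeas_real; exact: measurable_id.
Qed.

(** * The two limits *)

Section inner_limit.
Context d (T : measurableType d) (R : realType) (P : probability T R).
Variables (L : nat) (b : R[i]) (xi : nat -> T -> R[i]) (S : T -> R).
Let K := (2 * L)%N.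
Hypotheses (L0 : (0 < L)%N) (hxi : root_steps P K b xi).
Hypothesis hb : b ^+ K = (-1) ^+ L.+1 * (K`!)%:R.
Hypotheses (mS : measurable_fun setT S) (S0 : forall w, 0 <= S w).
Hypothesis hindep : forall n, (1 <= n)%N -> walk_indep_subordinator P K xi n S.
Hypothesis expS : forall a, P.-integrable setT (fun w => (expR (a * S w))%:E).
Local Notation leb := (@lebesgue_measure R).
Variables (F : R -> R[i]) (A : R).
Hypotheses (iF : cintegrable leb F) (FA : forall y, A < `|y| -> F y = 0) (A0 : 0 <= A).

Definition stable_laplace (y : R) : R := \int[P]_w expR (- (y ^+ K * S w)).

Let K0 : (0 < K)%N. Proof. by rewrite muln_gt0. Qed.

Lemma measurable_stable_laplace : measurable_fun setT stable_laplace.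
Proof.
have := @measurable_Rintegral_snd _ _ (measurableTypeR R) T R P
  (fun z => expR (- (z.1 ^+ K * S z.2))).
apply; apply: measurableT_comp => //; apply: measurableT_comp => //.
apply: measurable_funM; first by apply: measurable_funX; exact: measurable_fst.
exact: (measurableT_comp mS (@measurable_snd _ _ _ _)).
Qed.

Lemma stable_laplace_itv y : 0 <= stable_laplace y <= 1.
Proof.
have e2 : P.-integrable setT (EFin \o (fun w => expR (- (y ^+ K * S w)))).
  by have := expS (- y ^+ K); apply: eq_integrable => // w _ /=; rewrite mulNr.
rewrite /stable_laplace; apply/andP; split.
  by apply: Rintegral_ge0 => w _; exact: expR_ge0.
have h1 : P.-integrable setT (EFin \o cst (1 : R)) by exact: finite_measure_integrable_cst.
apply: (@le_trans _ _ (\int[P]_w (cst (1 : R)) w)).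
  apply: le_Rintegral => // w _; apply: expRN_le1; rewrite mulr_ge0//.
  by rewrite exprM exprn_ge0 ?sqr_ge0.
by rewrite Rintegral_cst// mul1r (_ : fine _ = 1)//; have /(congr1 fine) := probability_setT P.
Qed.

Let nR_cvg0 : (n%:R^-1 : R) @[n --> \oo] --> (0 : R).
Proof.
by have := @cvg_natr_powRN R 1 ltr01; under eq_fun do rewrite powRN powRr1//.
Qed.

Let cf n (y : R) : R[i] := cintegral P (fun w => cexp (- ('i%C * y%:C) * walk K xi n (S w) w)).

Let cmeas_cf n : (0 < n)%N -> cmeas (cf n).
Proof.
move=> n0; have mW := cmeas_stopped_walk n0 hxi mS.
have := @cmeas_cintegral_snd _ _ (measurableTypeR R) T R P
  (fun z => cexp (- ('i%C * z.1%:C) * walk K xi n (S z.2) z.2)).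
apply; apply: cmeas_cexp; apply: cmeasM.
  apply: cmeasN; apply: cmeasM; first exact: cmeas_cst.
  by apply: cmeas_real; exact: measurable_fst.
exact: (measurableT_comp mW (@measurable_snd _ _ _ _)).
Qed.

Let D : R := cf_constant L b A * \int[P]_w expR ((cf_constant L b A + 1) * S w) + A ^+ K.

(** The distance of the characteristic functions is at most D / n on the whole support of F, so the
    inverse transforms differ by a multiple of 1 / n. *)
Lemma inner_limit (x : R) :
  ccvg (fun n => cintegral P (fun w => inverse_fourier F (x%:C + walk K xi n (S w) w)))
    (inverse_fourier (multiplier F stable_laplace) x%:C).
Proof.
apply: (@ccvg_le _ _ _ (fun n => ((2 * pi)^-1 * (D * \int[leb]_y nc (F y))) * n%:R^-1)); last first.
  rewrite -[X in _ --> X](mulr0 ((2 * pi)^-1 * (D * \int[leb]_y nc (F y)))).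
  by apply: cvgM; [exact: cvg_cst|exact: nR_cvg0].
near=> n; have n0 : (0 < n)%N by near: n; exact: nbhs_infty_gt.
have mW := cmeas_stopped_walk n0 hxi mS.
have mF : cmeas F := cintegrable_meas iF.
(* The dominating variable comes from |W| <= n^(-1/K) |b| n S, which holds almost surely, and from
   the exponential moments of S. *)
rewrite (@cexpectation_inverse_fourier _ _ _ P F A _
  (fun w => expR (A * (n%:R `^ (- K%:R^-1) * (nc b * n%:R)) * S w)) iF FA mW (expS _)); last first.
  apply: filterS (sum_step_le hxi) => w h; rewrite ler_expR -mulrA ler_wpM2l//.
  rewrite /walk normc_real_mul ger0_norm ?powR_ge0// -mulrA ler_wpM2l ?powR_ge0//.
  rewrite (le_trans (h _))// -mulrA ler_wpM2l ?normc_ge0// truncn_le mulr_ge0//.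
pose e (y : R) := cexp (- ('i%C * x%:C * y%:C)).
have nce y : nc (e y) = 1 by exact: normc_fourier_phase.
have me : cmeas e by exact: cmeas_fourier_phase.
have dist y : nc ((cf n y - (stable_laplace y)%:C) * F y) <= D / n%:R * nc (F y).
  rewrite Normc.normcM; have [yA|yA] := leP `|y| A; last by rewrite FA// Normc.normc0 !mulr0.
  rewrite ler_wpM2r ?normc_ge0//.
  exact: (stopped_walk_cf_dist L0 n0 hxi hb mS S0 (hindep n0) expS yA).
have m1 : cmeas (fun y => e y * cf n y * F y).
  by apply: cmeasM => //; apply: cmeasM => //; exact: cmeas_cf.
have i2 : cintegrable leb (fun y => e y * multiplier F stable_laplace y).
  have ms := measurable_stable_laplace.
  have m2 : cmeas (fun y => e y * multiplier F stable_laplace y).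
    by apply: cmeasM => //; apply: cmeasM => //; exact: cmeas_real.
  apply: (le_cintegrable_lebesgue m2 (cintegrable_normc iF)) => y.
  rewrite Normc.normcM nce mul1r normc_real_mul -[leRHS]mul1r ler_wpM2r ?normc_ge0//.
  by have /andP[h1 h2] := stable_laplace_itv y; rewrite ger0_norm.
have idiff : cintegrable leb (fun y => e y * ((cf n y - (stable_laplace y)%:C) * F y)).
  have ib : leb.-integrable setT (EFin \o (fun y => D / n%:R * nc (F y))).
    by have := integrableZl measurableT (D / n%:R) (cintegrable_normc iF); apply: eq_integrable.
  apply: (le_cintegrable_lebesgue _ ib).
    apply: cmeasM => //; apply: cmeasM => //; apply: cmeasB; first exact: cmeas_cf.
    by apply: cmeas_real; exact: measurable_stable_laplace.
  by move=> y; rewrite Normc.normcM nce mul1r.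
have E y : e y * cf n y * F y = e y * ((cf n y - (stable_laplace y)%:C) * F y)
    + e y * multiplier F stable_laplace y.
  by rewrite /multiplier; ring.
rewrite /inverse_fourier -mulrBr.
rewrite (_ : cintegral leb _ - cintegral leb _ =
    cintegral leb (fun y => e y * ((cf n y - (stable_laplace y)%:C) * F y))); last first.
  rewrite (_ : cintegral leb _ = cintegral leb (fun y =>
      e y * ((cf n y - (stable_laplace y)%:C) * F y) + e y * multiplier F stable_laplace y)).
    by rewrite (cintegralD idiff i2) addrK.
  by apply: eq_cintegral => y; exact: E.
rewrite normc_real_mul.
rewrite ger0_norm ?invr_ge0 ?mulr_ge0 ?pi_ge0// -mulrA ler_wpM2l ?invr_ge0 ?mulr_ge0 ?pi_ge0//.
rewrite mulrAC -RintegralZl//; last exact: cintegrable_normc.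
apply: normc_cintegral_le => //.
  by have := integrableZl measurableT (D / n%:R) (cintegrable_normc iF); apply: eq_integrable.
by move=> y; rewrite Normc.normcM nce mul1r.
Unshelve. all: by end_near. Qed.

End inner_limit.

Section outer_limit.
Variable R : realType.
Local Notation leb := (@lebesgue_measure R).

Lemma inverse_fourier_multiplier_cvg (F : R -> R[i]) (k_ : nat -> R -> R) (k : R -> R) (x : R) :
  cintegrable leb F -> (forall m, measurable_fun setT (k_ m)) -> measurable_fun setT k ->
  (forall m y, `|k_ m y| <= 1) -> (forall y, `|k y| <= 1) ->
  (forall y, k_ m y @[m --> \oo] --> k y) ->
  ccvg (fun m => inverse_fourier (multiplier F (k_ m)) x%:C)
       (inverse_fourier (multiplier F k) x%:C).
Proof.
move=> iF mk_ mk k_1 k1 kc; have mF : cmeas F := cintegrable_meas iF.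
have me := cmeas_fourier_phase x.
have ik (h : R -> R) : measurable_fun setT h -> (forall y, `|h y| <= 1) ->
    cintegrable leb (fun y => cexp (- ('i%C * x%:C * y%:C)) * multiplier F h y).
  move=> mh h1; have m2 : cmeas (fun y => cexp (- ('i%C * x%:C * y%:C)) * multiplier F h y).
    by apply: cmeasM => //; apply: cmeasM => //; exact: cmeas_real.
  apply: (le_cintegrable_lebesgue m2 (cintegrable_normc iF)) => y.
  by rewrite Normc.normcM normc_fourier_phase mul1r normc_real_mul -[leRHS]mul1r ler_wpM2r ?normc_ge0.
have mFn := cmeas_normc mF.
have id2 : leb.-integrable setT (EFin \o (fun y => 2 * nc (F y))).
  by have := integrableZl measurableT 2 (cintegrable_normc iF); apply: eq_integrable.
pose g m (y : R) : \bar R := (`|k_ m y - k y| * nc (F y))%:E.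
have mgr m : measurable_fun setT (fun y => `|k_ m y - k y| * nc (F y)).
  apply: measurable_funM => //.
  by apply: measurableT_comp => //; exact: measurable_funB.
have mg m : measurable_fun setT (g m) by exact/measurable_EFinP.
have g2 m y : `|k_ m y - k y| * nc (F y) <= 2 * nc (F y).
  rewrite ler_wpM2r ?normc_ge0// (le_trans (ler_normB _ _))//.
  by rewrite (_ : 2 = 1 + 1)// lerD.
have ig m : leb.-integrable setT (g m).
  have [] // : cintegrable leb (fun y => (`|k_ m y - k y| * nc (F y))%:C).
  apply: (le_cintegrable_lebesgue (cmeas_real (mgr m)) id2) => y.
  by rewrite normc_real ger0_norm ?g2 ?mulr_ge0 ?normc_ge0.
have [] := @dominated_convergence _ _ _ leb setT measurableT g (cst 0%E)
   (EFin \o (fun y => 2 * nc (F y))) mg _ _ id2 _ => //.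
- apply: filterE => y _; apply: cvg_EFin; first exact: nearW.
  rewrite -[X in _ --> X](mul0r (nc (F y))); apply: cvgM; last exact: cvg_cst.
  rewrite -(normr0 R) -[X in `|X|](subrr (k y)); apply: cvg_norm; apply: cvgB => //.
  exact: cvg_cst.
- apply: filterE => y m _ /=; rewrite lee_fin ger0_norm ?g2//.
  by rewrite mulr_ge0 ?normc_ge0.
move=> _ _; rewrite integral0 => /fine_cvg H.
apply: (@ccvg_le _ _ _ (fun m => (2 * pi)^-1 * \int[leb]_y (`|k_ m y - k y| * nc (F y)))); last first.
  by rewrite -[X in _ --> X](mulr0 (2 * pi)^-1); apply: cvgM; [exact: cvg_cst|exact: H].
apply: nearW => m; rewrite /inverse_fourier -mulrBr normc_real_mul.
rewrite ger0_norm ?invr_ge0 ?mulr_ge0 ?pi_ge0// ler_wpM2l ?invr_ge0 ?mulr_ge0 ?pi_ge0//.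
rewrite -(cintegralB (ik _ (mk_ m) (k_1 m)) (ik _ mk k1)); apply: normc_cintegral_le.
- by apply: cintegrableB; exact: ik.
- exact: ig.
move=> y; rewrite -mulrBr Normc.normcM normc_fourier_phase mul1r /multiplier -mulrBl.
by rewrite -rmorphB normc_real_mul.
Qed.

(** Convergence of m^(2a) (1 - L) forces L to tend to 1, so the extra factor L due to Y_0
    disappears; in the exponent the intensity 1 / Gamma (1 - a) cancels the Gamma factor of that
    limit. *)
Lemma subordinator_laplace_cvg (a s theta : R) : 0 < a < 1 -> 0 <= theta ->
  jump_laplace a m theta * expR ((Gamma (1 - a))^-1 * s * m%:R `^ (2 * a) * (jump_laplace a m theta - 1))
    @[m --> \oo] --> expR (- (s * theta `^ a)).
Proof.
move=> a01 th0; have [a0 a1] := andP a01.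
have G0 := Gamma_gt0 a01.
have J := jump_laplace_cvg a01 th0.
have c1 : jump_laplace a m theta @[m --> \oo] --> (1 : R).
  have a2 : 0 < 2 * a by rewrite mulr_gt0.
  have := cvgM (cvg_natr_powRN a2) J; rewrite mul0r => H0.
  rewrite -[X in _ --> X](subr0 (1 : R)).
  have H1 : (1 - m%:R `^ (- (2 * a)) * (m%:R `^ (2 * a) *
      (1 - \int[leb]_y (jump_density a m y * expR (- (theta * y / m%:R))))))
      @[m --> \oo] --> (1 - 0 : R).
    by apply: cvgB; [exact: cvg_cst|exact: (H0 _)].
  apply: cvg_trans H1; apply: near_eq_cvg; near=> m.
  have m0 : (0 : R) < m%:R `^ (2 * a) by apply: powR_gt0; rewrite ltr0n; near: m; exact: nbhs_infty_gt.
  by rewrite /= powRN mulrA mulVf ?gt_eqF// mul1r opprB addrC subrK.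
rewrite -[X in _ --> X]mul1r; apply: cvgM => //.
suff H : (Gamma (1 - a))^-1 * s * m%:R `^ (2 * a) * (jump_laplace a m theta - 1)
    @[m --> \oo] --> - (s * theta `^ a).
  by apply: (cvg_comp _ _ H); exact: continuous_expR.
have -> : - (s * theta `^ a) = - ((Gamma (1 - a))^-1 * s) * (Gamma (1 - a) * theta `^ a).
  by field; rewrite gt_eqF.
have HJ : - ((Gamma (1 - a))^-1 * s) * (m%:R `^ (2 * a) * (1 - jump_laplace a m theta))
    @[m --> \oo] --> - ((Gamma (1 - a))^-1 * s) * (Gamma (1 - a) * theta `^ a).
  by apply: cvgM; [exact: cvg_cst|exact: J].
apply: cvg_trans HJ; apply: near_eq_cvg; near=> m.
by move: (jump_laplace a m theta) => l; ring.
Unshelve. all: by end_near. Qed.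

End outer_limit.

Section nonnegative_version.
Context d (T : measurableType d) (R : realType) (P : probability T R).
Variables (S : T -> R).
Hypothesis mS : measurable_fun setT S.

(* The subordinator is only almost surely nonnegative; replacing it by its positive
   part does not change the stopped walk, because truncn is 0 on negative reals. *)
Lemma truncn_max0 (n : nat) (x : R) : Num.truncn (n%:R * Num.max 0 x) = Num.truncn (n%:R * x).
Proof.
have [x0|x0] := leP 0 x; first by [].
rewrite mulr0 truncn0; apply/esym/truncn0Pn.
by rewrite -ltNge (le_lt_trans _ ltr01)// mulr_ge0_le0 ?(ltW x0).
Qed.

Lemma walk_max0 K (xi : nat -> T -> R[i]) n w :
  walk K xi n (Num.max 0 (S w)) w = walk K xi n (S w) w.
Proof. by rewrite /walk truncn_max0. Qed.

(** The positive part is a function of S, hence generates a smaller sigma-algebra. *)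
Lemma walk_indep_max0 K (xi : nat -> T -> R[i]) n : walk_indep_subordinator P K xi n S ->
  walk_indep_subordinator P K xi n (fun w => Num.max 0 (S w)).
Proof.
move=> H J A GA; apply: H => -[] cJ; have := GA _ cJ => //= -[B mB <-].
exists (Num.max 0 @^-1` B) => //.
rewrite -[X in measurable X]setTI; exact: measurable_maxr.
Qed.

End nonnegative_version.

Section positive_subordinator.
Context d (T : measurableType d) (R : realType) (P : probability T R).
Variables (a s : R) (m : nat) (X : {RV P >-> nat}) (Y : nat -> {RV P >-> R}).
Hypotheses (a01 : 0 < a < 1) (s0 : 0 <= s) (m2 : (2 <= m)%N).
Hypothesis hXY : subordinator_data a s m X Y.

Let S w := Num.max 0 (subordinator m X Y w).

Lemma measurable_max_subordinator : measurable_fun setT S.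
Proof. by apply: measurable_maxr => //; exact: measurable_subordinator. Qed.

Lemma max_subordinator_laplaceE theta :
  (\int[P]_w (expR (- (theta * S w)))%:E = (jump_laplace a m theta *
    expR ((Gamma (1 - a))^-1 * s * m%:R `^ (2 * a) * (jump_laplace a m theta - 1)))%:E)%E.
Proof.
rewrite -(subordinator_laplaceE a01 s0 m2 hXY); apply: ae_eq_integral => //.
- apply/measurable_EFinP; apply: measurableT_comp => //; apply: measurableT_comp => //.
  by apply: measurable_funM => //; exact: measurable_max_subordinator.
- apply/measurable_EFinP; apply: measurableT_comp => //; apply: measurableT_comp => //.
  by apply: measurable_funM => //; exact: measurable_subordinator.
- by apply: filterS (subordinator_ge0 hXY) => w h _; rewrite /S max_r.
Qed.

Lemma integrable_exp_max_subordinator c : P.-integrable setT (fun w => (expR (c * S w))%:E).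
Proof.
apply/integrableP; split.
  apply/measurable_EFinP; apply: measurableT_comp => //.
  by apply: measurable_funM => //; exact: measurable_max_subordinator.
rewrite (_ : (\int[P]_w _ = \int[P]_w (expR (- (- c * S w)))%:E)%E).
  by rewrite max_subordinator_laplaceE ltry.
by apply: eq_integral => w _; rewrite mulNr opprK /= ger0_norm ?expR_ge0.
Qed.

End positive_subordinator.

(** With alpha = 1 / (2M) and theta = y^(2MN) the limit exponent theta^alpha is |y|^N, the symbol of
    B^N. *)
Lemma powR_root_normX (R : realType) (M N : nat) (y : R) : (0 < M)%N ->
  (y ^+ (2 * M * N)) `^ ((2 * M)%:R^-1) = `|y| ^+ N.
Proof.
move=> M0; have -> : y ^+ (2 * M * N) = (`|y| ^+ N) ^+ (2 * M).
  rewrite -exprM mulnCA [(N * M)%N]mulnC -mulnA !(exprM _ 2%N).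
  by rewrite real_normK ?num_real.
rewrite -powR_mulrn ?exprn_ge0// -powRrM divff ?powRr1 ?exprn_ge0//.
by rewrite pnatr_eq0 muln_eq0 negb_or/= -lt0n.
Qed.

Theorem theorem12 (R : realType) (N M : nat) (hN : (1 <= N)%N) (hM : (1 <= M)%N)
  (* the initial datum *)
  (f : R[i] -> R[i]) (fhat : R -> R[i])
  (hfhat : L2 fhat)
  (hsupp : exists A : R,
     {ae @lebesgue_measure R, forall y, A < `|y| -> fhat y = 0})
  (hf : forall z : R[i], f z = inverse_fourier fhat z)
  (hfL2 : L2 (fun x : R => f x%:C))
  (* the semigroup exp(- t B^N) *)
  (T : R -> (R -> R[i]) -> (R -> R[i]))
  (hT : generated_by_opp_BN N T)
  (* beta and a fixed K-th root b of it, K = 2MN *)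
  (beta b : R[i])
  (hbeta : beta = (-1) ^+ (M * N).+1 * ((2 * M * N)`!)%:R)
  (hb : b ^+ (2 * M * N) = beta)
  (* the random walk and the approximate subordinators *)
  (d : measure_display) (Omega : measurableType d) (P : probability Omega R)
  (xi : nat -> Omega -> R[i])
  (hxi : root_steps P (2 * M * N) b xi)
  (X : R -> nat -> {RV P >-> nat}) (Y : R -> nat -> nat -> {RV P >-> R})
  (hXY : forall (s : R) (m : nat), 0 <= s -> (2 <= m)%N ->
     subordinator_data ((2 * M)%:R^-1) s m (X s m) (Y s m))
  (hindep : forall (s : R) (m n : nat), 0 <= s -> (2 <= m)%N -> (1 <= n)%N ->
     walk_indep_subordinator P (2 * M * N) xi n
       (subordinator m (X s m) (Y s m)))
  (t0 : R) :
  exists u : R -> R -> R[i],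
    (forall t x : R, t0 <= t ->
       iterated_lim
         (fun m n => cexpectation P (fun w =>
            f (x%:C +
               walk (2 * M * N) xi n
                 (subordinator m (X (t - t0) m) (Y (t - t0) m) w) w)))
         (u t x)) /\
    (forall t : R, t0 <= t ->
       aeeq (u t) (T (t - t0) (fun x : R => f x%:C))).
Proof.
have [A' hA'] := hsupp; pose A := Num.max 0 A'.
have A0 : 0 <= A by rewrite le_max lexx.
(* The support condition on [fhat] holds almost everywhere, whereas the estimates use it at every
   y. *)
pose F y := fhat y * (\1_(`[(- A), A] : set R) y)%:C.
have FA y : A < `|y| -> F y = 0.
  move=> yA; rewrite /F indicE memNset ?mulr0//= in_itv/= -ler_norml.
  by rewrite leNgt yA.
have mfhat := hfhat.1.
have mF : cmeas F.
  by apply: cmeasM => //; apply: cmeas_real; exact: measurable_indic.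
have F2 : L2 F.
  apply: (L2_le mF hfhat) => y; rewrite /F mulrC normc_real_mul.
  rewrite -[leRHS]mul1r ler_wpM2r ?normc_ge0// indicE.
  by case: (_ \in _); rewrite ?normr1 ?normr0.
have iF : cintegrable (@lebesgue_measure R) F := L2_cintegrable F2 FA.
have fhatF : aeeq fhat F.
  apply: filterS hA' => y h; rewrite /F indicE.
  case: (boolP (y \in _)) => [_|]; first by rewrite mulr1.
  rewrite notin_setE /= in_itv/= -ler_norml => /negP; rewrite -ltNge => Ay.
  by rewrite mulr0 h// (le_lt_trans _ Ay)// le_max lexx orbT.
have fE z : f z = inverse_fourier F z.
  have mphase : cmeas (fun y : R => cexp (- ('i%C * z * y%:C))).
    apply: cmeas_cexp; apply: cmeasN; apply: cmeasM; first exact: cmeas_cst.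
    by apply: cmeas_real; exact: measurable_id.
  rewrite hf /inverse_fourier; congr (_ * _); apply: ae_eq_cintegral.
  - exact: cmeasM.
  - exact: cmeasM.
  - by apply: filterS fhatF => y ->.
have fr : (fun x : R => f x%:C) = ift F.
  by apply/funext => x; rewrite fE inverse_fourier_real.
set K := (2 * M * N)%N in hb hbeta hxi hindep *.
have KE : K = (2 * (M * N))%N by rewrite /K mulnA.
have L0 : (0 < M * N)%N by rewrite muln_gt0 hM.
pose a : R := (2 * M)%:R^-1.
have a01 : 0 < a < 1.
  rewrite invr_gt0 ltr0n muln_gt0 hM/= invf_lt1 ?ltr0n ?muln_gt0 ?hM//.
  by rewrite ltr1n (leq_trans (ltnSn 1))// -[X in (X <= _)%N]muln1 leq_mul2l hM orbT.
pose k (s : R) (y : R) := expR (- (s * `|y| ^+ N)).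
(* A definite representative: the iterated limit is claimed at every x, the identity with the
   semigroup only almost everywhere. *)
exists (fun t x => ift (multiplier F (k (t - t0))) x); split; last first.
  move=> t tt0; have s0 : 0 <= t - t0 by rewrite subr_ge0.
  by rewrite fr; exact: (semigroup_multiplier A0 F2 FA hT s0).
move=> t x tt0; have s0 : 0 <= t - t0 by rewrite subr_ge0.
set s := t - t0 in s0 *.
pose S m w := Num.max 0 (subordinator m (X s m) (Y s m) w).
pose v m := inverse_fourier (multiplier F (stable_laplace P (M * N) (S m))) x%:C.
exists v; split.
  move=> m m2; have D := hXY s m s0 m2.
  have mS : measurable_fun setT (S m) by exact: measurable_max_subordinator.
  have S0 w : 0 <= S m w by rewrite le_max lexx.
  have expS c := integrable_exp_max_subordinator a01 s0 m2 D c.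
  have hi n : (1 <= n)%N -> walk_indep_subordinator P (2 * (M * N)) xi n (S m).
    by move=> n1; rewrite -KE; apply: walk_indep_max0; exact: hindep.
  have hb' : b ^+ (2 * (M * N)) = (-1) ^+ (M * N).+1 * ((2 * (M * N))`!)%:R.
    by rewrite -KE hb hbeta.
  have hxi' : root_steps P (2 * (M * N)) b xi by rewrite -KE.
  have := inner_limit L0 hxi' hb' mS S0 hi expS iF FA A0 (x := x).
  congr (ccvg _ _); apply/funext => n; rewrite cexpectationE -KE; apply: eq_cintegral => w.
  by rewrite fE walk_max0.
rewrite -inverse_fourier_real.
(* Below m = 2 there is no information on the subordinator; substituting the limit there makes the
   bounds required by dominated convergence valid for every m. *)
pose k_ m : R -> R := if (2 <= m)%N then stable_laplace P (M * N) (S m) else k s.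
have mk : measurable_fun setT (k s).
  apply: measurableT_comp => //; apply: measurableT_comp => //.
  by apply: measurable_funM => //; apply: measurable_funX; exact: normr_measurable.
have k1 y : `|k s y| <= 1.
  by rewrite ger0_norm ?expR_ge0// expRN_le1// mulr_ge0// exprn_ge0.
have H : ccvg (fun m => inverse_fourier (multiplier F (k_ m)) x%:C)
    (inverse_fourier (multiplier F (k s)) x%:C).
  apply: inverse_fourier_multiplier_cvg => //.
  - move=> m; rewrite /k_; case: (boolP (2 <= m)%N) => [m2|_ //].
    apply: measurable_stable_laplace.
    exact: measurable_max_subordinator.
  - move=> m y; rewrite /k_; case: (boolP (2 <= m)%N) => [m2|_ //]; have D := hXY s m s0 m2.
    have S0 w : 0 <= S m w by rewrite le_max lexx.
    have expS c := integrable_exp_max_subordinator a01 s0 m2 D c.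
    by have /andP[h1 h2] := stable_laplace_itv (M * N) S0 expS y; rewrite ger0_norm.
  - move=> y; have th0 : 0 <= y ^+ K by rewrite KE exprM exprn_ge0 ?sqr_ge0.
    have := subordinator_laplace_cvg (s := s) a01 th0; rewrite powR_root_normX//.
    apply: cvg_trans; apply: near_eq_cvg; near=> m.
    have m2 : (2 <= m)%N by near: m; exact: nbhs_infty_ge.
    rewrite /k_ m2 /stable_laplace -KE /Rintegral.
    by rewrite (max_subordinator_laplaceE a01 s0 m2 (hXY s m s0 m2)).
apply/ccvgP; move/ccvgP: H; apply: cvg_trans; apply: near_eq_cvg; near=> m.
have m2 : (2 <= m)%N by near: m; exact: nbhs_infty_ge.
by rewrite /k_ m2.
Unshelve. all: by end_near. Qed.
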